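(* Let $1<p_0\le p_1<\infty$, as well as $\gamma_0,\gamma_1,\Theta,\theta\in\mathbb{R}$ with $\gamma_0\ge\gamma_1$ be such that $$\gamma_0-\frac{2}{p_0}\ge\gamma_1-\frac{2}{p_1}.$$ Then $H^{\gamma_0}_{p_0,\Theta p_0,\theta p_0}(\mathcal{D})\hookrightarrow H^{\gamma_1}_{p_1,\Theta p_1,\theta p_1}(\mathcal{D})$, i.e., the first space is contained in the second and the embedding is bounded.
   Context: Fix $0<\kappa<2\pi$ and let $\mathcal{D}=\{(r\cos\phi,r\sin\phi)\in\mathbb{R}^2: r>0,\ 0<\phi<\kappa\}$. $\mathbb{N}=\{1,2,\dots\}$, $\mathbb{N}_0=\mathbb{N}\cup\{0\}$. $\mathscr{D}'(\mathcal{O})$ is the space of (complex) distributions on a domain $\mathcal{O}$; for $s>0$, $u(s\,\cdot)$ is the pullback of $u$ under $x\mapsto sx$. $H^\gamma_p(\mathbb{R}^d)$ is the usual Bessel potential space with norm $\|(1-\Delta)^{\gamma/2}f\|_{L_p(\mathbb{R}^d)}$. Resolutions: for a domain $\mathcal{O}\subsetneq\mathbb{R}^d$, a closed nonempty set $M\subset\partial\mathcal{O}$ and $c>1$, $\mathscr{A}^{[L]}_c(\mathcal{O},M)$ is the set of sequences $\xi=(\xi_\nu)_{\nu\in\mathbb{Z}}$ of real-valued functions $\xi_\nu\in C^\infty(\overline{\mathcal{O}}\setminus M)$ such that: for some $k_0\in\mathbb{N}$ and all $\nu$, $\operatorname{supp}\xi_\nu\subset\{x\in\overline{\mathcal{O}}\setminus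 M: c^{\nu-k_0}<\operatorname{dist}(x,M)<c^{\nu+k_0}\}$; for every $\alpha\in\mathbb{N}_0^d$ there is $C_\alpha$ with $|\partial^\alpha\xi_\nu|\le C_\alpha c^{-|\alpha|\nu}$ for all $\nu$; and there is $\delta>0$ with $\sum_\nu\xi_\nu\ge\delta$ on $\mathcal{O}$. Such sequences exist. Spaces: let $1<p<\infty$, $\gamma,\Theta,\theta\in\mathbb{R}$. For a domain $\mathcal{O}\subsetneq\mathbb{R}^d$ and $\xi\in\mathscr{A}^{[L]}_c(\mathcal{O},\partial\mathcal{O})$, $H^\gamma_{p,\Theta}(\mathcal{O})$ is the set of $u\in\mathscr{D}'(\mathcal{O})$ with $\|u\mid H^\gamma_{p,\Theta}(\mathcal{O})\|:=\big(\sum_{\nu\in\mathbb{Z}}c^{\nu\Theta}\|(\xi_\nu u)(c^\nu\cdot)\mid H^\gamma_p(\mathbb{R}^d)\|^p\big)^{1/p}<\infty$ (with $\xi_\nu u$ extended by zero). For $\zeta\in\mathscr{A}^{[L]}_c(\mathcal{D},\{0\})$, $H^\gamma_{p,\Theta,\theta}(\mathcal{D})$ is the set of $u\in\mathscr{D}'(\mathcal{D})$ with $\|u\mid H^\gamma_{p,\Theta,\theta}(\mathcal{D})\|:=\big(\sum_{\nu\in\mathbb{Z}}c^{\nu\theta}\|(\zeta_\nu u)(c^\nu\cdot)\mid H^\gamma_{p,\Theta}(\mathcal{D})\|^p\big)^{1/p}<\infty$. Different choices of $c$, $\xi$, $\zeta$ give the same spaces with equivalent norms; one choice is fixed. *)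

(* Defs.v *)
From HB Require Import structures.
From mathcomp Require Import all_boot all_order all_algebra.
From mathcomp Require Import all_classical all_reals all_analysis.
From mathcomp Require Import complex.

Set Implicit Arguments.
Unset Strict Implicit.
Unset Printing Implicit Defensive.

Import Order.TTheory GRing.Theory Num.Theory.
Import numFieldNormedType.Exports.

Local Open Scope classical_set_scope.
Local Open Scope ring_scope.
Local Open Scope complex_scope.

(* The norm that the library puts on [R * R] is the maximum norm; it is used
   here only through its topology and its differential calculus. *)
Section Plane.
Context {R : realType}.

Definition enorm (x : R * R) : R := Num.sqrt (x.1 ^+ 2 + x.2 ^+ 2).

Definition edist_to (M : set (R * R)) (x : R * R) : R :=
  inf [set enorm (x - y) | y in M].

Definition boundary (A : set (R * R)) : set (R * R) :=
  closure A `\` interior A.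

Definition angular_domain (kappa : R) : set (R * R) :=
  [set x | exists r phi : R,
    [/\ 0 < r, 0 < phi < kappa & x = (r * cos phi, r * sin phi)]].

(* Multi-indices are pairs of natural numbers. *)
Definition mindex_size (a : nat * nat) : nat := (a.1 + a.2)%N.

Definition pderiv (a : nat * nat) (f : R * R -> R) : R * R -> R :=
  iter a.1 (fun g : R * R -> R => 'D_(1, 0) g)
    (iter a.2 (fun g : R * R -> R => 'D_(0, 1) g) f).

Definition smooth_on (O : set (R * R)) (f : R * R -> R) : Prop :=
  forall (a : nat * nat) (x : R * R), O x -> differentiable (pderiv a f) x.

(* C^oo(closure O \ M) for [O] open and [M] a set of boundary points: smooth
   in [O], and all derivatives extend continuously to closure O \ M, the
   extension of the zeroth one being [f] itself. *)
Definition smooth_upto (O M : set (R * R)) (f : R * R -> R) : Prop :=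
  [/\ smooth_on O f,
      {within closure O `\` M, continuous f} &
      forall a : nat * nat, exists g : R * R -> R,
        {within closure O `\` M, continuous g} /\
        (forall x, O x -> g x = pderiv a f x)].

(* The values of [xi nu] outside closure O \ M play no role.  The supremum
   bound on the derivatives is imposed on [O]; it passes to closure O \ M by
   continuity.  By the support condition the sum in the last clause is finite
   at every point of [O] as soon as [M] is a closed nonempty part of the
   boundary of the open set [O]. *)
Definition resolution (c : R) (O M : set (R * R))
    (xi : int -> R * R -> R) : Prop :=
  [/\ forall nu, smooth_upto O M (xi nu),
      exists k0 : nat, (0 < k0)%N /\
        forall (nu : int) (x : R * R),
          (closure O `\` M) x ->
          closure [set y | (closure O `\` M) y /\ xi nu y != 0] x ->
          c ^ (nu - k0%:Z) < edist_to M x < c ^ (nu + k0%:Z),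
      forall a : nat * nat, exists Ca : R, forall (nu : int) (x : R * R),
        O x -> `|pderiv a (xi nu) x| <= Ca * c ^ (- ((mindex_size a)%:Z * nu)) &
      exists delta : R, 0 < delta /\
        forall x, O x -> delta <= \sum_(nu \in [set: int]) xi nu x].

Definition Cpderiv (a : nat * nat) (f : R * R -> R[i]) (x : R * R) : R[i] :=
  pderiv a (fun y => complex.Re (f y)) x +i*
  pderiv a (fun y => complex.Im (f y)) x.

Definition Csmooth (f : R * R -> R[i]) : Prop :=
  smooth_on setT (fun x => complex.Re (f x)) /\
  smooth_on setT (fun x => complex.Im (f x)).

Definition supp (f : R * R -> R[i]) : set (R * R) :=
  closure [set x | f x != 0].

Definition test_function (O : set (R * R)) (phi : R * R -> R[i]) : Prop :=
  [/\ Csmooth phi, compact (supp phi) & supp phi `<=` O].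

Definition schwartz (phi : R * R -> R[i]) : Prop :=
  Csmooth phi /\
  forall (k : nat) (a : nat * nat), exists B : R, forall x : R * R,
    (1 + enorm x) ^+ k * Normc.normc (Cpderiv a phi x) <= B.

Definition linear_over (S : (R * R -> R[i]) -> Prop)
    (u : (R * R -> R[i]) -> R[i]) : Prop :=
  forall (b : R[i]) (phi psi : R * R -> R[i]), S phi -> S psi ->
    u (fun x => b * phi x + psi x) = b * u phi + u psi.

(* A (tempered) distribution is represented by a total functional of which
   only the values on test functions (Schwartz functions) are meaningful. *)
Definition distribution_on (O : set (R * R))
    (u : (R * R -> R[i]) -> R[i]) : Prop :=
  linear_over (test_function O) u /\
  forall K : set (R * R), compact K -> K `<=` O ->
    exists (N : nat) (B : R), forall (phi : R * R -> R[i]) (m : R),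
      test_function O phi -> supp phi `<=` K ->
      (forall (a : nat * nat) (x : R * R), (mindex_size a <= N)%N ->
        Normc.normc (Cpderiv a phi x) <= m) ->
      Normc.normc (u phi) <= B * m.

Definition tempered (T : (R * R -> R[i]) -> R[i]) : Prop :=
  linear_over schwartz T /\
  exists (N : nat) (B : R), forall (phi : R * R -> R[i]) (m : R),
    schwartz phi ->
    (forall (a : nat * nat) (x : R * R), (mindex_size a <= N)%N ->
      (1 + enorm x) ^+ N * Normc.normc (Cpderiv a phi x) <= m) ->
    Normc.normc (T phi) <= B * m.

Definition lebesgue2 := (@lebesgue_measure R \x @lebesgue_measure R)%E.

Definition Cintegral (f : R * R -> R[i]) : R[i] :=
  (\int[lebesgue2]_x complex.Re (f x)) +i* (\int[lebesgue2]_x complex.Im (f x)).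

Definition CLpnorm (p : R) (g : R * R -> R[i]) : \bar R :=
  Lnorm lebesgue2 p%:E (fun x => (Normc.normc (g x))%:E).

Definition CLp (p : R) (g : R * R -> R[i]) : Prop :=
  [/\ measurable_fun setT (fun x : measurableTypeR R * measurableTypeR R =>
        complex.Re (g x)),
      measurable_fun setT (fun x : measurableTypeR R * measurableTypeR R =>
        complex.Im (g x)) &
      (CLpnorm p g < +oo)%E].

Definition expi (t : R) : R[i] := cos t +i* sin t.

Definition dotp (x y : R * R) : R := x.1 * y.1 + x.2 * y.2.

Definition fourier (phi : R * R -> R[i]) (y : R * R) : R[i] :=
  ((2 * pi)^-1)%:C * Cintegral (fun x => expi (- dotp x y) * phi x).

Definition inv_fourier (phi : R * R -> R[i]) (x : R * R) : R[i] :=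
  ((2 * pi)^-1)%:C * Cintegral (fun y => expi (dotp x y) * phi y).

(* (1 - Delta)^(gamma/2) on Schwartz functions *)
Definition bessel_op (gamma : R) (phi : R * R -> R[i]) : R * R -> R[i] :=
  inv_fourier (fun y => ((1 + enorm y ^+ 2) `^ (gamma / 2))%:C * fourier phi y).

(* (1 - Delta)^(gamma/2) on tempered distributions, by transposition; its
   Fourier symbol is even, so no reflection occurs. *)
Definition bessel_dist (gamma : R) (T : (R * R -> R[i]) -> R[i]) :
    (R * R -> R[i]) -> R[i] :=
  fun phi => T (bessel_op gamma phi).

Definition represented_by (T : (R * R -> R[i]) -> R[i]) (g : R * R -> R[i]) :
    Prop :=
  forall phi, schwartz phi -> T phi = Cintegral (fun x => g x * phi x).

(* The norm of a distribution [F] on the whole plane.  [F] has at most one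
   tempered extension [T], and [g] is unique almost everywhere, so the infimum
   is over at most one value; it is [+oo] when [F] is not in the space. *)
Definition bessel_norm (gamma p : R) (F : (R * R -> R[i]) -> R[i]) : \bar R :=
  ereal_inf [set r : \bar R |
    exists (T : (R * R -> R[i]) -> R[i]) (g : R * R -> R[i]),
      [/\ tempered T,
          forall phi, test_function setT phi -> T phi = F phi,
          CLp p g,
          represented_by (bessel_dist gamma T) g &
          r = CLpnorm p g]].

Definition mul_dist (eta : R * R -> R) (u : (R * R -> R[i]) -> R[i]) :
    (R * R -> R[i]) -> R[i] :=
  fun phi => u (fun x => (eta x)%:C * phi x).

(* Extension by zero to the plane of the distribution [eta u] on [O]: here
   [eta phi], cut off outside [O], is a test function on [O] whenever [phi] is
   one on the plane. *)
Definition mul_dist_ext (O : set (R * R)) (eta : R * R -> R)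
    (u : (R * R -> R[i]) -> R[i]) : (R * R -> R[i]) -> R[i] :=
  fun phi => u (fun x => (\1_O x * eta x)%:C * phi x).

(* u(s .), i.e. <u(s .), phi> = s^-2 <u, phi(s^-1 .)> in dimension 2 *)
Definition dilate (s : R) (u : (R * R -> R[i]) -> R[i]) :
    (R * R -> R[i]) -> R[i] :=
  fun phi => (s ^- 2)%:C * u (fun x => phi (s^-1 *: x)).

Definition weighted_norm (O : set (R * R)) (c : R) (xi : int -> R * R -> R)
    (gamma p Theta : R) (u : (R * R -> R[i]) -> R[i]) : \bar R :=
  ((\esum_(nu in [set: int])
     ((c `^ (nu%:~R * Theta))%:E *
      bessel_norm gamma p (dilate (c ^ nu) (mul_dist_ext O (xi nu) u)) `^ p))
   `^ p^-1)%E.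

Definition mixed_norm (kappa c : R) (xi zeta : int -> R * R -> R)
    (gamma p Theta theta : R) (u : (R * R -> R[i]) -> R[i]) : \bar R :=
  ((\esum_(nu in [set: int])
     ((c `^ (nu%:~R * theta))%:E *
      weighted_norm (angular_domain kappa) c xi gamma p Theta
        (dilate (c ^ nu) (mul_dist (zeta nu) u)) `^ p))
   `^ p^-1)%E.

Definition mixed_space (kappa c : R) (xi zeta : int -> R * R -> R)
    (gamma p Theta theta : R) : set ((R * R -> R[i]) -> R[i]) :=
  [set u | distribution_on (angular_domain kappa) u /\
    (mixed_norm kappa c xi zeta gamma p Theta theta u < +oo)%E].

End Plane.

(* Main.v *)
From HB Require Import structures.
Require Import Defs.
From mathcomp Require Import all_boot all_order all_algebra.
From mathcomp Require Import all_classical all_reals all_analysis.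
From mathcomp Require Import measurable_realfun complex.
From mathcomp Require Import ring lra.

Set Implicit Arguments.
Unset Strict Implicit.
Unset Printing Implicit Defensive.

Import Order.TTheory GRing.Theory Num.Theory.
Import numFieldNormedType.Exports.

Local Open Scope classical_set_scope.
Local Open Scope ring_scope.

(** The angular domain and the two resolutions of unity are the same on both
    sides, so the statement reduces to the whole plane.  There one needs a
    constant [K] such that, for every functional [F],

      bessel_norm gamma1 p1 F <= K * bessel_norm gamma0 p0 F    (bessel_norm_le).

    The weights match: c^(nu Theta p) is the p-th power of c^(nu Theta), so both
    outer norms are l^p norms of a sequence multiplied by weights independent
    of p.  As l^p0 is contained in l^p1 with norm one, the constant [K] passes
    through the inner sum and then through the outer one (weighted_lp_norm_le).

    Let 2b = gamma0 - gamma1.  If b = 0 the Sobolev condition forces p0 = p1.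
    Otherwise 0 < b and 1/p0 - 1/p1 <= b, and the embedding is the boundedness
    of (1 - Delta)^(-b) from L_p0 to L_p1.  This operator is an average of
    Gaussians: with time written as e^t,

      (1 + |y|^2)^(-b) = Gamma(b)^(-1) int e^(b t - e^t) e^(-e^t |y|^2) dt,

    and e^(-e^t |y|^2) is the Fourier transform of the heat kernel at time e^t.
    The integral over t is not carried out: [kern] is a smooth probability
    density in (t, z), and the potential of f averages the translates of f by z.
    This avoids the singularity of the Bessel kernel at the origin, and the
    logarithmic time turns changes of scale into translations.  Three facts
    about the potential are needed.

    - It maps Schwartz functions to Schwartz functions (rschwartz_superpose) and
      multiplies Fourier transforms by (1 + |y|^2)^(-b) (kern_fourier).  Hence
      bessel_op gamma1 phi = bessel_op gamma0 (potential of phi), an identity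
      that requires no Fourier inversion (bessel_op_potential).

    - Consequently, if bessel_dist gamma0 T is represented by g, then Fubini's
      theorem shows that bessel_dist gamma1 T is represented by the adjoint
      potential of g (Cpairing_adjoint).

    - It is bounded from L_p0 to L_p1 (potential_Lp).  By duality (dual_bound)
      one estimates the integral of e^(a t) heat_t(z) f(x + z) g(x) over x, z
      and t, where a = 1/p0 - 1/p1 and q is conjugate to p1, so that
      1/p0 + 1/q = 1 + a.  For p0 = p1 Young's inequality for products
      suffices.  For p0 < p1 the domain is split according to which of f^p0
      and g^q is larger.  When g^q <= f^p0 = e^(-S), the integral in z for
      fixed t is at most e^(-S/q), since the heat kernel has mass one, and at
      most 2 e^(-t/q), since the kernel is below e^(-t) and g has norm at most
      one.  The first bound is summable against e^(a t) for t below S, the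
      second for t above S, because 0 < a < 1/q.  Both give a multiple of
      f^(p0 - 1), whose product with f has integral at most one.  The other
      half is symmetric (potential_le, slice_le, bilinear_critical). *)

(** * Sequence spaces *)

Section SequenceSpaces.
Context {R : realType}.

Lemma le_poweR (x y : \bar R) (r : R) : 0 <= r -> (0 <= x)%E -> (x <= y)%E ->
  (x `^ r <= y `^ r)%E.
Proof.
move=> r0 x0 xy; apply: gt0_ler_poweR => //.
- by rewrite in_itv/= x0 leey.
- by rewrite in_itv/= (le_trans x0 xy) leey.
Qed.

(** Each term is at most the l^p0 norm [S]; so a^p1 <= S^(p1 - p0) a^p0, and it
    remains to sum. *)
Lemma lp_norm_le (T : choiceType) (p0 p1 : R) (a : T -> \bar R) :
  0 < p0 -> p0 <= p1 -> (forall i, 0 <= a i)%E ->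
  ((\esum_(i in [set: T]) a i `^ p1) `^ p1^-1 <=
   (\esum_(i in [set: T]) a i `^ p0) `^ p0^-1)%E.
Proof.
move=> p00 p01 a0; have p10 : 0 < p1 := lt_le_trans p00 p01.
set S0 := (\esum_(i in _) a i `^ p0)%E; set S := (S0 `^ _)%E.
have S00 : (0 <= S0)%E by apply: esum_ge0 => i _; exact: poweR_ge0.
have S_ge0 : (0 <= S)%E by exact: poweR_ge0.
have S0E : (S `^ p0 = S0)%E by rewrite /S -poweRrM mulVf ?gt_eqF// poweRe1.
have [Soo|] := eqVneq S +oo%E; first by rewrite Soo leey.
rewrite -ltey => Sfin.
have aS i : (a i <= S)%E.
  have -> : a i = ((a i `^ p0) `^ p0^-1)%E.
    by rewrite -poweRrM mulfV ?gt_eqF// poweRe1.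
  apply: le_poweR; rewrite ?invr_ge0 ?(ltW p00) ?poweR_ge0//.
  apply: esum_ge; exists [set i]; first by split.
  by rewrite fsbig_set1.
suff H : (\esum_(i in [set: T]) a i `^ p1 <= S `^ p1)%E.
  apply: (@le_trans _ _ ((S `^ p1) `^ p1^-1)%E).
    apply: le_poweR => //; first by rewrite invr_ge0 ltW.
    by apply: esum_ge0 => i _; exact: poweR_ge0.
  by rewrite -poweRrM mulfV ?gt_eqF// poweRe1.
have powD x : (0 <= x)%E -> (x `^ p1 = x `^ (p1 - p0) * x `^ p0)%E.
  by move=> x0; rewrite -poweRD ?subrK// add_neq0_poweRD_def// subrK gt_eqF.
have Spfin : (S `^ (p1 - p0))%E \is a fin_num.
  by rewrite fin_num_poweR// ge0_fin_numE.
rewrite powD// S0E.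
have -> : (S `^ (p1 - p0))%E = (fine (S `^ (p1 - p0)))%:E.
  by rewrite fineK.
rewrite -ereal_supZl; last 2 first.
- by apply/set0P; exists 0%E => /=; exists set0; rewrite ?fsbig_set0//; exact: fsets_set0.
- by rewrite fine_ge0// poweR_ge0.
apply: ge_ereal_sup => /= _ [X [finX _]] <-.
apply: le_ereal_sup_tmp; exists ((fine (S `^ (p1 - p0)))%:E * \sum_(i \in X) a i `^ p0)%E.
  by exists (\sum_(i \in X) a i `^ p0)%E => //; exists X.
rewrite ge0_mule_fsumr; last by move=> i; exact: poweR_ge0.
apply: lee_fsum => // i _.
rewrite powD// fineK//.
apply: lee_wpmul2r; first exact: poweR_ge0.
by apply: le_poweR; rewrite ?subr_ge0.
Qed.

(** Raising the weight to the same power as the term makes the weighted norm an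
    unweighted norm of [w i * b i]; this is why the weight exponents of the two
    spaces are [Theta * p0] and [Theta * p1]. *)
Lemma weighted_lp_norm_le (T : choiceType) (p0 p1 C : R) (w : T -> R)
    (b0 b1 : T -> \bar R) :
  0 < p0 -> p0 <= p1 -> 0 <= C ->
  (forall i, 0 < w i) ->
  (forall i, 0 <= b0 i)%E -> (forall i, 0 <= b1 i)%E ->
  (forall i, b1 i <= C%:E * b0 i)%E ->
  ((\esum_(i in [set: T]) ((w i `^ p1)%:E * b1 i `^ p1)) `^ p1^-1 <=
   C%:E * (\esum_(i in [set: T]) ((w i `^ p0)%:E * b0 i `^ p0)) `^ p0^-1)%E.
Proof.
move=> p00 p01 C0 w0 b00 b10 b01; have p10 : 0 < p1 := lt_le_trans p00 p01.
have wE p i (b : \bar R) : (0 <= b)%E ->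
    ((w i `^ p)%:E * b `^ p = ((w i)%:E * b) `^ p)%E.
  by move=> ?; rewrite poweRM ?lee_fin ?(ltW (w0 _))// poweR_EFin.
under eq_esum do rewrite wE//.
under [X in (_ <= _ * X `^ _)%E]eq_esum do rewrite wE//.
apply: (@le_trans _ _ ((\esum_(i in [set: T]) ((w i)%:E * (C%:E * b0 i)) `^ p1) `^ p1^-1)%E).
  apply: le_poweR; first by rewrite invr_ge0 ltW.
    by apply: esum_ge0 => i _; exact: poweR_ge0.
  apply: le_esum => i _; apply: le_poweR; rewrite ?(ltW p10) ?mule_ge0 ?lee_fin ?(ltW (w0 _))//.
  by apply: lee_wpmul2l => //; rewrite lee_fin ltW.
under eq_esum do rewrite muleCA poweRM ?mule_ge0 ?lee_fin ?(ltW (w0 _))// poweR_EFin.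
have scale : (\esum_(i in [set: T]) ((C `^ p1)%:E * ((w i)%:E * b0 i) `^ p1) =
    (C `^ p1)%:E * \esum_(i in [set: T]) ((w i)%:E * b0 i) `^ p1)%E.
  rewrite -ereal_supZl ?powR_ge0//; last first.
    by apply/set0P; exists 0%E => /=; exists set0; rewrite ?fsbig_set0//; exact: fsets_set0.
  congr ereal_sup; apply/seteqP; split => x /=.
    move=> [X fX <-]; exists (\sum_(i \in X) ((w i)%:E * b0 i) `^ p1)%E; first by exists X.
    by rewrite ge0_mule_fsumr// => i; exact: poweR_ge0.
  move=> [_ [X fX <-]] <-; exists X => //.
  by rewrite ge0_mule_fsumr// => i; exact: poweR_ge0.
rewrite scale poweRM ?lee_fin ?powR_ge0//; last first.
  by apply: esum_ge0 => i _; exact: poweR_ge0.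
rewrite poweR_EFin -powRrM mulfV ?gt_eqF// powRr1//.
apply: lee_wpmul2l; first by rewrite lee_fin.
by apply: lp_norm_le => // i; rewrite mule_ge0 ?lee_fin ?(ltW (w0 _)).
Qed.

End SequenceSpaces.

(** * Lebesgue measure on products *)

Section ProductSigmaFinite.
Context d1 d2 (T1 : measurableType d1) (T2 : measurableType d2) (R : realType).
Variable m1 : {sigma_finite_measure set T1 -> \bar R}.
Variable m2 : {sigma_finite_measure set T2 -> \bar R}.

Lemma product_measure_sigma_finite : sigma_finite setT (m1 \x m2)%E.
Proof.
have /sigma_finiteP[F [TF ndF Foo]] := sigma_finiteT m1.
have /sigma_finiteP[G [TG ndG Goo]] := sigma_finiteT m2.
exists (fun n => F n `*` G n).
 rewrite -setXTT TF TG predeqE => -[x y]; split.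
    move=> [/= [n _ Fnx] [k _ Gky]]; exists (maxn n k) => //; split.
    - by move: x Fnx; exact/subsetPset/ndF/leq_maxl.
    - by move: y Gky; exact/subsetPset/ndG/leq_maxr.
  by move=> [n _ []/= ? ?]; split; exists n.
move=> k; have [? ?] := Foo k; have [? ?] := Goo k.
split; first exact: measurableX.
by rewrite product_measure1E// lte_mul_pinfty// ge0_fin_numE.
Qed.

(** The product measure, packed with its sigma-finiteness so that products can be
    iterated and Fubini applied to them. *)
Definition sigma_finite_product :
  {sigma_finite_measure set (T1 * T2)%type -> \bar R} :=
  HB.pack (m1 \x m2)%E
    (Measure_isSigmaFinite.Build _ _ _ (m1 \x m2)%E product_measure_sigma_finite).

End ProductSigmaFinite.

Section Plane.
Context {R : realType}.
Local Notation leb := (@lebesgue_measure R).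
Local Notation mR := (measurableTypeR R).

Definition plane := sigma_finite_product leb leb.

Lemma plane_tonelli (f : R * R -> \bar R) : measurable_fun [set: mR * mR] f ->
  (forall x, 0 <= f x)%E -> (\int[plane]_x f x = \int[leb]_x fubini_F leb f x)%E.
Proof. exact: (fubini_tonelli1 (m1 := leb) (m2 := leb)). Qed.

End Plane.

Section Reflection.
Context {R : realType}.
Local Notation leb := (@lebesgue_measure R).
Local Notation mR := (measurableTypeR R).

Lemma measurable_reflect (a : R) : measurable_fun [set: mR] (fun x : mR => a - x : mR).
Proof. by apply: measurable_funB. Qed.

(** Lebesgue measure is determined by its values on half-open intervals, and the
    reflected interval is half-open at the other end with the same length. *)
Lemma lebesgue_measure_reflect (a : R) (A : set mR) : measurable A ->
  leb ((fun x : mR => a - x) @^-1` A) = leb A.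
Proof.
move=> mA.
have H X : ocitv X -> leb X = pushforward leb (fun x : mR => a - x : mR) X.
  move=> [[u v] _ <-]; rewrite /pushforward/=.
  have -> : (fun x : mR => a - x) @^-1` `]u, v]%classic = `[a - v, a - u[%classic.
    by apply/seteqP; split=> x /=; rewrite !in_itv/= => /andP[h1 h2]; apply/andP; split; lra.
  rewrite !lebesgue_measure_itv/= !lte_fin ltrD2l ltrN2.
  by case: ifP => // uv; rewrite -!EFinB; congr EFin; lra.
have mr := measurable_reflect a.
pose fm : {mfun mR >-> mR} := HB.pack (fun x : mR => a - x : mR) (isMeasurableFun.Build _ _ _ _ _ mr).
by rewrite (lebesgue_measure_unique (mu := pushforward leb fm) H mA).
Qed.

Lemma ge0_integral_reflect (a : R) (f : R -> \bar R) :
  measurable_fun [set: mR] f -> (forall x, 0 <= f x)%E ->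
  (\int[leb]_x f (a - x)%R = \int[leb]_x f x)%E.
Proof.
move=> mf f0; have mr := measurable_reflect a.
rewrite -[LHS](@ge0_integral_pushforward _ _ _ _ _ _ mr leb setT f)//.
apply: eq_measure_integral => A mA _; exact: lebesgue_measure_reflect.
Qed.

(** A translation is a product of two reflections. *)
Lemma ge0_integral_translate (a : R) (f : R -> \bar R) :
  measurable_fun [set: mR] f -> (forall x, 0 <= f x)%E ->
  (\int[leb]_x f (x + a)%R = \int[leb]_x f x)%E.
Proof.
move=> mf f0.
rewrite -[RHS](ge0_integral_reflect 0)// -[RHS](ge0_integral_reflect (- a))//.
- by apply: eq_integral => x _; congr f; lra.
- by apply: measurableT_comp => //; exact: measurable_reflect.
Qed.

End Reflection.

Section Reflection2.
Context {R : realType}.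
Local Notation leb := (@lebesgue_measure R).
Local Notation leb2 := (@plane R).
Local Notation mR := (measurableTypeR R).
Local Notation mR2 := (mR * mR)%type.

Lemma measurable_reflect2 (a : R * R) : measurable_fun [set: mR2] (fun x : mR2 => a - x : mR2).
Proof.
apply: measurable_fun_pair => /=.
- by apply: (measurable_funB (f := cst a.1) (g := fst)) => //.
- by apply: (measurable_funB (f := cst a.2) (g := snd)) => //.
Qed.

Lemma ge0_integral2_reflect (a : R * R) (f : R * R -> \bar R) :
  measurable_fun [set: mR2] f -> (forall x, 0 <= f x)%E ->
  (\int[leb2]_x f (a - x)%R = \int[leb2]_x f x)%E.
Proof.
move=> mf f0; rewrite !plane_tonelli//=; last first.
  by apply: measurableT_comp => //; exact: measurable_reflect2.
transitivity (\int[leb]_x fubini_F leb f (a.1 - x)%R)%E.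
  apply: eq_integral => x _; rewrite /fubini_F/=.
  rewrite -[RHS](ge0_integral_reflect a.2)//.
  by apply: measurableT_comp => //; exact: measurable_pair1.
rewrite ge0_integral_reflect//.
- exact: measurable_fun_fubini_tonelli_F.
- by move=> x; exact: integral_ge0.
Qed.

Lemma integral2_reflect (a : R * R) (f : R * R -> \bar R) :
  measurable_fun [set: mR2] f ->
  (\int[leb2]_x f (a - x)%R = \int[leb2]_x f x)%E.
Proof.
move=> mf; rewrite integralE [RHS]integralE; congr (_ - _)%E.
- have := ge0_integral2_reflect a (measurable_funepos mf) (fun x => funepos_ge0 _ x).
  by move=> <-; apply: eq_integral => x _; rewrite ?funeposE ?funenegE.
- have := ge0_integral2_reflect a (measurable_funeneg mf) (fun x => funeneg_ge0 _ x).
  by move=> <-; apply: eq_integral => x _; rewrite ?funeposE ?funenegE.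
Qed.

Lemma integral2_translate (a : R * R) (f : R * R -> \bar R) :
  measurable_fun [set: mR2] f ->
  (\int[leb2]_x f (x + a)%R = \int[leb2]_x f x)%E.
Proof.
move=> mf.
rewrite -[RHS](integral2_reflect 0)// -[RHS](integral2_reflect (- a))//.
- by apply: eq_integral => x _; congr f; rewrite sub0r opprB opprK.
- by apply: measurableT_comp => //; exact: measurable_reflect2.
Qed.

End Reflection2.

(** * The heat kernel in logarithmic time *)

(** Measurability of polynomial and exponential expressions in coordinates. *)
Ltac meas := repeat first
  [ exact: measurable_cst | exact: measurable_id | exact: measurable_fst
  | exact: measurable_snd | assumption
  | apply: measurable_funD | apply: measurable_funB | apply: measurable_funM
  | apply: measurable_funN | apply: measurable_funX
  | apply: (measurableT_comp (@measurable_expR _))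
  | apply: (measurableT_comp measurable_fst) | apply: (measurableT_comp measurable_snd)
  | apply: (measurableT_comp (@measurable_id _ _ _)) ].

Section Kernel.
Context {R : realType}.
Local Notation leb := (@lebesgue_measure R).
Local Notation leb2 := (@plane R).
Local Notation mR := (measurableTypeR R).
Local Notation mR2 := (mR * mR)%type.

(** Euler's integrand for Gamma(b), after the substitution s = e^t. *)
Definition weight (b t : R) : R := expR (b * t - expR t).

(** The Gaussian solving the one-dimensional heat equation, at time e^t. *)
Definition heat1 (t u : R) : R :=
  expR (- (t / 2) - u ^+ 2 * expR (- t) / 4) / (2 * Num.sqrt pi).

Definition heat (t : R) (z : R * R) : R := heat1 t z.1 * heat1 t z.2.

Lemma measurable_weight b : measurable_fun [set: mR] (weight b).
Proof. rewrite /weight. meas. Qed.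

Lemma measurable_heat : measurable_fun [set: mR * mR2] (fun q : mR * mR2 => heat q.1 q.2).
Proof. rewrite /heat /heat1. meas. Qed.

Lemma heat1_gt0 t u : 0 < heat1 t u.
Proof. by rewrite divr_gt0 ?expR_gt0// mulr_gt0// sqrtr_gt0 pi_gt0. Qed.

Lemma heat_ge0 t z : 0 <= heat t z.
Proof. by rewrite ltW// mulr_gt0// heat1_gt0. Qed.

Lemma heatE t z : heat t z =
  expR (- t - (z.1 ^+ 2 + z.2 ^+ 2) * expR (- t) / 4) / (4 * pi).
Proof.
rewrite /heat /heat1 mulrACA -expRD; congr (expR _ * _); first by field.
by rewrite -invfM mulrACA -[Num.sqrt _ * _]expr2 sqr_sqrtr ?pi_ge0//; congr (_^-1); ring.
Qed.

(** The bound (4 pi)^(-1) e^(-t) for the supremum, with the constant dropped. *)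
Lemma heat_le t z : heat t z <= expR (- t).
Proof.
rewrite heatE -[leRHS]mulr1; apply: ler_pM; rewrite ?expR_ge0//.
- by rewrite invr_ge0 mulr_ge0 ?pi_ge0.
- by rewrite ler_expR gerBl mulr_ge0// mulr_ge0 ?expR_ge0// addr_ge0// sqr_ge0.
- by rewrite invf_le1 ?mulr_gt0 ?pi_gt0//; have := @pi_ge2 R; lra.
Qed.

Lemma heat1E t : heat1 t = normal_pdf 0 (Num.sqrt (2 * expR t)).
Proof.
have e0 : 0 < 2 * expR t by rewrite mulr_gt0// expR_gt0.
apply/funext => u; rewrite normal_pdfE ?gt_eqF ?sqrtr_gt0// /heat1 /normal_fun /normal_peak.
rewrite sqr_sqrtr ?(ltW e0)// subr0 expRD mulrAC.
have -> : - u ^+ 2 / (2 * expR t *+ 2) = - (u ^+ 2 * expR (- t) / 4).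
  by rewrite expRN; field; rewrite gt_eqF// expR_gt0.
congr (_ * _).
have -> : 2 * expR t * pi *+ 2 = (2 * expR (t / 2)) ^+ 2 * pi.
  rewrite exprMn -expRM_natl (_ : 2%:R * (t / 2) = t); last by field.
  ring.
rewrite sqrtrM ?sqr_ge0// sqrtr_sqr ger0_norm ?mulr_ge0 ?expR_ge0//.
rewrite expRN; field.
by rewrite !gt_eqF ?sqrtr_gt0 ?pi_gt0 ?expR_gt0.
Qed.

Lemma integral_heat1 t : (\int[leb]_u (heat1 t u)%:E = 1)%E.
Proof. by rewrite heat1E integral_normal_pdf. Qed.

Lemma integral_heat t : (\int[leb2]_z (heat t z)%:E = 1)%E.
Proof.
have mh : measurable_fun [set: mR] (heat1 t).
  by rewrite heat1E; exact: measurable_normal_pdf.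
rewrite plane_tonelli//=; last 2 first.
- apply/measurable_EFinP; rewrite /heat.
  apply: measurable_funM.
  + exact: (measurableT_comp mh measurable_fst).
  + exact: (measurableT_comp mh measurable_snd).
- by move=> z; rewrite lee_fin heat_ge0.
rewrite -[RHS](integral_heat1 t); apply: eq_integral => u _.
rewrite /fubini_F /heat/=; under eq_integral do rewrite EFinM.
rewrite ge0_integralZl//.
- by rewrite integral_heat1 mule1.
- exact/measurable_EFinP.
- by move=> z _; rewrite lee_fin ltW// heat1_gt0.
- by rewrite lee_fin ltW// heat1_gt0.
Qed.

End Kernel.

(** * The Gamma integral *)

Section Weight.
Context {R : realType}.
Local Notation leb := (@lebesgue_measure R).
Local Notation mR := (measurableTypeR R).

Lemma integral_exponential_right (a T : R) : 0 < a ->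
  (\int[leb]_t (exponential_pdf a (t - T))%:E = 1)%E.
Proof.
move=> a0; rewrite -(integral_exponential_pdf a0).
rewrite -[RHS](@ge0_integral_translate _ (- T))//.
- by apply/measurable_EFinP; exact: measurable_exponential_pdf.
- by move=> x; rewrite lee_fin exponential_pdf_ge0// ltW.
Qed.

Lemma integral_exponential_left (a T : R) : 0 < a ->
  (\int[leb]_t (exponential_pdf a (T - t))%:E = 1)%E.
Proof.
move=> a0; rewrite -(integral_exponential_pdf a0).
rewrite -[RHS](@ge0_integral_reflect _ T)//.
- by apply/measurable_EFinP; exact: measurable_exponential_pdf.
- by move=> x; rewrite lee_fin exponential_pdf_ge0// ltW.
Qed.

(** For t <= 0 the factor e^(-e^t) is dropped.  For t > 0, convexity of the
    exponential gives (b + 1)(1 + t - ln (b + 1)) <= e^t, which absorbs b t and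
    leaves e^(-t).  The bound is written with exponential densities, whose
    integrals are known. *)
Lemma weight_le (b : R) : 0 < b -> exists K, 0 <= K /\
  forall t, weight b t <= b^-1 * exponential_pdf b (0 - t) + K * exponential_pdf 1 (t - 0).
Proof.
move=> b0; have m0 : 0 < b + 1 by lra.
exists (expR ((b + 1) * ln (b + 1))); split; first exact: expR_ge0.
move=> t; have [t0|t0] := leP t 0.
- apply: (@le_trans _ _ (b^-1 * exponential_pdf b (0 - t))).
    rewrite exponential_pdfE ?sub0r ?oppr_ge0// mulrA mulVf ?gt_eqF// mul1r /weight.
    by rewrite ler_expR mulrNN gerBl expR_ge0.
  by rewrite lerDl mulr_ge0 ?expR_ge0// exponential_pdf_ge0.
- apply: (@le_trans _ _ (expR ((b + 1) * ln (b + 1)) * exponential_pdf 1 (t - 0))).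
    rewrite subr0 exponential_pdfE ?(ltW t0)// mul1r /weight -expRD ler_expR mulN1r.
    have : (b + 1) * (1 + (t - ln (b + 1))) <= expR t.
      have -> : expR t = (b + 1) * expR (t - ln (b + 1)).
        by rewrite expRB lnK ?posrE// mulrCA divff ?mulr1// gt_eqF.
      by rewrite ler_pM2l// expR_ge1Dx.
    nra.
  by rewrite lerDr mulr_ge0 ?invr_ge0 ?(ltW b0)// exponential_pdf_ge0// ltW.
Qed.

Lemma integral_weight_lty (b : R) : 0 < b -> (\int[leb]_t (weight b t)%:E < +oo)%E.
Proof.
move=> b0; have [K [K0 HK]] := weight_le b0.
have me a f : measurable_fun [set: mR] f -> measurable_fun [set: mR] (fun t : mR => exponential_pdf a (f t)).
  by move=> mf; apply: measurableT_comp mf; exact: measurable_exponential_pdf.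
apply: (@le_lt_trans _ _ (\int[leb]_t ((b^-1)%:E * (exponential_pdf b (0 - t))%:E +
    K%:E * (exponential_pdf 1 (t - 0))%:E))%E).
  apply: ge0_le_integral => //.
  - by move=> x _; rewrite lee_fin expR_ge0.
  - by apply/measurable_EFinP; exact: measurable_weight.
  - under eq_fun do rewrite -!EFinM -EFinD.
    apply/measurable_EFinP; apply: measurable_funD; apply: measurable_funM => //;
    by apply: me; meas.
  - by move=> t _; rewrite -!EFinM -EFinD lee_fin.
rewrite ge0_integralD//; last 4 first.
- by move=> t _; rewrite mule_ge0// lee_fin ?invr_ge0 ?(ltW b0)// exponential_pdf_ge0// ltW.
- by apply: measurable_funeM; apply/measurable_EFinP; apply: me; meas.
- by move=> t _; rewrite mule_ge0// lee_fin exponential_pdf_ge0.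
- by apply: measurable_funeM; apply/measurable_EFinP; apply: me; meas.
rewrite !ge0_integralZl//; last 5 first.
- by apply/measurable_EFinP; apply: me; meas.
- by move=> t _; rewrite lee_fin exponential_pdf_ge0.
- by apply/measurable_EFinP; apply: me; meas.
- by move=> t _; rewrite lee_fin exponential_pdf_ge0// ltW.
- by rewrite lee_fin invr_ge0 ltW.
rewrite integral_exponential_left// integral_exponential_right//.
by rewrite !mule1 -EFinD ltry.
Qed.

Lemma integral_weight_gt0 (b : R) : 0 < b -> (0 < \int[leb]_t (weight b t)%:E)%E.
Proof.
move=> b0; have : (\int[leb]_(t in `[0%R, 1%R]) (expR (- expR 1))%:E <= \int[leb]_t (weight b t)%:E)%E; last first.
  apply: lt_le_trans.
  rewrite integral_cst//= lebesgue_measure_itv/= lte01 oppr0 adde0 mule1.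
  by rewrite lte_fin expR_gt0.
apply: (@le_trans _ _ (\int[leb]_(t in `[0%R, 1%R]) (weight b t)%:E)%E).
  apply: ge0_le_integral => //.
  - by apply/measurable_EFinP; apply: measurable_funTS; exact: measurable_weight.
  - move=> t /=; rewrite in_itv/= => /andP[t0 t1].
    rewrite lee_fin /weight ler_expR.
    have : expR t <= expR 1 by rewrite ler_expR.
    have : 0 <= b * t by rewrite mulr_ge0// ltW.
    lra.
apply: ge0_subset_integral => //.
- by apply/measurable_EFinP; exact: measurable_weight.
- by move=> t _; rewrite lee_fin expR_ge0.
Qed.

(** The value Gamma(b). *)
Definition gamma_int (b : R) : R := \int[leb]_t weight b t.

Lemma gamma_intE (b : R) : 0 < b -> (\int[leb]_t (weight b t)%:E = (gamma_int b)%:E)%E.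
Proof.
move=> b0; rewrite /gamma_int /Rintegral fineK// ge0_fin_numE ?integral_weight_lty//.
by rewrite ltW// integral_weight_gt0.
Qed.

Lemma gamma_int_gt0 (b : R) : 0 < b -> 0 < gamma_int b.
Proof. by move=> b0; rewrite -lte_fin -gamma_intE// integral_weight_gt0. Qed.

(** The factor w is absorbed by the translation t -> t + ln w. *)
Lemma integral_weight_scale (b w : R) : 0 < b -> 0 < w ->
  (\int[leb]_t (expR (b * t - w * expR t))%:E = (gamma_int b * w `^ (- b))%:E)%E.
Proof.
move=> b0 w0.
transitivity (\int[leb]_t ((w `^ (- b))%:E * (weight b (t + ln w))%:E))%E.
  apply: eq_integral => t _; rewrite -EFinM; congr EFin.
  rewrite /weight /powR gt_eqF// -expRD; congr expR.
  by rewrite expRD lnK ?posrE//; ring.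
rewrite ge0_integralZl//.
- rewrite (@ge0_integral_translate _ (ln w) (fun t => (weight b t)%:E))//.
  + by rewrite gamma_intE// -EFinM mulrC.
  + by apply/measurable_EFinP; exact: measurable_weight.
  + by move=> t; rewrite lee_fin expR_ge0.
- apply/measurable_EFinP; apply: (measurableT_comp (measurable_weight b)).
  by meas.
- by move=> t _; rewrite lee_fin expR_ge0.
- by rewrite lee_fin powR_ge0.
Qed.

End Weight.

(** * The Fourier transform of the Gaussian *)

Section GaussianFourier.
Context {R : realType}.
Local Notation leb := (@lebesgue_measure R).
Local Notation mR := (measurableTypeR R).

Lemma integral_translate (a : R) (f : R -> \bar R) :
  measurable_fun [set: mR] f ->
  (\int[leb]_x f (x + a)%R = \int[leb]_x f x)%E.
Proof.
move=> mf; rewrite integralE [RHS]integralE; congr (_ - _)%E.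
- have := ge0_integral_translate a (measurable_funepos mf) (fun x => funepos_ge0 _ x).
  by move=> <-; apply: eq_integral => x _; rewrite ?funeposE ?funenegE.
- have := ge0_integral_translate a (measurable_funeneg mf) (fun x => funeneg_ge0 _ x).
  by move=> <-; apply: eq_integral => x _; rewrite ?funeposE ?funenegE.
Qed.

Lemma integral_reflect (a : R) (f : R -> \bar R) :
  measurable_fun [set: mR] f ->
  (\int[leb]_x f (a - x)%R = \int[leb]_x f x)%E.
Proof.
move=> mf; rewrite integralE [RHS]integralE; congr (_ - _)%E.
- have := ge0_integral_reflect a (measurable_funepos mf) (fun x => funepos_ge0 _ x).
  by move=> <-; apply: eq_integral => x _; rewrite ?funeposE ?funenegE.
- have := ge0_integral_reflect a (measurable_funeneg mf) (fun x => funeneg_ge0 _ x).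
  by move=> <-; apply: eq_integral => x _; rewrite ?funeposE ?funenegE.
Qed.

Lemma Rintegral_translate (a : R) (f : R -> R) : measurable_fun [set: mR] f ->
  \int[leb]_x f (x + a) = \int[leb]_x f x.
Proof.
move=> mf; congr fine.
by rewrite (@integral_translate a (EFin \o f))//; exact/measurable_EFinP.
Qed.

(** The integral of f (u + h) does not depend on h; differentiate it at h = 0
    under the integral sign. *)
Lemma Rintegral_derive0 (f f' G : R -> R) :
  (forall u : R, is_derive u (1 : R) f (f' u)) ->
  leb.-integrable setT (EFin \o f) -> leb.-integrable setT (EFin \o G) ->
  (forall u, 0 <= G u) ->
  (forall h u, -1 < h < 1 -> `|f' (u + h)| <= G u) ->
  \int[leb]_u f' u = 0.
Proof.
move=> df fi Gi G0 fG.
have mf : measurable_fun [set: mR] f by apply/measurable_EFinP; exact: (measurable_int leb fi).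
have fE (h u : R) : is_derive h (1 : R) (fun h => f (u + h)) (f' (u + h)).
  have d1 : is_derive h (1 : R) (fun h : R => u + h) 1.
    by apply: is_derive_eq; rewrite add0r mulr1.
  by have := is_derive1_comp (df (u + h)) d1; rewrite mulr1.
have d1E h u : partial1of2 (fun h u => f (u + h)) h u = f' (u + h).
  by rewrite partial1of2E; have [_ ->] := fE h u.
have I0 : `]-1, 1[%classic (0 : R) by rewrite /= in_itv/=; apply/andP; split; lra.
have := @differentiation_under_integral R _ _ leb (fun h u => f (u + h)) setT measurableT
  0 (-1) 1 I0 _ _ G G0 Gi.
rewrite (_ : (fun x' => _) = cst (\int[leb]_u f u)); last first.
  by apply/funext => h /=; exact: Rintegral_translate.
rewrite derive1_cst => H.
rewrite -[LHS](_ : \int[leb]_u partial1of2 (fun h u => f (u + h)) 0 u = _); last first.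
  by apply: eq_Rintegral => u _; rewrite d1E addr0.
apply/esym/H.
- move=> h _; apply/integrableP; split.
    apply/measurable_EFinP; apply: (measurableT_comp mf); exact: measurable_funD.
  have mafe : measurable_fun [set: mR] (fun x : mR => `|(f x)%:E|%E).
    by apply: measurableT_comp => //; exact/measurable_EFinP.
  rewrite (@integral_translate h (fun x => `|(f x)%:E|%E))//.
  by have /integrableP[] := fi.
- by move=> h u _ _; have [] := fE h u.
- by move=> h u; rewrite /= in_itv/= => hh _; rewrite d1E; exact: fG.
Qed.

(** Doubling the time leaves a Gaussian factor to spare.  This factor absorbs
    polynomials and small shifts, so that all dominating functions below are
    multiples of heat kernels at later times. *)
Lemma heat1_spread (t u : R) :
  expR (u ^+ 2 * expR (- t) / 8) * heat1 t u = expR (ln 2 / 2) * heat1 (t + ln 2) u.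
Proof.
rewrite /heat1 !mulrA -!expRD; congr (expR _ / _).
by rewrite [- (t + _)]opprD [expR (_ + _)]expRD [expR (- ln 2)]expRN lnK ?posrE//; field.
Qed.

Lemma integrable_heat1 (t : R) : leb.-integrable setT (EFin \o heat1 t).
Proof. by rewrite heat1E; exact: integrable_normal_pdf. Qed.

Lemma integrable_le_heat1 (t K : R) (f : R -> R) : measurable_fun [set: mR] f ->
  (forall u, `|f u| <= K * heat1 t u) -> leb.-integrable setT (EFin \o f).
Proof.
move=> mf fK.
have Ki : leb.-integrable setT (EFin \o (fun u => K * heat1 t u)).
  rewrite (_ : EFin \o _ = (fun u => K%:E * (heat1 t u)%:E)%E); last first.
    by apply/funext => u /=; rewrite EFinM.
  by apply: integrableZl => //; exact: integrable_heat1.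
apply: le_integrable Ki => //; first exact/measurable_EFinP.
by move=> u _ /=; rewrite lee_fin (le_trans (fK u))// ler_norm.
Qed.

Lemma heat1_moment (t : R) : exists K, forall u, (1 + `|u|) * heat1 t u <= K * heat1 (t + ln 2) u.
Proof.
have e0 := expR_gt0 (- t).
exists ((2 + 8 * expR t) * expR (ln 2 / 2)) => u.
rewrite -mulrA -heat1_spread mulrA ler_pM2r ?heat1_gt0//.
have H : 1 + u ^+ 2 * expR (- t) / 8 <= expR (u ^+ 2 * expR (- t) / 8) by exact: expR_ge1Dx.
have H2 : 1 + `|u| <= 2 + 8 * expR t * (u ^+ 2 * expR (- t) / 8).
  have -> : 8 * expR t * (u ^+ 2 * expR (- t) / 8) = u ^+ 2.
    rewrite expRN; field; by rewrite gt_eqF// expR_gt0.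
  by rewrite -real_normK ?num_real//; have := sqr_ge0 (`|u| - 1); nra.
apply: (le_trans H2); have f0 := expR_gt0 t.
have X0 : 0 <= u ^+ 2 * expR (- t) / 8 by rewrite mulr_ge0// mulr_ge0 ?sqr_ge0 ?expR_ge0.
move: X0 H; move: (u ^+ 2 * _ / 8) => X X0 H.
by nra.
Qed.

Lemma heat1_shift (t h u : R) : -1 < h < 1 ->
  heat1 t (u + h) <= expR (expR (- t) / 4 + ln 2 / 2) * heat1 (t + ln 2) u.
Proof.
move=> /andP[h1 h2]; rewrite expRD -mulrA -heat1_spread mulrA -expRD /heat1 mulrA -expRD.
rewrite ler_pM2r ?invr_gt0 ?mulr_gt0 ?sqrtr_gt0 ?pi_gt0// ler_expR.
have e0 := expR_gt0 (- t).
have H : u ^+ 2 / 2 - 1 <= (u + h) ^+ 2.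
  have : h ^+ 2 <= 1 by rewrite expr2; nra.
  by have := sqr_ge0 (u + 2 * h); nra.
have : (u ^+ 2 / 2 - 1) * expR (- t) <= (u + h) ^+ 2 * expR (- t) by rewrite ler_pM2r.
lra.
Qed.

Lemma is_derive_heat1 (t u : R) :
  is_derive u (1 : R) (heat1 t) (- (u * expR (- t) / 2) * heat1 t u).
Proof.
rewrite /heat1.
apply: is_derive_eq.
rewrite /GRing.scale/=; field.
by rewrite gt_eqF// sqrtr_gt0 pi_gt0.
Qed.

Section OneDimension.
Variable t : R.

Let h := heat1 t.

Let measurable_h : measurable_fun [set: mR] h.
Proof. by rewrite /h heat1E; exact: measurable_normal_pdf. Qed.

Let measurable_sin y : measurable_fun [set: mR] (fun u : mR => sin (u * y)).
Proof.
by apply: (measurableT_comp (continuous_measurable_fun (@continuous_sin R))); exact: measurable_funM.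
Qed.

Let measurable_cos y : measurable_fun [set: mR] (fun u : mR => cos (u * y)).
Proof.
by apply: (measurableT_comp (continuous_measurable_fun (@continuous_cos R))); exact: measurable_funM.
Qed.

Let normr_sin (x : R) : `|sin x| <= 1.
Proof. by rewrite ler_norml sin_geN1 sin_le1. Qed.

Let normr_cos (x : R) : `|cos x| <= 1.
Proof. by rewrite ler_norml cos_geN1 cos_le1. Qed.

Let normr_h u : `|h u| = h u.
Proof. by rewrite ger0_norm// ltW// heat1_gt0. Qed.

Let heat_cos_integrable y : leb.-integrable setT (EFin \o (fun u => cos (u * y) * h u)).
Proof.
apply: (@integrable_le_heat1 t 1); first exact: measurable_funM.
by move=> u; rewrite normrM normr_h ler_pM2r ?heat1_gt0.
Qed.

Let heat_sin_integrable y : leb.-integrable setT (EFin \o (fun u => sin (u * y) * h u)).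
Proof.
apply: (@integrable_le_heat1 t 1); first exact: measurable_funM.
by move=> u; rewrite normrM normr_h ler_pM2r ?heat1_gt0.
Qed.

Let heat_usin_integrable y : leb.-integrable setT (EFin \o (fun u => u * sin (u * y) * h u)).
Proof.
have [K HK] := heat1_moment t.
apply: (@integrable_le_heat1 (t + ln 2) K); first by apply: measurable_funM => //; exact: measurable_funM.
move=> u; apply: le_trans (HK u); rewrite normrM normr_h ler_pM2r ?heat1_gt0//.
by rewrite normrM; have := normr_sin (u * y); have := normr_ge0 u; nra.
Qed.

(* Integration by parts: the integrand [f'] is the derivative of
   sin (u y) heat1 t u. *)
Let usin_cos y : \int[leb]_u (u * sin (u * y) * h u) =
  2 * expR t * y * \int[leb]_u (cos (u * y) * h u).
Proof.
have [K HK] := heat1_moment t.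
have e0 := expR_gt0 (- t).
pose C := (`|y| + expR (- t)) * (K * expR (expR (- (t + ln 2)) / 4 + ln 2 / 2)).
have K0 : 0 <= K.
  rewrite -(pmulr_lge0 _ (heat1_gt0 (t + ln 2) 0)); apply: le_trans (HK 0).
  by rewrite mulr_ge0 ?addr_ge0// ltW// heat1_gt0.
have C0 : 0 <= C by rewrite !mulr_ge0 ?addr_ge0 ?(ltW e0) ?expR_ge0.
pose f' u := y * (cos (u * y) * h u) - expR (- t) / 2 * (u * sin (u * y) * h u).
have : \int[leb]_u f' u = 0.
  apply: (@Rintegral_derive0 (fun u => sin (u * y) * h u) _ (fun u => C * heat1 (t + ln 2 + ln 2) u)).
  - move=> u; have dh := is_derive_heat1 t u.
    apply: is_derive_eq; rewrite /f' /GRing.scale/= -/(h u); ring.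
  - exact: heat_sin_integrable.
  - apply: (@integrable_le_heat1 (t + ln 2 + ln 2) C).
      by apply: measurable_funM => //; rewrite heat1E; exact: measurable_normal_pdf.
    by move=> u; rewrite ger0_norm// mulr_ge0// ltW// heat1_gt0.
  - by move=> u; rewrite mulr_ge0// ltW// heat1_gt0.
  - move=> d u d1; set v := u + d.
    have H1 : `|f' v| <= (`|y| + expR (- t)) * ((1 + `|v|) * h v).
      rewrite /f' (le_trans (ler_normB _ _))// [leRHS]mulrDl; apply: lerD.
        rewrite normrM ler_wpM2l// normrM normr_h ler_pM2r ?heat1_gt0//.
        by rewrite (le_trans (normr_cos _))// lerDl.
      rewrite normrM; apply: ler_pM => //; first by rewrite ger0_norm; lra.
      rewrite normrM normr_h ler_pM2r ?heat1_gt0// normrM.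
      by have := normr_sin (v * y); have := normr_ge0 v; nra.
    apply: (le_trans H1); rewrite /C -mulrA ler_wpM2l ?addr_ge0 ?(ltW e0)//.
    apply: (le_trans (HK v)); rewrite -mulrA ler_wpM2l//.
    exact: heat1_shift.
have HZ (k : R) g : leb.-integrable setT (EFin \o g) -> leb.-integrable setT (EFin \o (fun u => k * g u)).
  move=> gi; rewrite (_ : EFin \o _ = (fun u => k%:E * (g u)%:E)%E); last first.
    by apply/funext => u /=; rewrite EFinM.
  exact: integrableZl.
rewrite /f' RintegralB//; [|exact: HZ|exact: HZ].
rewrite !RintegralZl// => /eqP; rewrite subr_eq0 => /eqP H.
have tN : expR t * expR (- t) = 1 by rewrite expRxMexpNx_1.
set S := \int[leb]_u (u * _ * _) in H *.
have -> : S = 2 * expR t * (expR (- t) / 2 * S).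
  by rewrite (_ : 2 * expR t * _ = (expR t * expR (- t)) * S); [rewrite tN mul1r|field].
by rewrite -H; ring.
Qed.

(** As a function of y the left side F satisfies F' = - 2 e^t y F, by
    differentiation under the integral and an integration by parts, and F 0 = 1;
    so F multiplied by exp (e^t y^2) is constant. *)
Lemma integral_heat1_cos y :
  \int[leb]_u (cos (u * y) * heat1 t u) = expR (- (expR t * y ^+ 2)).
Proof.
pose F y := \int[leb]_u (cos (u * y) * h u).
have [K HK] := heat1_moment t.
have dF (y0 : R) : is_derive y0 (1 : R) F (- (2 * expR t * y0 * F y0)).
  pose f y u := cos (u * y) * h u.
  have df (y1 u : R) : is_derive y1 (1 : R) (f ^~ u) (- (u * sin (u * y1) * h u)).
    by apply: is_derive_eq; rewrite /GRing.scale/=; ring.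
  have d1 y1 u : partial1of2 f y1 u = - (u * sin (u * y1) * h u).
    by rewrite partial1of2E; have [_ ->] := df y1 u.
  have I0 : `]y0 - 1, y0 + 1[%classic y0 by rewrite /= in_itv/=; apply/andP; split; lra.
  have Gi : leb.-integrable setT (EFin \o (fun u => `|K| * heat1 (t + ln 2) u)).
    apply: (@integrable_le_heat1 (t + ln 2) `|K|).
      by apply: measurable_funM => //; rewrite heat1E; exact: measurable_normal_pdf.
    by move=> u; rewrite ger0_norm// mulr_ge0// ltW// heat1_gt0.
  have G0 u : 0 <= `|K| * heat1 (t + ln 2) u by rewrite mulr_ge0// ltW// heat1_gt0.
  have fi x : `]y0 - 1, y0 + 1[%classic x -> leb.-integrable setT (EFin \o f x).
    by move=> _; exact: heat_cos_integrable.
  have fd (x u : R) : `]y0 - 1, y0 + 1[%classic x -> setT u -> derivable (f ^~ u) x 1.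
    by move=> _ _; have [] := df x u.
  have fG (x u : R) : `]y0 - 1, y0 + 1[%classic x -> setT u -> `|partial1of2 f x u| <= `|K| * heat1 (t + ln 2) u.
    move=> _ _; rewrite d1 normrN.
    apply: (@le_trans _ _ (K * heat1 (t + ln 2) u)); last by rewrite ler_pM2r ?heat1_gt0// ler_norm.
    apply: le_trans (HK u); rewrite normrM normr_h ler_pM2r ?heat1_gt0// normrM.
    by have := normr_sin (u * x); have := normr_ge0 u; nra.
  have D := derivable_under_integral measurableT I0 fi fd G0 Gi fG.
  have E := differentiation_under_integral measurableT I0 fi fd G0 Gi fG.
  apply: DeriveDef => //; rewrite -derive1E [LHS]E.
  under eq_Rintegral do rewrite d1.
  rewrite -[RHS]mulN1r -usin_cos.
  rewrite -RintegralZl//.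
  by apply: eq_Rintegral => u _; rewrite mulN1r.
have cst0 : F y * expR (expR t * y ^+ 2) = F 0 * expR (expR t * 0 ^+ 2).
  apply: (@is_derive_0_is_cst R (fun y : R => F y * expR (expR t * y ^+ 2)) y 0) => x.
  by have dFx := dF x; apply: is_derive_eq; rewrite /GRing.scale/=; ring.
have F0 : F 0 = 1.
  rewrite /F; under eq_Rintegral do rewrite mulr0 cos0 mul1r.
  by rewrite /Rintegral /h integral_heat1.
rewrite -[LHS]/(F y) expRN; apply: (mulIf (lt0r_neq0 (expR_gt0 (expR t * y ^+ 2)))).
by rewrite cst0 F0 mulVf ?gt_eqF ?expR_gt0// expr0n/= mulr0 expR0 mulr1.
Qed.

Lemma integral_heat1_sin y : \int[leb]_u (sin (u * y) * heat1 t u) = 0.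
Proof.
have mf : measurable_fun [set: mR] (fun u : mR => sin (u * y) * h u) by exact: measurable_funM.
have HN : \int[leb]_u (sin (u * y) * h u) = \int[leb]_u (- (sin (u * y) * h u)).
  rewrite /Rintegral; congr fine.
  transitivity (\int[leb]_u (EFin \o (fun u : R => sin (u * y) * h u)%R) (0 - u)%R)%E.
    by rewrite integral_reflect//; exact/measurable_EFinP.
  apply: eq_integral => u _ /=; congr EFin.
  by rewrite sub0r mulNr sinN mulNr /h /heat1 sqrrN.
move: HN; under [in X in _ = X]eq_Rintegral do rewrite -mulN1r.
rewrite RintegralZl// -/h; lra.
Qed.

End OneDimension.

End GaussianFourier.

(** * Integrals over scales *)

Section Potential.
Context {R : realType} {d : measure_display} {T : measurableType d}.
Variable mu : {sigma_finite_measure set T -> \bar R}.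
Local Notation leb := (@lebesgue_measure R).
Local Notation mR := (measurableTypeR R).
Variables (k : R -> T -> R).
Hypothesis mk : measurable_fun [set: mR * T] (fun q : mR * T => k q.1 q.2).
Hypothesis k0 : forall t z, 0 <= k t z.
Hypothesis k1 : forall t, (\int[mu]_z (k t z)%:E <= 1)%E.
Hypothesis ksup : forall t z, k t z <= expR (- t).

Let mkt t : measurable_fun [set: T] (k t).
Proof. exact: (measurableT_comp mk (measurable_pair1 t)). Qed.

(** For fixed [t] the inner integral has two bounds: e^(-S/q), from the mass of
    [k t], and 2 e^(-t/q), from its supremum and the norm of [G].  The first is
    used for t <= S and the second for t > S; the exponential densities
    reproduce the two integrals over [t]. *)
Lemma potential_le (a q S : R) (G : T -> R) : 0 < a -> 1 < q -> a < q^-1 ->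
  measurable_fun [set: T] G -> (forall z, 0 <= G z) ->
  (forall z, G z <= expR (- S / q)) ->
  (\int[mu]_z (G z `^ q)%:E <= 1)%E ->
  (\int[leb]_t \int[mu]_z (expR (a * t) * (k t z * G z))%:E <=
    ((a^-1 + 2 / (q^-1 - a)) * expR (- (q^-1 - a) * S))%:E)%E.
Proof.
move=> a0 q1 aq mG G0 GS Gq; have q0 : 0 < q by lra.
set c := q^-1 - a; have c0 : 0 < c by rewrite subr_gt0.
have mkG t : measurable_fun [set: T] (fun z => (k t z * G z)%:E).
  by apply/measurable_EFinP; apply: measurable_funM.
have near_ t : (\int[mu]_z (k t z * G z)%:E <= (expR (- S / q))%:E)%E.
  apply: (@le_trans _ _ (\int[mu]_z ((expR (- S / q))%:E * (k t z)%:E))%E).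
    apply: ge0_le_integral => //.
    - by move=> z _; rewrite lee_fin mulr_ge0.
    - by apply: measurable_funeM; apply/measurable_EFinP.
    - by move=> z _; rewrite -EFinM lee_fin mulrC ler_wpM2r.
  rewrite ge0_integralZl//; [|exact/measurable_EFinP|by move=> z _; rewrite lee_fin].
  by rewrite -[leRHS]mule1 lee_wpmul2l// lee_fin expR_ge0.
have far_ t : (\int[mu]_z (k t z * G z)%:E <= (2 * expR (- t / q))%:E)%E.
  (* Where G <= A the mass of the kernel suffices; where G > A one has
     G <= A^(1 - q) G^q, and A is the value for which A^(1 - q) e^(-t) = A. *)
  set A := expR (- t / q); have A0 : 0 < A by exact: expR_gt0.
  have AE : A `^ (1 - q) * expR (- t) = A.
    rewrite /A /powR gt_eqF ?expR_gt0// expRK -expRD; congr expR.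
    by field; rewrite gt_eqF.
  have kG z : k t z * G z <= A * k t z + A * G z `^ q.
    have [GA|AG] := leP (G z) A.
      apply: (@le_trans _ _ (A * k t z)); first by rewrite mulrC ler_wpM2r.
      by rewrite lerDl mulr_ge0 ?powR_ge0// ltW.
    apply: (@le_trans _ _ (A * G z `^ q)); last by rewrite lerDr mulr_ge0// ltW.
    have Gz0 : 0 < G z := lt_trans A0 AG.
    rewrite -[in leRHS]AE mulrAC mulrC; apply: ler_pM => //.
    have -> : G z `^ q = G z * G z `^ (q - 1) by rewrite mulr_powRB1// ltW.
    rewrite mulrCA -[leLHS]mulr1 ler_pM2l//.
    rewrite -[1 - q]opprB powRN mulrC ler_pdivlMr ?powR_gt0// mul1r.
    by apply: ge0_ler_powR; rewrite ?nnegrE; lra.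
  apply: (@le_trans _ _ (\int[mu]_z (A%:E * (k t z)%:E + A%:E * (G z `^ q)%:E))%E).
    apply: ge0_le_integral => //.
    - by move=> z _; rewrite lee_fin mulr_ge0.
    - apply: emeasurable_funD; apply: measurable_funeM; apply/measurable_EFinP => //.
      exact: (measurableT_comp (measurable_powR q)).
    - by move=> z _; rewrite -!EFinM -EFinD lee_fin.
  have mGq : measurable_fun [set: T] (fun z => (G z `^ q)%:E).
    by apply/measurable_EFinP; exact: (measurableT_comp (measurable_powR q)).
  have mkE : measurable_fun [set: T] (fun z => (k t z)%:E) by exact/measurable_EFinP.
  have AE0 : (0 <= A%:E)%E by rewrite lee_fin ltW.
  rewrite ge0_integralD//; last 4 first.
  - by move=> z _; rewrite mule_ge0// lee_fin.
  - exact: measurable_funeM.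
  - by move=> z _; rewrite mule_ge0// lee_fin powR_ge0.
  - exact: measurable_funeM.
  rewrite !ge0_integralZl//; last 2 first.
  - by move=> z _; rewrite lee_fin powR_ge0.
  - by move=> z _; rewrite lee_fin.
  rewrite mulr_natl mulr2n EFinD; apply: leeD.
    by rewrite -[leRHS]mule1 lee_wpmul2l.
  by rewrite -[leRHS]mule1 lee_wpmul2l.
pose M := expR (- c * S).
have mpdf r (f : R -> R) : measurable_fun [set: mR] f ->
    measurable_fun [set: mR] (fun t : mR => (exponential_pdf r (f t))%:E).
  move=> mf; apply/measurable_EFinP; apply: measurableT_comp mf.
  exact: measurable_exponential_pdf.
have pdf0 (r : R) x : 0 < r -> (0 <= (exponential_pdf r x)%:E)%E.
  by move=> r0; rewrite lee_fin exponential_pdf_ge0// ltW.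
apply: (@le_trans _ _ (\int[leb]_t ((a^-1 * M)%:E * (exponential_pdf a (S - t))%:E +
    (2 / c * M)%:E * (exponential_pdf c (t - S))%:E))%E).
  apply: ge0_le_integral => //.
  - by move=> t _; apply: integral_ge0 => z _; rewrite lee_fin mulr_ge0 ?expR_ge0// mulr_ge0.
  - apply: (@measurable_fun_fubini_tonelli_F _ _ mR T R mu
      (fun q : mR * T => (expR (a * q.1) * (k q.1 q.2 * G q.2))%:E)).
    + apply/measurable_EFinP; apply: measurable_funM.
        by meas.
      by apply: measurable_funM => //; exact: (measurableT_comp mG measurable_snd).
    + by move=> z; rewrite lee_fin mulr_ge0 ?expR_ge0// mulr_ge0.
  - by apply: emeasurable_funD; apply: measurable_funeM; apply: mpdf; meas.
  - move=> t _; under eq_integral do rewrite EFinM.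
    rewrite ge0_integralZl//; last first.
      by move=> z _; rewrite lee_fin mulr_ge0.
    have [tS|St] := leP t S.
      apply: (@le_trans _ _ ((a^-1 * M)%:E * (exponential_pdf a (S - t))%:E)%E); last first.
        by rewrite leeDl// mule_ge0 ?pdf0// lee_fin !mulr_ge0 ?invr_ge0 ?expR_ge0 ?(ltW c0).
      apply: (@le_trans _ _ ((expR (a * t))%:E * (expR (- S / q))%:E)%E).
        by rewrite lee_wpmul2l ?near_// lee_fin expR_ge0.
      rewrite exponential_pdfE ?subr_ge0// -!EFinM lee_fin.
      rewrite mulrACA mulVf ?gt_eqF// mul1r -!expRD ler_expR.
      by rewrite le_eqVlt; apply/orP; left; apply/eqP; rewrite /c; ring.
    apply: (@le_trans _ _ ((2 / c * M)%:E * (exponential_pdf c (t - S))%:E)%E); last first.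
      by rewrite leeDr// mule_ge0 ?pdf0// lee_fin !mulr_ge0 ?invr_ge0 ?expR_ge0 ?(ltW a0).
    apply: (@le_trans _ _ ((expR (a * t))%:E * (2 * expR (- t / q))%:E)%E).
      by rewrite lee_wpmul2l ?far_// lee_fin expR_ge0.
    rewrite exponential_pdfE ?subr_ge0 ?(ltW St)// -!EFinM lee_fin.
    rewrite (_ : 2 / c * M * _ = 2 * (M * expR (- c * (t - S)))); last by field; rewrite gt_eqF.
    rewrite mulrCA ler_pM2l// -!expRD ler_expR.
    by rewrite le_eqVlt; apply/orP; left; apply/eqP; rewrite /c; ring.
rewrite ge0_integralD//; last 4 first.
- by move=> t _; rewrite mule_ge0 ?pdf0// lee_fin !mulr_ge0 ?invr_ge0 ?expR_ge0 ?(ltW a0).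
- by apply: measurable_funeM; apply: mpdf; meas.
- by move=> t _; rewrite mule_ge0 ?pdf0// lee_fin !mulr_ge0 ?invr_ge0 ?expR_ge0 ?(ltW c0).
- by apply: measurable_funeM; apply: mpdf; meas.
rewrite !ge0_integralZl//; last 6 first.
- by apply: mpdf; meas.
- by move=> t _; exact: pdf0.
- by rewrite lee_fin !mulr_ge0 ?invr_ge0 ?expR_ge0 ?(ltW c0).
- by apply: mpdf; meas.
- by move=> t _; exact: pdf0.
- by rewrite lee_fin !mulr_ge0 ?invr_ge0 ?expR_ge0 ?(ltW a0).
rewrite integral_exponential_left// integral_exponential_right// !mule1 -EFinD.
by rewrite -mulrDl.
Qed.

(** The half of the bilinear form on which g^q <= b^p, for a fixed value [b] of
    the other function.  It is the previous bound for e^(-S) = b^p: the exponent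
    becomes p (1/q - a) = p - 1, and the factor [b] completes b^p. *)
Lemma slice_le (a p q b : R) (g : T -> R) : 0 < a -> 1 < p -> 1 < q ->
  p^-1 + q^-1 = 1 + a -> 0 <= b ->
  measurable_fun [set: T] g -> (forall z, 0 <= g z) ->
  (\int[mu]_z (g z `^ q)%:E <= 1)%E ->
  (\int[leb]_t \int[mu]_z (expR (a * t) * (k t z *
     (if g z `^ q <= b `^ p then b * g z else 0)))%:E <=
    ((a^-1 + 2 / (q^-1 - a)) * b `^ p)%:E)%E.
Proof.
move=> a0 p1 q1 pq b0 mg g0 gq.
have p0 : 0 < p by lra. have q0 : 0 < q by lra.
have ip1 : p^-1 < 1 by rewrite invf_lt1.
have aq : a < q^-1 by lra.
have c0 : 0 < q^-1 - a by lra.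
move: b0; rewrite le_eqVlt => /predU1P[<-|b0].
  under eq_integral => t _.
    under eq_integral => z _ do rewrite mul0r if_same mulr0 mulr0.
    rewrite integral0; over.
  by rewrite integral0 lee_fin mulr_ge0 ?powR_ge0// addr_ge0 ?invr_ge0 ?(ltW a0)// mulr_ge0 ?invr_ge0 ?(ltW c0).
pose G z := if g z `^ q <= b `^ p then g z else 0.
have mgq : measurable_fun [set: T] (fun z => g z `^ q).
  exact: (measurableT_comp (measurable_powR q)).
have mG : measurable_fun [set: T] G.
  apply: measurable_fun_ifT => //.
  by apply: measurable_fun_ler.
have G0 z : 0 <= G z by rewrite /G; case: ifP.
pose S := - (p * ln b).
have GS z : G z <= expR (- S / q).
  rewrite /G; case: ifP => [gb|_]; last exact: expR_ge0.
  have -> : g z = (g z `^ q) `^ q^-1 by rewrite -powRrM mulfV ?gt_eqF// powRr1.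
  have -> : expR (- S / q) = (b `^ p) `^ q^-1.
    by rewrite -powRrM /powR gt_eqF// /S opprK mulrAC.
  by apply: ge0_ler_powR; rewrite ?nnegrE ?powR_ge0 ?invr_ge0 ?(ltW q0).
have Gq : (\int[mu]_z (G z `^ q)%:E <= 1)%E.
  apply: le_trans gq; apply: ge0_le_integral => //.
  - by move=> z _; rewrite lee_fin powR_ge0.
  - by apply/measurable_EFinP; exact: (measurableT_comp (measurable_powR q)).
  - exact/measurable_EFinP.
  - move=> z _; rewrite lee_fin /G; case: ifP => // _.
    by rewrite powR0 ?gt_eqF// powR_ge0.
have := potential_le a0 q1 aq mG G0 GS Gq.
have -> : (\int[leb]_t \int[mu]_z (expR (a * t) * (k t z *
     (if g z `^ q <= b `^ p then b * g z else 0)))%:E =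
   b%:E * \int[leb]_t \int[mu]_z (expR (a * t) * (k t z * G z))%:E)%E.
  rewrite -ge0_integralZl//; last 3 first.
  - apply: (@measurable_fun_fubini_tonelli_F _ _ mR T R mu
      (fun q : mR * T => (expR (a * q.1) * (k q.1 q.2 * G q.2))%:E)).
    + apply/measurable_EFinP; apply: measurable_funM.
        by meas.
      by apply: measurable_funM => //; exact: (measurableT_comp mG measurable_snd).
    + by move=> z; rewrite lee_fin mulr_ge0 ?expR_ge0// mulr_ge0.
  - by move=> t _; apply: integral_ge0 => z _; rewrite lee_fin mulr_ge0 ?expR_ge0// mulr_ge0.
  - by rewrite lee_fin ltW.
  apply: eq_integral => t _; rewrite -ge0_integralZl//; last 3 first.
  - by apply/measurable_EFinP; apply: measurable_funM => //; apply: measurable_funM.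
  - by move=> z _; rewrite lee_fin mulr_ge0 ?expR_ge0// mulr_ge0.
  - by rewrite lee_fin ltW.
  apply: eq_integral => z _; rewrite -EFinM; congr EFin.
  by rewrite /G; case: ifP => _; ring.
move=> H; apply: (@le_trans _ _ (b%:E * ((a^-1 + 2 / (q^-1 - a)) * expR (- (q^-1 - a) * S))%:E)%E).
  by rewrite lee_wpmul2l// lee_fin ltW.
rewrite -EFinM lee_fin mulrCA ler_pM2l; last by rewrite addr_gt0 ?invr_gt0// divr_gt0.
have -> : expR (- (q^-1 - a) * S) = b `^ (p - 1).
  rewrite /powR gt_eqF//; congr expR; rewrite /S.
  have -> : q^-1 - a = 1 - p^-1 by lra.
  by field; rewrite gt_eqF.
by rewrite mulr_powRB1// ltW.
Qed.

End Potential.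

(** * The kernel of the Bessel potential *)

Section BesselKernel.
Context {R : realType}.
Local Notation leb := (@lebesgue_measure R).
Local Notation leb2 := (@plane R).
Local Notation mR := (measurableTypeR R).
Local Notation mR2 := (mR * mR)%type.
Local Notation mQ := (mR * mR2)%type.
Local Notation leb3 := (sigma_finite_product leb leb2).

(** Its integral over t is the kernel of (1 - Delta)^(-b) on the plane. *)
Definition kern (b : R) (q : R * (R * R)) : R :=
  weight b q.1 * heat q.1 q.2 / gamma_int b.

Lemma measurable_kern b : measurable_fun [set: mQ] (kern b).
Proof.
apply: measurable_funM => //; apply: measurable_funM; last exact: measurable_heat.
exact: (measurableT_comp (measurable_weight b) measurable_fst).
Qed.

Lemma kern_ge0 b q : 0 < b -> 0 <= kern b q.
Proof.
by move=> b0; rewrite mulr_ge0 ?invr_ge0 ?(ltW (gamma_int_gt0 b0))// mulr_ge0 ?expR_ge0// heat_ge0.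
Qed.

(** Lowering the exponent b to a costs only a constant, because e^(-e^t) beats
    every exponential for large t.  Thus the critical exponent handles all
    larger orders. *)
Lemma kern_le (a b : R) : 0 < b -> a <= b -> exists K, 0 <= K /\
  forall q, kern b q <= K * (expR (a * q.1) * heat q.1 q.2).
Proof.
move=> b0 ab; have g0 := gamma_int_gt0 b0.
have [m Hm] : exists m, forall t, (b - a) * t - expR t <= m.
  have [->|ba] := eqVneq b a.
    by exists 0 => t; rewrite subrr mul0r sub0r oppr_le0 expR_ge0.
  have c0 : 0 < b - a by rewrite subr_gt0 lt_neqAle eq_sym ba.
  exists ((b - a) * ln (b - a)) => t.
  have : (b - a) * (1 + (t - ln (b - a))) <= expR t.
    have -> : expR t = (b - a) * expR (t - ln (b - a)).
      by rewrite expRB lnK ?posrE// mulrCA divff ?mulr1// gt_eqF.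
    by rewrite ler_pM2l// expR_ge1Dx.
  nra.
exists (expR m / gamma_int b); split; first by rewrite divr_ge0 ?expR_ge0// ltW.
move=> q; rewrite /kern [leRHS]mulrAC ler_pM2r ?invr_gt0// [leRHS]mulrA.
rewrite ler_wpM2r ?heat_ge0// /weight -expRD ler_expR.
by have := Hm q.1; lra.
Qed.

Lemma ge0_integral3 (f : R * (R * R) -> \bar R) : measurable_fun [set: mQ] f ->
  (forall q, 0 <= f q)%E -> (\int[leb3]_q f q = \int[leb]_t \int[leb2]_z f (t, z))%E.
Proof. exact: (fubini_tonelli1 (m1 := leb) (m2 := leb2)). Qed.

Lemma integral_kern b : 0 < b -> (\int[leb3]_q (kern b q)%:E = 1)%E.
Proof.
move=> b0; rewrite ge0_integral3//; last 2 first.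
- by apply/measurable_EFinP; exact: measurable_kern.
- by move=> q; rewrite lee_fin kern_ge0.
have g0 := gamma_int_gt0 b0.
transitivity (\int[leb]_t ((gamma_int b)^-1%:E * (weight b t)%:E))%E.
  apply: eq_integral => t _.
  transitivity (\int[leb2]_z (((gamma_int b)^-1 * weight b t)%:E * (heat t z)%:E))%E.
    by apply: eq_integral => z _; rewrite -EFinM /kern/=; congr EFin; ring.
  rewrite ge0_integralZl//.
  - by rewrite integral_heat mule1.
  - apply/measurable_EFinP; exact: (measurableT_comp measurable_heat (measurable_pair1 t)).
  - by move=> z _; rewrite lee_fin heat_ge0.
  - by rewrite lee_fin mulr_ge0 ?invr_ge0 ?(ltW g0)// expR_ge0.
rewrite ge0_integralZl//.
- by rewrite gamma_intE// -EFinM mulVf// gt_eqF.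
- by apply/measurable_EFinP; exact: measurable_weight.
- by move=> t _; rewrite lee_fin expR_ge0.
- by rewrite lee_fin invr_ge0 ltW.
Qed.

(** Fubini exchanges the integrals; for fixed q the inner one is invariant under
    the translation by the space component of q.  This puts the shift on the
    other function. *)
Lemma ge0_integral_swap (F : (R * R) -> R * (R * R) -> \bar R) :
  measurable_fun [set: mR2 * mQ] (fun w : mR2 * mQ => F w.1 w.2) ->
  (forall x q, 0 <= F x q)%E ->
  (\int[leb2]_x \int[leb3]_q F x q = \int[leb2]_y \int[leb3]_q F (y - q.2)%R q)%E.
Proof.
move=> mF F0.
have msub : measurable_fun [set: mR2 * mQ] (fun w : mR2 * mQ => (w.1 - w.2.2, w.2)).
  apply: measurable_fun_pair; last exact: measurable_snd.
  by apply: measurable_fun_pair => /=; meas.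
have mF' := measurableT_comp mF msub.
transitivity (\int[leb3]_q \int[leb2]_x F x q)%E.
  exact: (fubini_tonelli (m1 := leb2) (m2 := leb3) (fun w => F w.1 w.2)).
transitivity (\int[leb3]_q \int[leb2]_y F (y - q.2)%R q)%E; last first.
  apply/esym.
  exact: (fubini_tonelli (m1 := leb2) (m2 := leb3) (fun w => F (w.1 - w.2.2)%R w.2)).
apply: eq_integral => q _; apply/esym.
apply: (@integral2_translate _ (- q.2)%R (fun y => F y q)).
exact: (measurableT_comp mF (measurable_pair2 q)).
Qed.

Definition potential (b : R) (f : R * R -> R) (x : R * R) : \bar R :=
  (\int[leb3]_q (kern b q * f (x + q.2)%R)%:E)%E.

Section Bilinear.
Variables (b : R) (f g : R * R -> R).
Hypotheses (b0 : 0 < b).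
Hypotheses (mf : measurable_fun [set: mR2] f) (mg : measurable_fun [set: mR2] g).
Hypotheses (f0 : forall x, 0 <= f x) (g0 : forall x, 0 <= g x).

Lemma measurable_shift : measurable_fun [set: mR2 * mQ] (fun w : mR2 * mQ => f (w.1 + w.2.2)%R).
Proof.
apply: (measurableT_comp mf).
by apply: measurable_fun_pair => /=; meas.
Qed.

Lemma measurable_potential : measurable_fun [set: mR2] (potential b f).
Proof.
apply: (@measurable_fun_fubini_tonelli_F _ _ mR2 mQ R leb3
  (fun w : mR2 * mQ => (kern b w.2 * f (w.1 + w.2.2)%R)%:E)).
  apply/measurable_EFinP; apply: measurable_funM; last exact: measurable_shift.
  exact: (measurableT_comp (measurable_kern b) measurable_snd).
by move=> w; rewrite lee_fin mulr_ge0// kern_ge0.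
Qed.

Lemma potential_ge0 x : (0 <= potential b f x)%E.
Proof. by apply: integral_ge0 => w _; rewrite lee_fin mulr_ge0// kern_ge0. Qed.

Let form := (\int[leb2]_x \int[leb3]_w (kern b w * (f (x + w.2)%R * g x))%:E)%E.

Lemma potential_formE : (\int[leb2]_x (potential b f x * (g x)%:E) = form)%E.
Proof.
apply: eq_integral => x _; rewrite muleC -ge0_integralZl//.
- by apply: eq_integral => w _; rewrite -EFinM; congr EFin; ring.
- apply/measurable_EFinP; apply: measurable_funM; first exact: measurable_kern.
  exact: (measurableT_comp measurable_shift (measurable_pair1 x)).
- by move=> w _; rewrite lee_fin mulr_ge0// kern_ge0.
- by rewrite lee_fin.
Qed.

End Bilinear.
End BesselKernel.

(** * Boundedness of the potential from Lp to Lp *)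

Section BilinearBound.
Context {R : realType}.
Local Notation leb := (@lebesgue_measure R).
Local Notation leb2 := (@plane R).
Local Notation mR := (measurableTypeR R).
Local Notation mR2 := (mR * mR)%type.
Local Notation mQ := (mR * mR2)%type.
Local Notation leb3 := (sigma_finite_product leb leb2).

Let mheat : measurable_fun [set: mQ] (fun q : mQ => heat q.1 q.2).
Proof. exact: measurable_heat. Qed.

Let heat1_le t : (\int[leb2]_z (heat t z)%:E <= 1)%E.
Proof. by rewrite integral_heat. Qed.

Lemma ge0_integral2D d1 d2 (T1 : measurableType d1) (T2 : measurableType d2)
    (mu : {measure set T1 -> \bar R}) (nu : {sigma_finite_measure set T2 -> \bar R})
    (K : R) (F G : T1 -> T2 -> \bar R) :
  0 <= K ->
  measurable_fun [set: T1 * T2] (fun w : T1 * T2 => F w.1 w.2) ->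
  measurable_fun [set: T1 * T2] (fun w : T1 * T2 => G w.1 w.2) ->
  (forall x q, 0 <= F x q)%E -> (forall x q, 0 <= G x q)%E ->
  (\int[mu]_x \int[nu]_q (K%:E * (F x q + G x q)) =
   K%:E * (\int[mu]_x \int[nu]_q F x q + \int[mu]_x \int[nu]_q G x q))%E.
Proof.
move=> K0 mF mG F0 G0.
have mFx x : measurable_fun [set: T2] (F x) by exact: (measurableT_comp mF (measurable_pair1 x)).
have mGx x : measurable_fun [set: T2] (G x) by exact: (measurableT_comp mG (measurable_pair1 x)).
have mIF := @measurable_fun_fubini_tonelli_F _ _ T1 T2 R nu (fun w => F w.1 w.2) mF (fun w => F0 _ _).
have mIG := @measurable_fun_fubini_tonelli_F _ _ T1 T2 R nu (fun w => G w.1 w.2) mG (fun w => G0 _ _).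
rewrite -ge0_integralD//; [|by move=> x _; exact: integral_ge0|by move=> x _; exact: integral_ge0].
rewrite -ge0_integralZl//; last 2 first.
- exact: emeasurable_funD.
- by move=> x _; apply: adde_ge0; exact: integral_ge0.
apply: eq_integral => x _; rewrite -ge0_integralD// -ge0_integralZl//.
- exact: emeasurable_funD.
- by move=> q _; exact: adde_ge0.
Qed.

(** [Phi1] and [Phi2] are the halves on which g^q, respectively f^p, is the larger
    power; they overlap where the powers agree.  In the first half x is fixed; in
    the second the variables are swapped so that y = x + z is fixed. *)
Lemma bilinear_critical (a b p q : R) :
  0 < b -> a <= b -> 0 < a -> 1 < p -> 1 < q -> p^-1 + q^-1 = 1 + a ->
  exists C, 0 <= C /\ forall f g : R * R -> R,
  measurable_fun [set: mR2] f -> measurable_fun [set: mR2] g ->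
  (forall x, 0 <= f x) -> (forall x, 0 <= g x) ->
  (\int[leb2]_x (f x `^ p)%:E <= 1)%E -> (\int[leb2]_x (g x `^ q)%:E <= 1)%E ->
  (\int[leb2]_x (potential b f x * (g x)%:E) <= C%:E)%E.
Proof.
move=> b0 ab a0 p1 q1 pq.
have [K [K0 HK]] := kern_le b0 ab.
have p0 : 0 < p := lt_trans ltr01 p1. have q0 : 0 < q := lt_trans ltr01 q1.
have ip1 : p^-1 < 1 by rewrite invf_lt1.
have iq1 : q^-1 < 1 by rewrite invf_lt1.
pose C1 := a^-1 + 2 / (p^-1 - a); pose C2 := a^-1 + 2 / (q^-1 - a).
have C10 : 0 <= C1 by rewrite addr_ge0 ?invr_ge0 ?(ltW a0)// divr_ge0//; lra.
have C20 : 0 <= C2 by rewrite addr_ge0 ?invr_ge0 ?(ltW a0)// divr_ge0//; lra.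
exists (K * (C1 + C2)); split; first by rewrite mulr_ge0// addr_ge0.
move=> f g mf mg f0 g0 f1 g1.
rewrite potential_formE//.
pose Phi1 (x : R * R) (w : R * (R * R)) := expR (a * w.1) * (heat w.1 w.2 *
  (if f (x + w.2) `^ p <= g x `^ q then g x * f (x + w.2) else 0)).
pose Phi2 (x : R * R) (w : R * (R * R)) := expR (a * w.1) * (heat w.1 w.2 *
  (if g x `^ q <= f (x + w.2) `^ p then f (x + w.2) * g x else 0)).
have mfs := measurable_shift mf.
have mgx : measurable_fun [set: mR2 * mQ] (fun w : mR2 * mQ => g w.1).
  exact: (measurableT_comp mg measurable_fst).
have mfp := measurableT_comp (measurable_powR p) mfs.
have mgq := measurableT_comp (measurable_powR q) mgx.
have mexp : measurable_fun [set: mR2 * mQ] (fun w : mR2 * mQ => expR (a * w.2.1)) by meas.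
have mh : measurable_fun [set: mR2 * mQ] (fun w : mR2 * mQ => heat w.2.1 w.2.2).
  exact: (measurableT_comp mheat measurable_snd).
have mPhi1 : measurable_fun [set: mR2 * mQ] (fun w : mR2 * mQ => (Phi1 w.1 w.2)%:E).
  apply/measurable_EFinP; apply: measurable_funM => //; apply: measurable_funM => //.
  apply: measurable_fun_ifT => //; first exact: measurable_fun_ler.
  exact: measurable_funM.
have mPhi2 : measurable_fun [set: mR2 * mQ] (fun w : mR2 * mQ => (Phi2 w.1 w.2)%:E).
  apply/measurable_EFinP; apply: measurable_funM => //; apply: measurable_funM => //.
  apply: measurable_fun_ifT => //; first exact: measurable_fun_ler.
  exact: measurable_funM.
have Phi10 x w : (0 <= (Phi1 x w)%:E)%E.
  by rewrite lee_fin mulr_ge0 ?expR_ge0// mulr_ge0 ?heat_ge0//; case: ifP => // _; exact: mulr_ge0.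
have Phi20 x w : (0 <= (Phi2 x w)%:E)%E.
  by rewrite lee_fin mulr_ge0 ?expR_ge0// mulr_ge0 ?heat_ge0//; case: ifP => // _; exact: mulr_ge0.
have I1 : (\int[leb2]_x \int[leb3]_w (Phi1 x w)%:E <= C1%:E)%E.
  apply: (@le_trans _ _ (\int[leb2]_x (C1%:E * (g x `^ q)%:E))%E).
    apply: ge0_le_integral => //.
    - by move=> x _; exact: integral_ge0.
    - exact: (@measurable_fun_fubini_tonelli_F _ _ mR2 mQ R leb3 (fun w => (Phi1 w.1 w.2)%:E)).
    - by apply: measurable_funeM; apply/measurable_EFinP; exact: (measurableT_comp (measurable_powR q)).
    - move=> x _; rewrite ge0_integral3//; last first.
        exact: (measurableT_comp mPhi1 (measurable_pair1 x)).
      rewrite -EFinM; apply: (@slice_le _ _ _ leb2 heat mheat heat_ge0 heat1_le heat_le a q p (g x)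
        (fun z => f (x + z))) => //; first by rewrite addrC.
        exact: (measurableT_comp mfs (measurableT_comp (measurable_pair1 x) (measurable_pair1 (0 : mR)))).
      apply: le_trans f1; rewrite le_eqVlt; apply/orP; left; apply/eqP.
      rewrite -(@integral2_translate _ x (fun z => (f z `^ p)%:E)).
        by apply: eq_integral => z _; rewrite addrC.
      by apply/measurable_EFinP; exact: (measurableT_comp (measurable_powR p)).
  rewrite ge0_integralZl//; last 2 first.
  - by apply/measurable_EFinP; exact: (measurableT_comp (measurable_powR q)).
  - by move=> x _; rewrite lee_fin powR_ge0.
  by rewrite -[leRHS]mule1; apply: lee_wpmul2l; rewrite ?lee_fin.
have I2 : (\int[leb2]_x \int[leb3]_w (Phi2 x w)%:E <= C2%:E)%E.
  rewrite ge0_integral_swap//.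
  apply: (@le_trans _ _ (\int[leb2]_x (C2%:E * (f x `^ p)%:E))%E).
    apply: ge0_le_integral => //.
    - by move=> x _; exact: integral_ge0.
    - apply: (@measurable_fun_fubini_tonelli_F _ _ mR2 mQ R leb3 (fun w => (Phi2 (w.1 - w.2.2)%R w.2)%:E)) => //.
      have msub : measurable_fun [set: mR2 * mQ] (fun w : mR2 * mQ => (w.1 - w.2.2, w.2)).
        apply: measurable_fun_pair; last exact: measurable_snd.
        by apply: measurable_fun_pair => /=; meas.
      exact: (measurableT_comp mPhi2 msub).
    - by apply: measurable_funeM; apply/measurable_EFinP; exact: (measurableT_comp (measurable_powR p)).
    - move=> y _; rewrite ge0_integral3//; last first.
        have msub : measurable_fun [set: mQ] (fun w : mQ => (y - w.2, w) : mR2 * mQ).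
          apply: measurable_fun_pair; last exact: measurable_id.
          exact: (measurableT_comp (measurable_reflect2 y) measurable_snd).
        exact: (measurableT_comp mPhi2 msub).
      rewrite /Phi2/= -EFinM.
      under eq_integral => t _ do under eq_integral => z _ do rewrite subrK.
      apply: (@slice_le _ _ _ leb2 heat mheat heat_ge0 heat1_le heat_le a p q (f y)
        (fun z => g (y - z))) => //.
        exact: (measurableT_comp mg (measurable_reflect2 y)).
      apply: le_trans g1; rewrite le_eqVlt; apply/orP; left; apply/eqP.
      apply: (@integral2_reflect _ y (fun z => (g z `^ q)%:E)).
      by apply/measurable_EFinP; exact: (measurableT_comp (measurable_powR q)).
  rewrite ge0_integralZl//; last 2 first.
  - by apply/measurable_EFinP; exact: (measurableT_comp (measurable_powR p)).
  - by move=> x _; rewrite lee_fin powR_ge0.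
  by rewrite -[leRHS]mule1; apply: lee_wpmul2l; rewrite ?lee_fin.
apply: (@le_trans _ _ (\int[leb2]_x \int[leb3]_w (K%:E * ((Phi1 x w)%:E + (Phi2 x w)%:E)))%E).
  have mL : measurable_fun [set: mR2 * mQ] (fun w : mR2 * mQ => (kern b w.2 * (f (w.1 + w.2.2) * g w.1))%:E).
    apply/measurable_EFinP; apply: measurable_funM; last exact: measurable_funM.
    exact: (measurableT_comp (measurable_kern b) measurable_snd).
  have mR' : measurable_fun [set: mR2 * mQ] (fun w : mR2 * mQ => (K%:E * ((Phi1 w.1 w.2)%:E + (Phi2 w.1 w.2)%:E))%E).
    by apply: measurable_funeM; exact: emeasurable_funD.
  have L0 (x : R * R) w : (0 <= (kern b w * (f (x + w.2) * g x))%:E)%E.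
    by rewrite lee_fin mulr_ge0 ?kern_ge0// mulr_ge0.
  have R0 x w : (0 <= K%:E * ((Phi1 x w)%:E + (Phi2 x w)%:E))%E.
    by apply: mule_ge0; [rewrite lee_fin|exact: adde_ge0].
  apply: ge0_le_integral => //.
  - by move=> x _; exact: integral_ge0.
  - exact: (@measurable_fun_fubini_tonelli_F _ _ mR2 mQ R leb3 _ mL (fun w => L0 _ _)).
  - exact: (@measurable_fun_fubini_tonelli_F _ _ mR2 mQ R leb3 _ mR' (fun w => R0 _ _)).
  - move=> x _; apply: ge0_le_integral => //.
    + exact: (measurableT_comp mL (measurable_pair1 x)).
    + exact: (measurableT_comp mR' (measurable_pair1 x)).
    + move=> w _; rewrite -EFinD -EFinM lee_fin.
      apply: (@le_trans _ _ (K * (expR (a * w.1) * heat w.1 w.2) * (f (x + w.2) * g x))).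
        by rewrite ler_wpM2r// mulr_ge0.
      rewrite -mulrA ler_wpM2l// /Phi1 /Phi2 -!mulrDr -mulrA.
      rewrite ler_wpM2l ?expR_ge0// ler_wpM2l ?heat_ge0//.
      have fg0 : 0 <= f (x + w.2) * g x by exact: mulr_ge0.
      rewrite [g x * _]mulrC; case: (leP (f (x + w.2) `^ p) (g x `^ q)) => h.
        by rewrite lerDl; case: ifP.
      by rewrite (ltW h) add0r.
rewrite (@ge0_integral2D _ _ mR2 mQ leb2 leb3)// EFinM EFinD.
by apply: lee_wpmul2l; rewrite ?lee_fin// leeD.
Qed.

End BilinearBound.

Section Duality.
Context {R : realType} {d : measure_display} {T : measurableType d}.
Variable mu : {sigma_finite_measure set T -> \bar R}.

(** Test with a normalised power h^(r - 1).  As [h] may be infinite and its norm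
    is not known to be finite, the test function is built from the truncations
    of [h] at height n on sets of finite measure, and n tends to infinity by
    monotone convergence. *)
Lemma dual_bound (r C : R) (h : T -> \bar R) : 1 < r -> 0 <= C ->
  measurable_fun setT h -> (forall x, 0 <= h x)%E ->
  (forall g : T -> R, measurable_fun setT g -> (forall x, 0 <= g x) ->
    (\int[mu]_x (g x `^ (r / (r - 1)))%:E <= 1)%E ->
    (\int[mu]_x (h x * (g x)%:E) <= C%:E)%E) ->
  (\int[mu]_x h x `^ r <= (C `^ r)%:E)%E.
Proof.
move=> r1 C0 mh h0 hC.
have r0 : 0 < r by lra. have rm : 0 < r - 1 by lra.
have /sigma_finiteP[F [TF ndF Foo]] := sigma_finiteT mu.
pose hn n x : R := fine (mine (h x) n%:R%:E) * \1_(F n) x.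
have mine_fin n x : mine (h x) n%:R%:E \is a fin_num.
  by rewrite fin_real// (lt_le_trans (ltNyr 0))/= ?le_min ?h0 ?lee_fin ?ler0n//= gt_min ltry orbT.
have hn0 n x : 0 <= hn n x by rewrite mulr_ge0// fine_ge0// le_min h0 lee_fin ler0n.
have mhn n : measurable_fun setT (hn n).
  apply: measurable_funM; last exact: measurable_indic (Foo n).1.
  by apply: measurableT_comp => //; exact: measurable_mine.
have hn_h n x : ((hn n x)%:E <= h x)%E.
  rewrite /hn indicE; case: (x \in F n); last by rewrite mulr0.
  by rewrite mulr1 fineK// ge_min lexx.
have mpow s n : measurable_fun setT (fun x => (hn n x `^ s)%:E).
  by apply/measurable_EFinP; exact: (measurableT_comp (measurable_powR s)).
have hn_bound n : (\int[mu]_x (hn n x `^ r)%:E <= (C `^ r)%:E)%E.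
  have Mfin : (\int[mu]_x (hn n x `^ r)%:E < +oo)%E.
    apply: (@le_lt_trans _ _ (\int[mu]_x ((n%:R `^ r)%:E * (\1_(F n) x)%:E))%E).
      apply: ge0_le_integral => //.
      - by move=> x _; rewrite lee_fin powR_ge0.
      - apply: measurable_funeM; apply/measurable_EFinP; exact: measurable_indic (Foo n).1.
      - move=> x _; rewrite -EFinM lee_fin /hn indicE; case: (x \in F n).
          rewrite !mulr1; apply: ge0_ler_powR; rewrite ?nnegrE ?(ltW r0) ?fine_ge0//.
            by rewrite le_min h0 lee_fin ler0n.
          by rewrite -lee_fin fineK// ge_min lexx orbT.
        by rewrite !mulr0 powR0// gt_eqF.
    rewrite ge0_integralZl//; last first.
      by apply/measurable_EFinP; exact: measurable_indic (Foo n).1.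
    rewrite integral_indic ?setIT//; last exact: (Foo n).1.
    by apply: lte_mul_pinfty; rewrite ?lee_fin ?powR_ge0// (Foo n).2.
  set M := (\int[mu]_x (hn n x `^ r)%:E)%E.
  have M0 : (0 <= M)%E by apply: integral_ge0 => x _; rewrite lee_fin powR_ge0.
  pose m := fine M.
  have ME : M = m%:E by rewrite fineK// ge0_fin_numE.
  rewrite -/M ME lee_fin.
  have := fine_ge0 M0; rewrite -/m le_eqVlt => /predU1P[<-|m0]; first exact: powR_ge0.
  pose q := r / (r - 1).
  have q0 : 0 < q by rewrite divr_gt0.
  pose c := (m `^ q^-1)^-1.
  have c0 : 0 < c by rewrite invr_gt0 powR_gt0.
  pose g x := c * hn n x `^ (r - 1).
  have gq x : g x `^ q = m^-1 * hn n x `^ r.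
    rewrite /g powRM ?powR_ge0 ?(ltW c0)// -powRrM /q mulrCA mulfV ?gt_eqF// mulr1.
    congr (_ * _); rewrite /c -powRN -powRrM mulNr mulVf ?gt_eqF//.
    by rewrite powRN powRr1// ltW.
  have := hC g.
  have mg : measurable_fun setT g.
    by apply: measurable_funM => //; exact: (measurableT_comp (measurable_powR (r - 1))).
  move=> /(_ mg (fun x => mulr_ge0 (ltW c0) (powR_ge0 _ _))).
  under eq_integral do rewrite -/q gq EFinM.
  rewrite ge0_integralZl//; last 2 first.
  - by move=> x _; rewrite lee_fin powR_ge0.
  - by rewrite lee_fin invr_ge0 ltW.
  rewrite -/M ME -EFinM mulVf ?gt_eqF// lexx => /(_ isT) H.
  have : ((m `^ r^-1)%:E <= C%:E)%E.
    apply: le_trans H.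
    apply: (@le_trans _ _ (\int[mu]_x (c%:E * (hn n x `^ r)%:E))%E).
      rewrite ge0_integralZl//; last 2 first.
      - by move=> x _; rewrite lee_fin powR_ge0.
      - by rewrite lee_fin ltW.
      rewrite -/M ME -EFinM lee_fin /c -powRN.
      have -> : m `^ (- q^-1) * m = m `^ (- q^-1 + 1).
        by rewrite powRD ?powRr1 ?(ltW m0)//; apply/implyP => _; rewrite gt_eqF.
      rewrite le_eqVlt; apply/orP; left; apply/eqP; congr (_ `^ _).
      by rewrite /q; field; rewrite !gt_eqF.
    apply: ge0_le_integral => //.
    - by move=> x _; rewrite -EFinM lee_fin mulr_ge0 ?powR_ge0// ltW.
    - exact: measurable_funeM.
    - apply: emeasurable_funM => //; exact/measurable_EFinP.
    - move=> x _; rewrite -EFinM.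
      apply: (@le_trans _ _ ((hn n x)%:E * (g x)%:E)%E).
        rewrite -EFinM lee_fin /g mulrCA mulr_powRB1//.
      by apply: lee_wpmul2r => //; rewrite lee_fin mulr_ge0 ?powR_ge0// ltW.
  rewrite lee_fin => mC.
  have -> : m = (m `^ r^-1) `^ r by rewrite -powRrM mulVf ?gt_eqF// powRr1// ltW.
  by apply: ge0_ler_powR; rewrite ?nnegrE ?powR_ge0 ?(ltW r0).
have hn_nd x : {homo (fun n => (hn n x `^ r)%:E) : n m / (n <= m)%N >-> (n <= m)%E}.
  move=> n m nm; rewrite lee_fin; apply: ge0_ler_powR; rewrite ?nnegrE ?(ltW r0)//.
  apply: ler_pM; rewrite ?fine_ge0 ?le_min ?h0 ?lee_fin ?ler0n//.
    apply: fine_le => //; rewrite le_min ge_min lexx/= ge_min.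
    by rewrite lee_fin ler_nat nm orbT.
  rewrite !indicE ler_nat; case: (boolP (x \in F n)) => // /set_mem xn.
  by rewrite mem_set//; have /subsetPset := ndF _ _ nm; apply.
have hn_cvg x : (hn n x `^ r)%:E @[n --> \oo] --> (h x `^ r)%E.
  have [N _ FNx] : (\bigcup_i F i) x by rewrite -TF.
  have Fx n : (N <= n)%N -> \1_(F n) x = 1 :> R.
    by move=> Nn; rewrite indicE mem_set//; have /subsetPset := ndF _ _ Nn; apply.
  have [hoo|hfin] := eqVneq (h x) +oo%E.
    rewrite hoo poweRyr ?gt_eqF//; apply/cvgeyPge => A.
    near=> n; rewrite lee_fin /hn Fx ?mulr1; last by near: n; exact: nbhs_infty_ge.
    rewrite hoo min_r ?leey//=.
    have n1 : 1 <= n%:R :> R by near: n; exact: nbhs_infty_ger.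
    apply: (@le_trans _ _ n%:R); first by near: n; exact: nbhs_infty_ger.
    by apply: le1r_powR => //; exact: ltW.
  have hE : h x = (fine (h x))%:E by rewrite fineK// ge0_fin_numE// ltey.
  apply: cvg_near_cst; near=> n.
  rewrite /hn Fx ?mulr1; last by near: n; exact: nbhs_infty_ge.
  rewrite min_l; first by rewrite hE.
  by rewrite hE lee_fin; near: n; exact: nbhs_infty_ger.
have -> : (\int[mu]_x h x `^ r = \int[mu]_x limn (fun n => (hn n x `^ r)%:E))%E.
  by apply: eq_integral => x _; apply/esym/cvg_lim => //; exact: hn_cvg.
rewrite monotone_convergence//; last by move=> n x _; rewrite lee_fin powR_ge0.
apply: lime_le.
  apply: ereal_nondecreasing_is_cvgn => n m nm; apply: ge0_le_integral => //.
  - by move=> x _; rewrite lee_fin powR_ge0.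
  - by move=> x _; exact: hn_nd.
by apply: nearW => n.
Unshelve. all: by end_near. Qed.

End Duality.

Section PotentialBound.
Context {R : realType}.
Local Notation leb := (@lebesgue_measure R).
Local Notation leb2 := (@plane R).
Local Notation mR := (measurableTypeR R).
Local Notation mR2 := (mR * mR)%type.
Local Notation mQ := (mR * mR2)%type.
Local Notation leb3 := (sigma_finite_product leb leb2).

(** The inequality f g <= f^p / p + g^q / q is integrated against the kernel,
    which has mass one in both variables. *)
Lemma bilinear_diagonal (b p q : R) (f g : R * R -> R) :
  0 < b -> 1 < p -> 1 < q -> p^-1 + q^-1 = 1 ->
  measurable_fun [set: mR2] f -> measurable_fun [set: mR2] g ->
  (forall x, 0 <= f x) -> (forall x, 0 <= g x) ->
  (\int[leb2]_x (f x `^ p)%:E <= 1)%E -> (\int[leb2]_x (g x `^ q)%:E <= 1)%E ->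
  (\int[leb2]_x (potential b f x * (g x)%:E) <= 2%:E)%E.
Proof.
move=> b0 p1 q1 pq mf mg f0 g0 f1 g1.
have p0 : 0 < p := lt_trans ltr01 p1. have q0 : 0 < q := lt_trans ltr01 q1.
rewrite potential_formE//.
pose Phi1 (x : R * R) (w : R * (R * R)) := (kern b w * f (x + w.2) `^ p)%:E.
pose Phi2 (x : R * R) (w : R * (R * R)) := (kern b w * g x `^ q)%:E.
have mfs := measurable_shift mf.
have mgx : measurable_fun [set: mR2 * mQ] (fun w : mR2 * mQ => g w.1).
  exact: (measurableT_comp mg measurable_fst).
have mfp := measurableT_comp (measurable_powR p) mfs.
have mgq := measurableT_comp (measurable_powR q) mgx.
have mk : measurable_fun [set: mR2 * mQ] (fun w : mR2 * mQ => kern b w.2).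
  exact: (measurableT_comp (measurable_kern b) measurable_snd).
have mPhi1 : measurable_fun [set: mR2 * mQ] (fun w : mR2 * mQ => Phi1 w.1 w.2).
  by apply/measurable_EFinP; apply: measurable_funM.
have mPhi2 : measurable_fun [set: mR2 * mQ] (fun w : mR2 * mQ => Phi2 w.1 w.2).
  by apply/measurable_EFinP; apply: measurable_funM.
have Phi10 x w : (0 <= Phi1 x w)%E by rewrite lee_fin mulr_ge0 ?kern_ge0 ?powR_ge0.
have Phi20 x w : (0 <= Phi2 x w)%E by rewrite lee_fin mulr_ge0 ?kern_ge0 ?powR_ge0.
have kernZ (u : R * R -> R) : (forall x, 0 <= u x) ->
    (\int[leb2]_x \int[leb3]_w (kern b w * u x)%:E = \int[leb2]_x (u x)%:E)%E.
  move=> u0; apply: eq_integral => x _.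
  under eq_integral do rewrite EFinM.
  rewrite ge0_integralZr//.
  - by rewrite integral_kern// mul1e.
  - by apply/measurable_EFinP; exact: measurable_kern.
  - by move=> w _; rewrite lee_fin kern_ge0.
  - by rewrite lee_fin.
have I1 : (\int[leb2]_x \int[leb3]_w Phi1 x w <= 1)%E.
  apply: le_trans f1; rewrite ge0_integral_swap// /Phi1.
  under eq_integral => x _ do under eq_integral => w _ do rewrite subrK.
  by rewrite (kernZ (fun x => f x `^ p))// => x; exact: powR_ge0.
have I2 : (\int[leb2]_x \int[leb3]_w Phi2 x w <= 1)%E.
  apply: le_trans g1.
  by rewrite (kernZ (fun x => g x `^ q))// => x; exact: powR_ge0.
apply: (@le_trans _ _ (\int[leb2]_x \int[leb3]_w (1%:E * (Phi1 x w + Phi2 x w)))%E).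
  have mL : measurable_fun [set: mR2 * mQ] (fun w : mR2 * mQ => (kern b w.2 * (f (w.1 + w.2.2) * g w.1))%:E).
    by apply/measurable_EFinP; apply: measurable_funM => //; exact: measurable_funM.
  have mR' : measurable_fun [set: mR2 * mQ] (fun w : mR2 * mQ => (1%:E * (Phi1 w.1 w.2 + Phi2 w.1 w.2))%E).
    by apply: measurable_funeM; exact: emeasurable_funD.
  have L0 (x : R * R) w : (0 <= (kern b w * (f (x + w.2) * g x))%:E)%E.
    by rewrite lee_fin mulr_ge0 ?kern_ge0// mulr_ge0.
  have R0 x w : (0 <= 1%:E * (Phi1 x w + Phi2 x w))%E.
    by apply: mule_ge0 => //; exact: adde_ge0.
  apply: ge0_le_integral => //.
  - by move=> x _; exact: integral_ge0.
  - exact: (@measurable_fun_fubini_tonelli_F _ _ mR2 mQ R leb3 _ mL (fun w => L0 _ _)).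
  - exact: (@measurable_fun_fubini_tonelli_F _ _ mR2 mQ R leb3 _ mR' (fun w => R0 _ _)).
  - move=> x _; apply: ge0_le_integral => //.
    + exact: (measurableT_comp mL (measurable_pair1 x)).
    + exact: (measurableT_comp mR' (measurable_pair1 x)).
    + move=> w _; rewrite -EFinD -EFinM lee_fin mul1r -mulrDr ler_wpM2l ?kern_ge0//.
      apply: (le_trans (conjugate_powR (f0 (x + w.2)) (g0 x) p0 q0 pq)).
      by apply: lerD; rewrite ler_pdivrMr// ler_peMr ?powR_ge0// ltW.
rewrite (@ge0_integral2D _ _ _ mR2 mQ leb2 leb3)// mul1e.
apply: (le_trans (leeD I1 I2)); rewrite -EFinD lee_fin; lra.
Qed.

(** Sobolev's inequality for the Bessel potential of order 2b, by duality. *)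
Lemma potential_Lp (b p0 p1 : R) : 0 < b -> 1 < p0 -> p0 <= p1 ->
  p0^-1 - p1^-1 <= b ->
  exists C, 0 <= C /\ forall f : R * R -> R,
    measurable_fun [set: mR2] f -> (forall x, 0 <= f x) ->
    (\int[leb2]_x (f x `^ p0)%:E <= 1)%E ->
    (\int[leb2]_x potential b f x `^ p1 <= (C `^ p1)%:E)%E.
Proof.
move=> b0 p01 p0p1 pb.
have p11 : 1 < p1 := lt_le_trans p01 p0p1.
pose q := p1 / (p1 - 1).
have q1 : 1 < q by rewrite ltr_pdivlMr ?mul1r; lra.
have qE : q^-1 = 1 - p1^-1.
  by rewrite /q; field; rewrite !gt_eqF//; lra.
have [C [C0 HC]] : exists C, 0 <= C /\ forall f g : R * R -> R,
    measurable_fun [set: mR2] f -> measurable_fun [set: mR2] g ->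
    (forall x, 0 <= f x) -> (forall x, 0 <= g x) ->
    (\int[leb2]_x (f x `^ p0)%:E <= 1)%E -> (\int[leb2]_x (g x `^ q)%:E <= 1)%E ->
    (\int[leb2]_x (potential b f x * (g x)%:E) <= C%:E)%E.
  move: p0p1; rewrite le_eqVlt => /predU1P[p0E|p0p1].
    exists 2; split => // f g *; apply: (@bilinear_diagonal b p0 q) => //.
    by rewrite qE p0E; ring.
  apply: (@bilinear_critical _ (p0^-1 - p1^-1)) => //; last by rewrite qE; ring.
  by rewrite subr_gt0 ltf_pV2 ?posrE//; lra.
exists C; split => // f mf f0 f1.
apply: dual_bound => //.
- exact: measurable_potential.
- by move=> x; exact: potential_ge0.
- by move=> g mg g0 gq; exact: HC.
Qed.

End PotentialBound.

(** * Second order calculus on the plane *)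

Section PlaneCalculus.
Context {R : realType}.
Implicit Types (f F : R * R -> R) (x h : R * R).

Local Notation D1 f := ('D_((1 : R), (0 : R)) f).
Local Notation D2 f := ('D_((0 : R), (1 : R)) f).

Lemma is_derive_fst f (s y : R) : differentiable f (s, y) ->
  is_derive s (1 : R) (fun s => f (s, y)) (D1 f (s, y)).
Proof.
move=> df; have := @diff_derivable _ _ _ f (s, y) (1, 0) df.
have E : (fun h : R => h^-1 *: ((f \o shift (s, y)) (h *: ((1, 0) : R * R)) - f (s, y))) =
    (fun h : R => h^-1 *: (((fun s => f (s, y)) \o shift s) (h *: (1 : R)) - f (s, y))).
  apply/funext => h /=; congr (_ *: (f _ - _)).
  by congr (_, _); rewrite /= /GRing.scale/= mulr0 add0r.
rewrite /derivable E => H; apply: DeriveDef => //.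
by rewrite /derive E.
Qed.

Lemma is_derive_snd f (s y : R) : differentiable f (s, y) ->
  is_derive y (1 : R) (fun y => f (s, y)) (D2 f (s, y)).
Proof.
move=> df; have := @diff_derivable _ _ _ f (s, y) (0, 1) df.
have E : (fun h : R => h^-1 *: ((f \o shift (s, y)) (h *: ((0, 1) : R * R)) - f (s, y))) =
    (fun h : R => h^-1 *: (((fun y => f (s, y)) \o shift y) (h *: (1 : R)) - f (s, y))).
  apply/funext => h /=; congr (_ *: (f _ - _)).
  by congr (_, _); rewrite /= /GRing.scale/= mulr0 add0r.
rewrite /derivable E => H; apply: DeriveDef => //.
by rewrite /derive E.
Qed.

Lemma mean_value (g g' : R -> R) (a h : R) :
  (forall t : R, is_derive t (1 : R) g (g' t)) ->
  exists2 c, `|c - a| <= `|h| & g (a + h) - g a = g' c * h.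
Proof.
move=> dg.
have cg (u v : R) : {within `[u, v], continuous g}.
  by apply: derivable_within_continuous => t _; have [] := dg t.
have [h0|h0] := leP 0 h.
  have ah : a <= a + h by rewrite lerDl.
  have [c cI ->] := MVT_segment ah (fun t _ => dg t) (cg _ _).
  exists c; last by congr (_ * _); ring.
  by move: cI; rewrite in_itv/= => /andP[ac ca]; rewrite !ger0_norm; lra.
have ah : a + h <= a by lra.
have [c cI E] := MVT_segment ah (fun t _ => dg t) (cg _ _).
exists c; last by rewrite -opprB E; ring.
by move: cI; rewrite in_itv/= => /andP[ac ca]; rewrite !ler0_norm; lra.
Qed.

Lemma diff_expansion f x : differentiable f x -> forall e, 0 < e ->
  exists2 d, 0 < d & forall h, `|h| < d ->
    `|f (x + h) - f x - (D1 f x * h.1 + D2 f x * h.2)| <= e * `|h|.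
Proof.
move=> df e e0.
have /eqaddoP/(_ e e0) := diff_locally df.
rewrite near_nbhs => /nbhs_ballP[d /= d0 H]; exists d => // h hd.
have := H h; rewrite -ball_normE/= sub0r normrN => /(_ hd).
rewrite /= !fctE/= [h + x]addrC opprD addrA.
have -> : 'd f x h = D1 f x * h.1 + D2 f x * h.2.
  rewrite !deriveE//.
  have -> : 'd f x h = 'd f x (h.1 *: (1, 0) + h.2 *: (0, 1)).
    congr ('d f x _); case: h {hd} => h1 h2.
    transitivity (h1 * 1 + h2 * 0, h1 * 0 + h2 * 1); last by [].
    by rewrite !mulr0 !mulr1 addr0 add0r.
  by rewrite linearD !linearZ /= /GRing.scale/=; ring.
by [].
Qed.

Lemma diff_expansion2 f (u v : R) : differentiable f (u, v) -> forall e, 0 < e ->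
  exists2 d, 0 < d & forall (s t m : R), `|s| <= m -> `|t| <= m -> m < d ->
    `|f (u + s, v + t) - f (u, v) - (D1 f (u, v) * s + D2 f (u, v) * t)| <= e * m.
Proof.
move=> df e e0; have [d d0 H] := diff_expansion df e0; exists d => // s t m sm tm md.
have nm : `|((s, t) : R * R)| <= m by rewrite prod_normE/= ge_max sm.
by apply: (le_trans (H (s, t) (le_lt_trans nm md))); rewrite ler_wpM2l// ltW.
Qed.

(** The converse of Taylor's formula, through which differentiability of an
    integral is read off from an integrated expansion. *)
Lemma differentiable_of_expansion F x (a b M : R) :
  (forall h, `|F (x + h) - F x - (a * h.1 + b * h.2)| <= M * (`|h.1| + `|h.2|) ^+ 2) ->
  [/\ differentiable F x, D1 F x = a & D2 F x = b].
Proof.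
move=> HM.
pose L (h : R * R) : R := a * h.1 + b * h.2.
have linL : linear L.
  by move=> k u v; rewrite /L /= /GRing.scale/=; ring.
pose Ll : {linear (R * R)%type -> R^o} := HB.pack L (GRing.isLinear.Build _ _ _ _ L linL).
have cL : continuous Ll.
  move=> u; apply: (@continuousD _ _ _ (fun h : R * R => a * h.1) (fun h : R * R => b * h.2)).
    by apply: (@continuousM _ _ (cst a) (fst : R * R -> R)); [exact: cst_continuous|exact: cvg_fst].
  by apply: (@continuousM _ _ (cst b) (snd : R * R -> R)); [exact: cst_continuous|exact: cvg_snd].
have LE : F \o shift x = cst (F x) + Ll +o_ (0 : R * R) id.
  apply/eqaddoP => e e0; rewrite near_nbhs; apply/nbhs_ballP.
  exists (e / (4 * `|M| + 1)) => /=; first by rewrite divr_gt0//; have := normr_ge0 M; lra.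
  move=> h; rewrite -ball_normE/= sub0r normrN => hd.
  rewrite !fctE/= [h + x]addrC opprD addrA.
  apply: (le_trans (HM h)).
  have h1 : `|h.1| <= `|h| by rewrite prod_normE le_max lexx.
  have h2 : `|h.2| <= `|h| by rewrite prod_normE le_max lexx orbT.
  have s2 : (`|h.1| + `|h.2|) ^+ 2 <= 4 * `|h| * `|h|.
    by rewrite expr2; have := normr_ge0 h.1; have := normr_ge0 h.2; nra.
  move: hd; rewrite ltr_pdivlMr; last by have := normr_ge0 M; lra.
  move=> hd; apply: (@le_trans _ _ (`|M| * (4 * `|h| * `|h|))).
    apply: (@le_trans _ _ (`|M| * (`|h.1| + `|h.2|) ^+ 2)).
      by rewrite ler_wpM2r ?sqr_ge0 ?ler_norm.
    by rewrite ler_wpM2l.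
  have := ler_wpM2r (normr_ge0 h) (ltW hd).
  by have := sqr_ge0 `|h|; have := normr_ge0 M; nra.
have dE := diff_unique cL LE.
have dF : differentiable F x.
  by apply/diff_locallyP; rewrite dE.
split => //; rewrite deriveE// dE /= /L/=; ring.
Qed.

Lemma second_difference_le (h e X Y A c1 c2 Q : R) : 0 < h -> c1 - c2 = Q * h ->
  `|Y - A - c1| <= e * h -> `|X - A - c2| <= e * h ->
  `|(Y - X) * h - Q * h ^+ 2| <= 2 * e * h ^+ 2.
Proof.
move=> h0 c12 G1 G2.
have -> : (Y - X) * h - Q * h ^+ 2 = h * ((Y - A - c1) - (X - A - c2)).
  by rewrite expr2 mulrA -c12; ring.
rewrite normrM (ger0_norm (ltW h0)) expr2 mulrCA ler_wpM2l ?(ltW h0)//.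
by apply: (le_trans (ler_normB _ _)); lra.
Qed.

Lemma second_difference_unique (h e Delta Q Q' : R) : 0 < h ->
  `|Delta - Q * h ^+ 2| <= e * h ^+ 2 -> `|Delta - Q' * h ^+ 2| <= e * h ^+ 2 ->
  `|Q - Q'| <= 2 * e.
Proof.
move=> h0 B1 B2; have h20 : 0 < h ^+ 2 by rewrite exprn_gt0.
rewrite -(ler_pM2r h20) -[in leLHS](ger0_norm (ltW h20)) -normrM.
have -> : (Q - Q') * h ^+ 2 = (Delta - Q' * h ^+ 2) - (Delta - Q * h ^+ 2) by ring.
by apply: (le_trans (ler_normB _ _)); lra.
Qed.

(* A first order expansion with the remainder measured by the maximum norm. *)
Let expands (g : R * R -> R) (u v P Q : R) := forall e : R, 0 < e ->
  exists2 d : R, 0 < d & forall (s t m : R), `|s| <= m -> `|t| <= m -> m < d ->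
    `|g (u + s, v + t) - g (u, v) - (P * s + Q * t)| <= e * m.

(** The second difference of [f] over a square of side h is approximated up to
    o(h^2) by Q h^2 when the mean value theorem is applied horizontally first,
    and by Q' h^2 when it is applied vertically first. *)
Lemma mixed_expansion_comm f (g1 g2 : R * R -> R) (u v P Q P' Q' : R) :
  (forall s y : R, is_derive s (1 : R) (fun s => f (s, y)) (g1 (s, y))) ->
  (forall s y : R, is_derive y (1 : R) (fun y => f (s, y)) (g2 (s, y))) ->
  expands g1 u v P Q -> expands g2 u v Q' P' -> Q = Q'.
Proof.
move=> df1 df2 Hg1 Hg2.
apply/eqP; rewrite -subr_eq0 -normr_le0; apply/ler_addgt0Pr => e e0.
have e4 : 0 < e / 4 by lra.
have [d1 d10 H1] := Hg1 _ e4.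
have [d2 d20 H2] := Hg2 _ e4.
have [h [h0 hd1 hd2]] : exists h : R, [/\ 0 < h, h < d1 & h < d2].
  exists (Num.min d1 d2 / 2).
  have m0 : 0 < Num.min d1 d2 by rewrite lt_min d10.
  have m1 : Num.min d1 d2 <= d1 by rewrite ge_min lexx.
  have m2 : Num.min d1 d2 <= d2 by rewrite ge_min lexx orbT.
  by split; lra.
have nh : `|h| <= h by rewrite ger0_norm// ltW.
have n0 : `|0 : R| <= h by rewrite normr0 ltW.
have vE (a b : R) : a + (b - a) = b by ring.
have eE : 0 + e = 2 * (2 * (e / 4)) by field.
rewrite eE.
apply: (second_difference_unique h0
  (Delta := f (u + h, v + h) - f (u + h, v) - f (u, v + h) + f (u, v))).
- have [xi xih E] := @mean_value (fun s => f (s, v + h) - f (s, v))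
    (fun s => g1 (s, v + h) - g1 (s, v)) u h
    (fun s => is_deriveB (df1 s (v + h)) (df1 s v)).
  have {}xih : `|xi - u| <= h by rewrite (le_trans xih).
  have G1 := H1 (xi - u) h h xih nh hd1.
  have G2 := H1 (xi - u) 0 h xih n0 hd1.
  move: G1 G2; rewrite vE [v + 0]addr0 => G1 G2.
  rewrite (_ : f (u + h, v + h) - f (u + h, v) - f (u, v + h) + f (u, v) =
    (g1 (xi, v + h) - g1 (xi, v)) * h); last by rewrite -E; ring.
  by apply: (second_difference_le h0 _ G1 G2); ring.
- have [xi xih E] := @mean_value (fun s => f (u + h, s) - f (u, s))
    (fun s => g2 (u + h, s) - g2 (u, s)) v h
    (fun s => is_deriveB (df2 (u + h) s) (df2 u s)).
  have {}xih : `|xi - v| <= h by rewrite (le_trans xih).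
  have G1 := H2 h (xi - v) h nh xih hd2.
  have G2 := H2 0 (xi - v) h n0 xih hd2.
  move: G1 G2; rewrite vE [u + 0]addr0 => G1 G2.
  rewrite (_ : f (u + h, v + h) - f (u + h, v) - f (u, v + h) + f (u, v) =
    (g2 (u + h, xi) - g2 (u, xi)) * h); last by rewrite -E; ring.
  by apply: (second_difference_le h0 _ G1 G2); ring.
Qed.

(** Young's theorem, in the form that asks only for differentiability of the first
    derivatives.  It is needed because [pderiv] applies the derivatives in a fixed
    order. *)
Lemma mixed_derivative_comm f x : (forall y, differentiable f y) ->
  differentiable (D1 f) x -> differentiable (D2 f) x -> D2 (D1 f) x = D1 (D2 f) x.
Proof.
case: x => u v df d1f d2f.
have H1 := diff_expansion2 d1f; have H2 := diff_expansion2 d2f.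
apply: (@mixed_expansion_comm f (D1 f) (D2 f) u v _ _ _ _ _ _ H1 H2) => s y.
- exact: is_derive_fst.
- exact: is_derive_snd.
Qed.

(** The increment is split into a horizontal and a vertical one; the mean value
    theorem is applied to each, and again to the resulting first derivatives. *)
Lemma taylor_bound_of_derive f (g1 g2 g11 g12 g22 : R * R -> R) (M : R) :
  (forall s y : R, is_derive s (1 : R) (fun s => f (s, y)) (g1 (s, y))) ->
  (forall s y : R, is_derive y (1 : R) (fun y => f (s, y)) (g2 (s, y))) ->
  (forall s y : R, is_derive s (1 : R) (fun s => g1 (s, y)) (g11 (s, y))) ->
  (forall s y : R, is_derive y (1 : R) (fun y => g1 (s, y)) (g12 (s, y))) ->
  (forall s y : R, is_derive y (1 : R) (fun y => g2 (s, y)) (g22 (s, y))) ->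
  (forall y, `|g11 y| <= M) -> (forall y, `|g12 y| <= M) -> (forall y, `|g22 y| <= M) ->
  forall u v h k : R, `|f (u + h, v + k) - f (u, v) - (g1 (u, v) * h + g2 (u, v) * k)| <=
    M * (`|h| + `|k|) ^+ 2.
Proof.
move=> df1 df2 dg11 dg12 dg22 M11 M12 M22 u v h k.
have M0 : 0 <= M := le_trans (normr_ge0 _) (M11 0).
have vE (a b : R) : a + (b - a) = b by ring.
have [xi xih E1] := @mean_value _ _ u h (fun s => df1 s (v + k)).
have [et etk E2] := @mean_value _ _ v k (fun s => df2 u s).
have [a _ E3] := @mean_value _ _ u (xi - u) (fun s => dg11 s (v + k)).
have [b _ E4] := @mean_value _ _ v k (fun s => dg12 u s).
have [c _ E5] := @mean_value _ _ v (et - v) (fun s => dg22 u s).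
move: E3 E5; rewrite !vE => E3 E5.
have E1' : f (u + h, v + k) = f (u, v + k) + g1 (xi, v + k) * h by rewrite -E1; ring.
have E2' : f (u, v + k) = f (u, v) + g2 (u, et) * k by rewrite -E2; ring.
have E3' : g1 (xi, v + k) = g1 (u, v + k) + g11 (a, v + k) * (xi - u) by rewrite -E3; ring.
have E4' : g1 (u, v + k) = g1 (u, v) + g12 (u, b) * k by rewrite -E4; ring.
have E5' : g2 (u, et) = g2 (u, v) + g22 (u, c) * (et - v) by rewrite -E5; ring.
have -> : f (u + h, v + k) - f (u, v) - (g1 (u, v) * h + g2 (u, v) * k) =
    g11 (a, v + k) * (xi - u) * h + g12 (u, b) * k * h + g22 (u, c) * (et - v) * k.
  by rewrite E1' E2' E3' E4' E5'; ring.
apply: (le_trans (ler_normD _ _)).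
apply: (@le_trans _ _ (M * `|h| * `|h| + M * `|k| * `|h| + M * `|k| * `|k|)); last first.
  have := mulr_ge0 M0 (mulr_ge0 (normr_ge0 h) (normr_ge0 k)).
  by rewrite expr2; nra.
apply: lerD; last by rewrite !normrM; apply: ler_pM => //; apply: ler_pM.
apply: (le_trans (ler_normD _ _)).
by apply: lerD; rewrite !normrM; apply: ler_pM => //; apply: ler_pM.
Qed.

Lemma taylor_bound f (M : R) : (forall y, differentiable f y) ->
  (forall y, differentiable (D1 f) y) -> (forall y, differentiable (D2 f) y) ->
  (forall y, `|D1 (D1 f) y| <= M) -> (forall y, `|D2 (D1 f) y| <= M) ->
  (forall y, `|D2 (D2 f) y| <= M) ->
  forall x h, `|f (x + h) - f x - (D1 f x * h.1 + D2 f x * h.2)| <=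
    M * (`|h.1| + `|h.2|) ^+ 2.
Proof.
move=> df d1f d2f M11 M21 M22 [u v] [h k].
exact: (@taylor_bound_of_derive f (D1 f) (D2 f) (D1 (D1 f)) (D2 (D1 f)) (D2 (D2 f)) M
  (fun s y => is_derive_fst (df (s, y))) (fun s y => is_derive_snd (df (s, y)))
  (fun s y => is_derive_fst (d1f (s, y))) (fun s y => is_derive_snd (d1f (s, y)))
  (fun s y => is_derive_snd (d2f (s, y))) M11 M21 M22 u v h k).
Qed.

End PlaneCalculus.

(** * Continuous functions on the plane are measurable *)

Section ContinuousMeasurable.
Context {R : realType}.
Local Notation mR := (measurableTypeR R).
Local Notation mR2 := (mR * mR)%type.

(** An open set is the union of the open squares with rational centre and radius
    that it contains. *)
Lemma open_plane_measurable (S : set (R * R)) : open S -> measurable (S : set mR2).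
Proof.
move=> oS.
pose B (c : rat * rat * rat) : set mR2 :=
  `](ratr c.1.1 - ratr c.2 : R), (ratr c.1.1 + ratr c.2)[ `*` `](ratr c.1.2 - ratr c.2), (ratr c.1.2 + ratr c.2)[.
have mB c : measurable (B c) by apply: measurableX; exact: measurable_itv.
have -> : S = \bigcup_c (if `[< B c `<=` S >] then B c else set0).
  apply/seteqP; split=> [[u v] Sx|x [c _]]; last by case: asboolP => // cS; exact: cS.
  have /nbhs_ballP[e /= e0 eS] := open_nbhs_nbhs (conj oS Sx).
  have e42 : e / 4 < e / 2 by lra.
  have [r] := rat_in_itvoo e42; rewrite in_itv/= => /andP[r1 r2].
  have r0 : 0 < ratr r :> R by lra.
  have lu : u - ratr r < u + ratr r by lra.
  have lv : v - ratr r < v + ratr r by lra.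
  have [q1] := rat_in_itvoo lu; rewrite in_itv/= => /andP[q11 q12].
  have [q2] := rat_in_itvoo lv; rewrite in_itv/= => /andP[q21 q22].
  exists (q1, q2, r) => //; case: asboolP => [_|].
    by split=> /=; rewrite in_itv/=; apply/andP; split; lra.
  move=> BS; exfalso; apply: BS => -[u' v'] [/=]; rewrite !in_itv/= => /andP[a1 a2] /andP[b1 b2].
  apply: eS; split; rewrite /= -ball_normE/= ltr_norml; apply/andP; split; lra.
apply: countable_bigcupT_measurable; first exact: countableP.
by move=> c; case: ifP.
Qed.

Lemma continuous_plane_measurable (f : R * R -> R) : continuous f ->
  measurable_fun [set: mR2] f.
Proof.
move=> cf mD; apply: (measurability _ (RGenOInfty.measurableE R)) => //.
move=> /= _ [_ [a ->] <-]; rewrite setTI; apply: open_plane_measurable.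
apply: open_comp => //; exact: open_itv.
Qed.

End ContinuousMeasurable.

(** * Averages of translates of a Schwartz function *)

Lemma iter_comm_on (T : Type) (S : T -> Prop) (d1 d2 : T -> T) (n : nat) (g : T) :
  (forall g, S g -> S (d2 g)) -> (forall g, S g -> d2 (d1 g) = d1 (d2 g)) ->
  S g -> iter n d2 (d1 g) = d1 (iter n d2 g).
Proof.
move=> S2 comm; elim: n g => // n IH g Sg.
by rewrite !iterSr comm// IH//; exact: S2.
Qed.

Section SchwartzClass.
Context {R : realType}.
Local Notation mR := (measurableTypeR R).
Local Notation mR2 := (mR * mR)%type.
Local Notation D1 f := ('D_((1 : R), (0 : R)) f).
Local Notation D2 f := ('D_((0 : R), (1 : R)) f).

(** The real-valued Schwartz class; complex Schwartz functions are treated through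
    their real and imaginary parts. *)
Definition rschwartz (f : R * R -> R) : Prop :=
  smooth_on setT f /\
  forall (k : nat) (a : nat * nat), exists B : R, forall x : R * R,
    (1 + enorm x) ^+ k * `|pderiv a f x| <= B.

Lemma measurable_enorm : measurable_fun [set: mR2] (@enorm R).
Proof.
apply: (measurableT_comp (continuous_measurable_fun (@sqrt_continuous R))).
by apply: measurable_funD; apply: measurable_funX.
Qed.

Lemma enorm_ge0 (x : R * R) : 0 <= enorm x.
Proof. exact: sqrtr_ge0. Qed.

Lemma enormD (x y : R * R) : enorm (x + y) <= enorm x + enorm y.
Proof.
have sq (z : R * R) : enorm z ^+ 2 = z.1 ^+ 2 + z.2 ^+ 2.
  by rewrite sqr_sqrtr// addr_ge0 ?sqr_ge0.
rewrite -(@ler_pXn2r _ 2)// ?nnegrE ?addr_ge0 ?enorm_ge0//.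
rewrite sqrrD !sq /=.
suff : x.1 * y.1 + x.2 * y.2 <= enorm x * enorm y by rewrite mulr2n; lra.
have [c0|c0] := leP (x.1 * y.1 + x.2 * y.2) 0.
  by rewrite (le_trans c0)// mulr_ge0 ?enorm_ge0.
rewrite -(@ler_pXn2r _ 2)// ?nnegrE ?(ltW c0) ?mulr_ge0 ?enorm_ge0//.
rewrite exprMn !sq; have := sqr_ge0 (x.1 * y.2 - x.2 * y.1); lra.
Qed.

(** Peetre's inequality: decay survives a translation by z at the price of a power
    of 1 + |z|, which is what the moments of the kernel pay for. *)
Lemma onep_enorm_le (k : nat) (x z : R * R) :
  (1 + enorm x) ^+ k <= (1 + enorm z) ^+ k * (1 + enorm (x - z)) ^+ k.
Proof.
rewrite -exprMn; apply: lerXn2r; rewrite ?nnegrE ?mulr_ge0 ?addr_ge0 ?enorm_ge0//.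
have := enormD (x - z) z; rewrite subrK.
by have := enorm_ge0 z; have := enorm_ge0 (x - z); nra.
Qed.

Lemma smooth_differentiable (f : R * R -> R) x : smooth_on setT f -> differentiable f x.
Proof. by move=> sf; exact: (sf (0, 0)%N x I). Qed.

Lemma pderivD2 (a : nat * nat) (f : R * R -> R) : pderiv a (D2 f) = pderiv (a.1, a.2.+1) f.
Proof. by rewrite /pderiv/= -iterSr. Qed.

Lemma smoothD2 (f : R * R -> R) : smooth_on setT f -> smooth_on setT (D2 f).
Proof. by move=> sf a x _; rewrite pderivD2; exact: sf. Qed.

Lemma pderivD1 (a : nat * nat) (f : R * R -> R) : smooth_on setT f ->
  pderiv a (D1 f) = pderiv (a.1.+1, a.2) f.
Proof.
case: a => a1 a2 sf; rewrite /pderiv [fst _]/= [snd _]/=.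
have -> : iter a2 (fun g : R * R -> R => D2 g) (D1 f) =
    D1 (iter a2 (fun g : R * R -> R => D2 g) f).
  apply: (@iter_comm_on _ (smooth_on setT) (fun g => D1 g) (fun g => D2 g)) => [|g sg|].
  - exact: smoothD2.
  - apply/funext => x; apply: mixed_derivative_comm.
    + by move=> y; exact: smooth_differentiable.
    + exact: (sg (1, 0)%N x I).
    + exact: (sg (0, 1)%N x I).
  - exact: sf.
by rewrite -iterSr.
Qed.

Lemma smoothD1 (f : R * R -> R) : smooth_on setT f -> smooth_on setT (D1 f).
Proof. by move=> sf a x _; rewrite pderivD1//; exact: sf. Qed.

Lemma rschwartzD1 (f : R * R -> R) : rschwartz f -> rschwartz (D1 f).
Proof.
by move=> [sf df]; split=> [|k a]; [exact: smoothD1|rewrite pderivD1//; exact: df].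
Qed.

Lemma rschwartzD2 (f : R * R -> R) : rschwartz f -> rschwartz (D2 f).
Proof.
by move=> [sf df]; split=> [|k a]; [exact: smoothD2|rewrite pderivD2; exact: df].
Qed.

Lemma rschwartz_decay (f : R * R -> R) (k : nat) : rschwartz f ->
  exists B : R, 0 <= B /\ forall x, (1 + enorm x) ^+ k * `|f x| <= B.
Proof.
move=> [_ /(_ k (0, 0)%N)[B HB]]; exists B; split => [|x]; last exact: HB.
by apply: le_trans (HB 0); rewrite mulr_ge0// exprn_ge0// addr_ge0// enorm_ge0.
Qed.

Lemma rschwartz_bounded (f : R * R -> R) : rschwartz f ->
  exists B : R, 0 <= B /\ forall x, `|f x| <= B.
Proof.
move=> /(@rschwartz_decay _ 0)[B [B0 HB]]; exists B; split => // x.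
by have := HB x; rewrite expr0 mul1r.
Qed.

Lemma rschwartz_continuous (f : R * R -> R) : rschwartz f -> continuous f.
Proof.
by move=> [sf _] x; apply: differentiable_continuous; exact: smooth_differentiable.
Qed.

Lemma rschwartz_measurable (f : R * R -> R) : rschwartz f -> measurable_fun [set: mR2] f.
Proof. by move=> sf; apply: continuous_plane_measurable; exact: rschwartz_continuous. Qed.

Lemma rschwartz_taylor (f : R * R -> R) : rschwartz f -> exists M, 0 <= M /\
  forall x h, `|f (x + h) - f x - (D1 f x * h.1 + D2 f x * h.2)| <=
    M * (`|h.1| + `|h.2|) ^+ 2.
Proof.
move=> rf; have rf1 := rschwartzD1 rf; have rf2 := rschwartzD2 rf.
have [M1 [M10 H1]] := rschwartz_bounded (rschwartzD1 rf1).
have [M2 [M20 H2]] := rschwartz_bounded (rschwartzD2 rf1).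
have [M3 [M30 H3]] := rschwartz_bounded (rschwartzD2 rf2).
exists (M1 + M2 + M3); split; first by rewrite !addr_ge0.
have B1 y : `|D1 (D1 f) y| <= M1 + M2 + M3.
  by apply: (le_trans (H1 y)); rewrite -addrA lerDl addr_ge0.
have B2 y : `|D2 (D1 f) y| <= M1 + M2 + M3.
  by apply: (le_trans (H2 y)); rewrite addrAC lerDr addr_ge0.
have B3 y : `|D2 (D2 f) y| <= M1 + M2 + M3.
  by apply: (le_trans (H3 y)); rewrite lerDr addr_ge0.
exact: (taylor_bound (fun y => smooth_differentiable y rf.1)
  (fun y => smooth_differentiable y rf1.1) (fun y => smooth_differentiable y rf2.1) B1 B2 B3).
Qed.

Section Superposition.
Context {d : measure_display} {Q : measurableType d}.
Variables (nu : {measure set Q -> \bar R}) (k : Q -> R) (z : Q -> R * R).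
Hypothesis mk : measurable_fun setT k.
Hypothesis k0 : forall q, 0 <= k q.
Hypothesis mz : measurable_fun setT (z : Q -> mR2).
Hypothesis moment : forall N : nat,
  (\int[nu]_q (k q * (1 + enorm (z q)) ^+ N)%:E < +oo)%E.

(** The convolution of [f] with the image under [z] of the measure of density [k]. *)
Definition superpose (f : R * R -> R) (x : R * R) : R := \int[nu]_q (k q * f (x - z q)).

Lemma integrable_moment (N : nat) :
  nu.-integrable setT (EFin \o (fun q => k q * (1 + enorm (z q)) ^+ N)).
Proof.
have menorm : measurable_fun setT (fun q => enorm (z q)) := measurableT_comp measurable_enorm mz.
apply/integrableP; split.
  apply/measurable_EFinP; apply: measurable_funM => //.
  by apply: measurable_funX; exact: measurable_funD.
apply: le_lt_trans (moment N).
rewrite le_eqVlt; apply/orP; left; apply/eqP; apply: eq_integral => q _ /=.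
by rewrite ger0_norm// mulr_ge0// exprn_ge0// addr_ge0// enorm_ge0.
Qed.

Lemma integrable_superpose (f : R * R -> R) (x : R * R) :
  measurable_fun [set: mR2] f -> (exists B, 0 <= B /\ forall x, `|f x| <= B) ->
  nu.-integrable setT (EFin \o (fun q => k q * f (x - z q))).
Proof.
move=> mf [B [B0 HB]].
have ki : nu.-integrable setT (EFin \o (fun q => B * (k q * (1 + enorm (z q)) ^+ 0))).
  rewrite (_ : EFin \o _ = (fun q => B%:E * (k q * (1 + enorm (z q)) ^+ 0)%:E)%E).
    by apply: integrableZl => //; exact: (integrable_moment 0).
  by apply/funext => q /=; rewrite EFinM.
apply: le_integrable ki => //.
  apply/measurable_EFinP; apply: measurable_funM => //.
  apply: (measurableT_comp mf).
  exact: (measurableT_comp (measurable_reflect2 x) mz).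
move=> q _ /=; rewrite lee_fin expr0 mulr1 !normrM (ger0_norm (k0 q)) (ger0_norm B0).
by rewrite mulrC ler_wpM2r.
Qed.

(** The second order remainder of [f] is uniform, so it can be integrated. *)
Lemma superpose_expansion (f f1 f2 : R * R -> R) (M : R) (x h : R * R) :
  (forall y, nu.-integrable setT (EFin \o (fun q => k q * f (y - z q)))) ->
  nu.-integrable setT (EFin \o (fun q => k q * f1 (x - z q))) ->
  nu.-integrable setT (EFin \o (fun q => k q * f2 (x - z q))) ->
  (forall x h : R * R, `|f (x + h) - f x - (f1 x * h.1 + f2 x * h.2)| <= M * (`|h.1| + `|h.2|) ^+ 2) ->
  `|superpose f (x + h) - superpose f x - (superpose f1 x * h.1 + superpose f2 x * h.2)| <=
    (\int[nu]_q (k q * (1 + enorm (z q)) ^+ 0)) * M * (`|h.1| + `|h.2|) ^+ 2.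
Proof.
move=> If I1 I2 HM.
have IZ (g : Q -> R) (c : R) : nu.-integrable setT (EFin \o g) ->
    nu.-integrable setT (EFin \o (fun q => g q * c)).
  move=> gi; rewrite (_ : EFin \o _ = (fun q => (g q)%:E * c%:E)%E); last first.
    by apply/funext => q /=; rewrite EFinM.
  exact: integrableZr.
have ID (g1 g2 : Q -> R) : nu.-integrable setT (EFin \o g1) -> nu.-integrable setT (EFin \o g2) ->
    nu.-integrable setT (EFin \o (fun q => g1 q + g2 q)).
  move=> gi1 gi2; rewrite (_ : EFin \o _ = (EFin \o g1) \+ (EFin \o g2))%E; last first.
    by apply/funext => q /=; rewrite EFinD.
  exact: integrableD.
have IB (g1 g2 : Q -> R) : nu.-integrable setT (EFin \o g1) -> nu.-integrable setT (EFin \o g2) ->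
    nu.-integrable setT (EFin \o (fun q => g1 q - g2 q)).
  move=> gi1 gi2; rewrite (_ : EFin \o _ = (EFin \o g1) \- (EFin \o g2))%E; last first.
    by apply/funext => q /=; rewrite EFinB.
  exact: integrableB.
have J1 := IZ _ h.1 I1. have J2 := IZ _ h.2 I2.
have J3 := ID _ _ J1 J2. have J4 := IB _ _ (If (x + h)) (If x).
have J5 := IB _ _ J4 J3.
have -> : superpose f (x + h) - superpose f x - (superpose f1 x * h.1 + superpose f2 x * h.2) =
    \int[nu]_q (k q * f (x + h - z q) - k q * f (x - z q) -
      (k q * f1 (x - z q) * h.1 + k q * f2 (x - z q) * h.2)).
  rewrite (RintegralB measurableT J4 J3) (RintegralB measurableT (If (x + h)) (If x)).
  by rewrite (RintegralD measurableT J1 J2) (RintegralZr _ measurableT I1) (RintegralZr _ measurableT I2).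
apply: (le_trans (le_normr_Rintegral measurableT J5)).
rewrite -mulrA -(RintegralZr _ measurableT (integrable_moment 0)).
apply: le_Rintegral => //.
- exact: (integrable_norm J5).
- exact: (IZ _ _ (integrable_moment 0)).
- move=> q _; rewrite expr0 mulr1.
  have -> : k q * f (x + h - z q) - k q * f (x - z q) -
      (k q * f1 (x - z q) * h.1 + k q * f2 (x - z q) * h.2) =
      k q * (f ((x - z q) + h) - f (x - z q) - (f1 (x - z q) * h.1 + f2 (x - z q) * h.2)).
    by rewrite [x - z q + h]addrAC; ring.
  by rewrite normrM (ger0_norm (k0 q)) ler_wpM2l.
Qed.

Lemma rschwartz_integrable (f : R * R -> R) (x : R * R) : rschwartz f ->
  nu.-integrable setT (EFin \o (fun q => k q * f (x - z q))).
Proof.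
by move=> rf; apply: integrable_superpose; [exact: rschwartz_measurable|exact: rschwartz_bounded].
Qed.

Lemma superpose_diff (f : R * R -> R) (x : R * R) : rschwartz f ->
  [/\ differentiable (superpose f) x, D1 (superpose f) x = superpose (D1 f) x &
      D2 (superpose f) x = superpose (D2 f) x].
Proof.
move=> rf; have [M [M0 HM]] := rschwartz_taylor rf.
exact: (differentiable_of_expansion (fun h => superpose_expansion h
  (fun y => rschwartz_integrable y rf) (rschwartz_integrable x (rschwartzD1 rf))
  (rschwartz_integrable x (rschwartzD2 rf)) HM)).
Qed.

Lemma pderiv_superpose (a : nat * nat) (f : R * R -> R) : rschwartz f ->
  pderiv a (superpose f) = superpose (pderiv a f).
Proof.
case: a => a1 a2 rf; rewrite /pderiv /=.
have [-> rf2] : iter a2 (fun g => D2 g) (superpose f) = superpose (iter a2 (fun g => D2 g) f) /\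
    rschwartz (iter a2 (fun g => D2 g) f).
  elim: a2 => //= a2 [-> rg]; split; last exact: rschwartzD2.
  by apply/funext => x; have [_ _ E] := superpose_diff x rg; exact: E.
move: (iter a2 _ f) rf2 => g rg.
suff [] : iter a1 (fun g => D1 g) (superpose g) = superpose (iter a1 (fun g => D1 g) g) /\
    rschwartz (iter a1 (fun g => D1 g) g) by [].
elim: a1 => //= a1 [-> rg']; split; last exact: rschwartzD1.
by apply/funext => x; have [_ E _] := superpose_diff x rg'; exact: E.
Qed.

Lemma rschwartz_pderiv (a : nat * nat) (f : R * R -> R) : rschwartz f -> rschwartz (pderiv a f).
Proof.
case: a => a1 a2 rf; rewrite /pderiv /=.
have rf2 : rschwartz (iter a2 (fun g => D2 g) f) by elim: a2 => //= a2; exact: rschwartzD2.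
by elim: a1 => //= a1; exact: rschwartzD1.
Qed.

(** Derivatives commute with the average, so it is enough to bound the decay of
    averages of Schwartz functions; that follows from Peetre's inequality and the
    finite moments. *)
Lemma rschwartz_superpose (f : R * R -> R) : rschwartz f -> rschwartz (superpose f).
Proof.
move=> rf; split=> [a x _|n a].
  by rewrite pderiv_superpose//; have [E _ _] := superpose_diff x (rschwartz_pderiv a rf); exact: E.
rewrite pderiv_superpose//; have := rschwartz_pderiv a rf; move: (pderiv a f) => g rg.
have [B [B0 HB]] := rschwartz_decay n rg.
exists (\int[nu]_q (k q * (1 + enorm (z q)) ^+ n) * B) => x.
have x0 : 0 <= (1 + enorm x) ^+ n by rewrite exprn_ge0// addr_ge0// enorm_ge0.
have gi := rschwartz_integrable x rg.
apply: (@le_trans _ _ ((1 + enorm x) ^+ n * \int[nu]_q `|k q * g (x - z q)|)).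
  by rewrite ler_wpM2l// /superpose le_normr_Rintegral.
have gi' : nu.-integrable setT (EFin \o (fun q => `|k q * g (x - z q)|)).
  exact: (integrable_norm gi).
rewrite -RintegralZl// -RintegralZr//; last exact: integrable_moment.
apply: le_Rintegral => //.
- rewrite (_ : EFin \o _ = (fun q => ((1 + enorm x) ^+ n)%:E * (`|k q * g (x - z q)|)%:E)%E); last first.
    by apply/funext => q /=; rewrite EFinM.
  exact: integrableZl.
- rewrite (_ : EFin \o _ = (fun q => (k q * (1 + enorm (z q)) ^+ n)%:E * B%:E)%E); last first.
    by apply/funext => q /=; rewrite EFinM.
  by apply: integrableZr => //; exact: integrable_moment.
- move=> q _; rewrite normrM (ger0_norm (k0 q)).
  rewrite mulrCA -mulrA ler_wpM2l//.
  apply: (@le_trans _ _ ((1 + enorm (z q)) ^+ n * (1 + enorm (x - z q)) ^+ n * `|g (x - z q)|)).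
    by rewrite ler_wpM2r// onep_enorm_le.
  by rewrite -mulrA ler_wpM2l ?exprn_ge0 ?addr_ge0 ?enorm_ge0.
Qed.

End Superposition.
End SchwartzClass.

(** * Moments and Fourier transform of the kernel *)

Section KernelMoments.
Context {R : realType}.
Local Notation leb := (@lebesgue_measure R).
Local Notation leb2 := (@plane R).
Local Notation mR := (measurableTypeR R).
Local Notation mR2 := (mR * mR)%type.
Local Notation mQ := (mR * mR2)%type.
Local Notation leb3 := (sigma_finite_product leb leb2).

(** With r = e^(t/2) and s = |z| / r one has 1 + |z| <= e^(r + s).  Completing
    squares, N (r + s) <= r^2 / 2 + s^2 / 8 + 3 N^2; the term s^2 / 8 is absorbed
    by doubling the time, and r^2 / 2 is half of the exponent e^t that [weight]
    provides. *)
Lemma heat_moment (N : nat) (t : R) (z : R * R) :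
  heat t z * (1 + enorm z) ^+ N <=
  2 * expR (3 * N%:R ^+ 2) * (expR (expR t / 2) * heat (t + ln 2) z).
Proof.
set r := expR (t / 2); have r0 : 0 < r by exact: expR_gt0.
have rr : r ^+ 2 = expR t by rewrite -expRM_natl; congr expR; field.
set s := enorm z / r; have s0 : 0 <= s by rewrite divr_ge0 ?enorm_ge0 ?ltW.
have ss : s ^+ 2 = (z.1 ^+ 2 + z.2 ^+ 2) * expR (- t).
  rewrite /s exprMn sqr_sqrtr ?addr_ge0 ?sqr_ge0//.
  by rewrite exprVn rr expRN.
have H1 : 1 + enorm z <= expR (r + s).
  have -> : enorm z = r * s by rewrite /s mulrCA divff ?mulr1// gt_eqF.
  rewrite expRD; apply: (@le_trans _ _ ((1 + r) * (1 + s))); first by nra.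
  by apply: ler_pM; rewrite ?expR_ge1Dx ?addr_ge0// ltW.
have H2 : (1 + enorm z) ^+ N <= expR (expR t / 2 + s ^+ 2 / 8 + 3 * N%:R ^+ 2).
  apply: (@le_trans _ _ (expR (r + s) ^+ N)).
    by apply: lerXn2r; rewrite ?nnegrE ?expR_ge0// addr_ge0// enorm_ge0.
  rewrite -expRM_natl ler_expR -rr.
  have n0 : 0 <= N%:R :> R by [].
  by have := sqr_ge0 (r - N%:R); have := sqr_ge0 (s - 4 * N%:R); nra.
apply: (le_trans (ler_wpM2l (heat_ge0 t z) H2)).
rewrite le_eqVlt; apply/orP; left; apply/eqP.
rewrite expRD expRD.
have -> : heat t z * (expR (expR t / 2) * expR (s ^+ 2 / 8) * expR (3 * N%:R ^+ 2)) =
  expR (3 * N%:R ^+ 2) * (expR (expR t / 2) * (expR (s ^+ 2 / 8) * heat t z)) by ring.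
have -> : 2 * expR (3 * N%:R ^+ 2) * (expR (expR t / 2) * heat (t + ln 2) z) =
  expR (3 * N%:R ^+ 2) * (expR (expR t / 2) * (2 * heat (t + ln 2) z)) by ring.
do 2 congr (_ * _).
rewrite ss mulrDl mulrDl expRD /heat.
have -> : expR (z.1 ^+ 2 * expR (- t) / 8) * expR (z.2 ^+ 2 * expR (- t) / 8) *
  (heat1 t z.1 * heat1 t z.2) = (expR (z.1 ^+ 2 * expR (- t) / 8) * heat1 t z.1) *
  (expR (z.2 ^+ 2 * expR (- t) / 8) * heat1 t z.2) by ring.
have S : expR (ln 2 / 2) * expR (ln 2 / 2) = 2 :> R by rewrite -expRD -splitr lnK ?posrE.
by rewrite (heat1_spread t z.1) (heat1_spread t z.2) mulrACA S.
Qed.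

Lemma kern_moment (b : R) (N : nat) : 0 < b ->
  (\int[leb3]_q (kern b q * (1 + enorm q.2) ^+ N)%:E < +oo)%E.
Proof.
move=> b0; have g0 := gamma_int_gt0 b0.
pose K := 2 * expR (3 * N%:R ^+ 2) / gamma_int b.
have K0 : 0 <= K by rewrite divr_ge0 ?(ltW g0)// mulr_ge0 ?expR_ge0.
pose Phi (q : R * (R * R)) := expR (b * q.1 - 2^-1 * expR q.1) * heat (q.1 + ln 2) q.2.
have mPhi : measurable_fun [set: mQ] Phi.
  apply: measurable_funM; first by meas.
  have mf : measurable_fun [set: mQ] (fun q : mQ => (q.1 + ln 2, q.2) : mQ).
    by apply: measurable_fun_pair; [meas|exact: measurable_snd].
  exact: (measurableT_comp measurable_heat mf).
have Phi0 q : 0 <= Phi q by rewrite mulr_ge0 ?expR_ge0 ?heat_ge0.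
apply: (@le_lt_trans _ _ (\int[leb3]_q (K%:E * (Phi q)%:E))%E).
  apply: ge0_le_integral => //.
  - by move=> q _; rewrite lee_fin mulr_ge0 ?kern_ge0// exprn_ge0// addr_ge0// enorm_ge0.
  - apply/measurable_EFinP; apply: measurable_funM; first exact: measurable_kern.
    apply: measurable_funX; apply: measurable_funD => //.
    exact: (measurableT_comp measurable_enorm measurable_snd).
  - by apply: measurable_funeM; exact/measurable_EFinP.
  - move=> q _; rewrite -EFinM lee_fin /kern.
    have -> : weight b q.1 * heat q.1 q.2 / gamma_int b * (1 + enorm q.2) ^+ N =
      (weight b q.1 / gamma_int b) * (heat q.1 q.2 * (1 + enorm q.2) ^+ N) by ring.
    apply: (@le_trans _ _ ((weight b q.1 / gamma_int b) *
      (2 * expR (3 * N%:R ^+ 2) * (expR (expR q.1 / 2) * heat (q.1 + ln 2) q.2)))).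
      by rewrite ler_wpM2l ?heat_moment// divr_ge0 ?expR_ge0 ?ltW.
    rewrite le_eqVlt; apply/orP; left; apply/eqP; rewrite /K /Phi /weight.
    have -> : expR (b * q.1 - 2^-1 * expR q.1) = expR (b * q.1 - expR q.1) * expR (expR q.1 / 2).
      by rewrite -expRD; congr expR; field.
    by ring.
rewrite ge0_integralZl//; [|exact/measurable_EFinP|by move=> q _; rewrite lee_fin].
have -> : (\int[leb3]_q (Phi q)%:E = \int[leb]_t \int[leb2]_z (Phi (t, z))%:E)%E.
  apply: (@ge0_integral3 R (fun q => (Phi q)%:E)); first exact/measurable_EFinP.
  by move=> q; rewrite lee_fin.
have -> : (\int[leb]_t \int[leb2]_z (Phi (t, z))%:E =
    \int[leb]_t (expR (b * t - 2^-1 * expR t))%:E)%E.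
  apply: eq_integral => t _; rewrite /Phi/=.
  under eq_integral do rewrite EFinM.
  rewrite ge0_integralZl//.
  - by rewrite integral_heat mule1.
  - apply/measurable_EFinP; exact: (measurableT_comp measurable_heat (measurable_pair1 (t + ln 2))).
  - by move=> z _; rewrite lee_fin heat_ge0.
by rewrite integral_weight_scale// -EFinM ltry.
Qed.

End KernelMoments.

Section Fubini.
Context {R : realType} d1 d2 (T1 : measurableType d1) (T2 : measurableType d2).
Variables (m1 : {sigma_finite_measure set T1 -> \bar R}) (m2 : {sigma_finite_measure set T2 -> \bar R}).

Lemma Rintegral_fubini (f : T1 * T2 -> R) :
  (sigma_finite_product m1 m2).-integrable setT (EFin \o f) ->
  (forall x, m2.-integrable setT (EFin \o (fun y => f (x, y)))) ->
  \int[sigma_finite_product m1 m2]_w f w = \int[m1]_x \int[m2]_y f (x, y).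
Proof.
move=> fi fxi; rewrite /Rintegral; congr fine.
transitivity (\int[m1]_x fubini_F m2 (EFin \o f) x)%E.
  apply/esym; exact: (integral12_prod_meas1 (m1 := m1) (m2 := m2) fi).
apply: eq_integral => x _; rewrite /fubini_F /= fineK//.
exact: (integrable_fin_num measurableT (fxi x)).
Qed.

End Fubini.

Section KernelFourier.
Context {R : realType}.
Local Notation leb := (@lebesgue_measure R).
Local Notation leb2 := (@plane R).
Local Notation mR := (measurableTypeR R).
Local Notation mR2 := (mR * mR)%type.
Local Notation mQ := (mR * mR2)%type.
Local Notation leb3 := (sigma_finite_product leb leb2).

Lemma integrableZ_real d (T : measurableType d) (mu : {measure set T -> \bar R}) (f : T -> R) (c : R) :
  mu.-integrable setT (EFin \o f) -> mu.-integrable setT (EFin \o (fun x => c * f x)).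
Proof.
move=> fi; rewrite (_ : EFin \o _ = (fun x => c%:E * (f x)%:E)%E); last first.
  by apply/funext => x /=; rewrite EFinM.
exact: integrableZl.
Qed.

Lemma plane_prod (f1 f2 : R -> R) :
  leb.-integrable setT (EFin \o f1) -> leb.-integrable setT (EFin \o f2) ->
  leb2.-integrable setT (EFin \o (fun z => f1 z.1 * f2 z.2)) /\
  \int[leb2]_z (f1 z.1 * f2 z.2) = (\int[leb]_u f1 u) * (\int[leb]_u f2 u).
Proof.
move=> i1 i2.
have mf1 : measurable_fun [set: mR] f1 by apply/measurable_EFinP; exact: (measurable_int leb i1).
have mf2 : measurable_fun [set: mR] f2 by apply/measurable_EFinP; exact: (measurable_int leb i2).
have mf : measurable_fun [set: mR2] (fun z : mR2 => f1 z.1 * f2 z.2).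
  by apply: measurable_funM; [exact: (measurableT_comp mf1 measurable_fst)|exact: (measurableT_comp mf2 measurable_snd)].
have fi : leb2.-integrable setT (EFin \o (fun z => f1 z.1 * f2 z.2)).
  apply/integrableP; split; first exact/measurable_EFinP.
  have [_ J1] := integrableP _ _ _ i1; have [_ J2] := integrableP _ _ _ i2.
  rewrite plane_tonelli//; last first.
    by apply: measurableT_comp => //; exact/measurable_EFinP.
  pose c := (\int[leb]_u `|(f2 u)%:E|)%E.
  have cE : c = (fine c)%:E by rewrite fineK// ge0_fin_numE//; exact: integral_ge0.
  have -> : (\int[leb]_u fubini_F leb (fun z : mR2 => `|(f1 z.1 * f2 z.2)%:E|) u =
      \int[leb]_u (`|(f1 u)%:E| * c))%E.
    apply: eq_integral => u _; rewrite /fubini_F /c -ge0_integralZl//.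
      by apply: eq_integral => v _ /=; rewrite -EFinM -normrM.
    by apply: measurableT_comp => //; exact/measurable_EFinP.
  rewrite cE ge0_integralZr//; last 2 first.
  - by apply: measurableT_comp => //; exact/measurable_EFinP.
  - by rewrite lee_fin fine_ge0//; exact: integral_ge0.
  have I0 : (0 <= \int[leb]_u `|(f1 u)%:E|)%E by exact: integral_ge0.
  by apply: lte_mul_pinfty; rewrite ?ge0_fin_numE// -cE.
split => //; rewrite /plane Rintegral_fubini//; last by move=> x; exact: (integrableZ_real (f1 x) i2).
under eq_Rintegral => u _ do rewrite /= (RintegralZl _ measurableT i2).
by rewrite (RintegralZr _ measurableT i1).
Qed.

Lemma trig_heat1_integrable (t y : R) :
  leb.-integrable setT (EFin \o (fun u => cos (u * y) * heat1 t u)) /\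
  leb.-integrable setT (EFin \o (fun u => sin (u * y) * heat1 t u)).
Proof.
have mh : measurable_fun [set: mR] (heat1 t) by rewrite heat1E; exact: measurable_normal_pdf.
split; apply: (@integrable_le_heat1 _ t 1).
- apply: measurable_funM => //.
  apply: (measurableT_comp (continuous_measurable_fun (@continuous_cos R))); exact: measurable_funM.
- move=> u; rewrite normrM (ger0_norm (ltW (heat1_gt0 t u))) ler_pM2r ?heat1_gt0//.
  by rewrite ler_norml cos_geN1 cos_le1.
- apply: measurable_funM => //.
  apply: (measurableT_comp (continuous_measurable_fun (@continuous_sin R))); exact: measurable_funM.
- move=> u; rewrite normrM (ger0_norm (ltW (heat1_gt0 t u))) ler_pM2r ?heat1_gt0//.
  by rewrite ler_norml sin_geN1 sin_le1.
Qed.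

Lemma heat_fourier (t : R) (y : R * R) :
  [/\ leb2.-integrable setT (EFin \o (fun z => cos (dotp z y) * heat t z)),
      leb2.-integrable setT (EFin \o (fun z => sin (dotp z y) * heat t z)),
      \int[leb2]_z (cos (dotp z y) * heat t z) = expR (- (expR t * enorm y ^+ 2)) &
      \int[leb2]_z (sin (dotp z y) * heat t z) = 0].
Proof.
have [c1 s1] := trig_heat1_integrable t y.1; have [c2 s2] := trig_heat1_integrable t y.2.
have [icc Ecc] := plane_prod c1 c2; have [iss Ess] := plane_prod s1 s2.
have [isc Esc] := plane_prod s1 c2; have [ics Ecs] := plane_prod c1 s2.
have cE : (fun z : R * R => cos (dotp z y) * heat t z) =
    (fun z => cos (z.1 * y.1) * heat1 t z.1 * (cos (z.2 * y.2) * heat1 t z.2) -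
      sin (z.1 * y.1) * heat1 t z.1 * (sin (z.2 * y.2) * heat1 t z.2)).
  by apply/funext => z; rewrite /dotp cosD /heat; ring.
have sE : (fun z : R * R => sin (dotp z y) * heat t z) =
    (fun z => sin (z.1 * y.1) * heat1 t z.1 * (cos (z.2 * y.2) * heat1 t z.2) +
      cos (z.1 * y.1) * heat1 t z.1 * (sin (z.2 * y.2) * heat1 t z.2)).
  by apply/funext => z; rewrite /dotp sinD /heat; ring.
rewrite cE sE; split.
- by have := integrableB measurableT icc iss.
- by have := integrableD measurableT isc ics.
- rewrite RintegralB// Ecc Ess !integral_heat1_cos !integral_heat1_sin mul0r subr0 -expRD.
  by congr expR; rewrite sqr_sqrtr ?addr_ge0 ?sqr_ge0//; ring.
- by rewrite RintegralD// Esc Ecs !integral_heat1_sin mul0r mulr0 addr0.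
Qed.

Lemma measurable_dotp (y : R * R) : measurable_fun [set: mR2] (fun z : mR2 => dotp z y).
Proof. by rewrite /dotp; meas. Qed.

Lemma integrable_kern (b : R) (e : R * R -> R) : 0 < b -> measurable_fun [set: mR2] e ->
  (forall z, `|e z| <= 1) ->
  leb3.-integrable setT (EFin \o (fun q => kern b q * e q.2)).
Proof.
move=> b0 me e1.
have ki : leb3.-integrable setT (EFin \o kern b).
  apply/integrableP; split; first by apply/measurable_EFinP; exact: measurable_kern.
  have -> : (\int[leb3]_q `|(EFin \o kern b) q| = \int[leb3]_q (kern b q)%:E)%E.
    by apply: eq_integral => q _ /=; rewrite ger0_norm// kern_ge0.
  by rewrite integral_kern// ltry.
apply: le_integrable ki => //.
  apply/measurable_EFinP; apply: measurable_funM; first exact: measurable_kern.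
  exact: (measurableT_comp me measurable_snd).
by move=> q _ /=; rewrite lee_fin normrM ler_piMr.
Qed.

(** The subordination formula: by Fubini the Gaussian integral in z is taken
    first, and the scaled Gamma integral with w = 1 + |y|^2 remains. *)
Lemma kern_fourier (b : R) (y : R * R) : 0 < b ->
  \int[leb3]_q (kern b q * cos (dotp q.2 y)) = (1 + enorm y ^+ 2) `^ (- b) /\
  \int[leb3]_q (kern b q * sin (dotp q.2 y)) = 0.
Proof.
move=> b0; have g0 := gamma_int_gt0 b0.
have mcos : measurable_fun [set: mR2] (fun z : mR2 => cos (dotp z y)).
  exact: (measurableT_comp (continuous_measurable_fun (@continuous_cos R)) (measurable_dotp y)).
have msin : measurable_fun [set: mR2] (fun z : mR2 => sin (dotp z y)).
  exact: (measurableT_comp (continuous_measurable_fun (@continuous_sin R)) (measurable_dotp y)).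
have cos1 z : `|cos (dotp z y)| <= 1 by rewrite ler_norml cos_geN1 cos_le1.
have sin1 z : `|sin (dotp z y)| <= 1 by rewrite ler_norml sin_geN1 sin_le1.
have ic := integrable_kern b0 mcos cos1; have is_ := integrable_kern b0 msin sin1.
have w0 : 0 < 1 + enorm y ^+ 2 by rewrite ltr_wpDr ?sqr_ge0.
split.
- rewrite Rintegral_fubini//; last first.
    move=> t; have [hc _ _ _] := heat_fourier t y.
    have := integrableZ_real (weight b t / gamma_int b) hc; apply: eq_integrable => //.
    by move=> z _ /=; congr EFin; rewrite /kern/=; ring.
  have -> : \int[leb]_t \int[leb2]_z (kern b (t, z) * cos (dotp (t, z).2 y)) =
      \int[leb]_t ((gamma_int b)^-1 * expR (b * t - (1 + enorm y ^+ 2) * expR t)).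
    apply: eq_Rintegral => t _; have [hc _ Ec _] := heat_fourier t y.
    have -> : (fun z => kern b (t, z) * cos (dotp (t, z).2 y)) =
        (fun z => weight b t / gamma_int b * (cos (dotp z y) * heat t z)).
      by apply/funext => z; rewrite /kern/=; ring.
    rewrite RintegralZl// Ec /weight mulrAC -expRD mulrC; congr (_ * expR _); ring.
  rewrite /Rintegral.
  under eq_integral do rewrite EFinM.
  rewrite ge0_integralZl//.
  + by rewrite integral_weight_scale// -EFinM /= mulrA mulVf ?mul1r// gt_eqF.
  + by apply/measurable_EFinP; meas.
  + by rewrite lee_fin invr_ge0 (ltW g0).
- rewrite Rintegral_fubini//; last first.
    move=> t; have [_ hs _ _] := heat_fourier t y.
    have := integrableZ_real (weight b t / gamma_int b) hs; apply: eq_integrable => //.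
    by move=> z _ /=; congr EFin; rewrite /kern/=; ring.
  rewrite /Rintegral integral0_eq// => t _; have [_ hs _ Es] := heat_fourier t y.
  have E := RintegralZl (weight b t / gamma_int b) measurableT hs.
  rewrite Es mulr0 in E; congr EFin; rewrite -[RHS]E.
  by apply: eq_Rintegral => z _; rewrite /kern/=; ring.
Qed.

End KernelFourier.

(** * The potential and its adjoint *)

Section Pairing.
Context {R : realType}.
Local Notation leb := (@lebesgue_measure R).
Local Notation leb2 := (@plane R).
Local Notation mR := (measurableTypeR R).
Local Notation mR2 := (mR * mR)%type.
Local Notation mQ := (mR * mR2)%type.
Local Notation leb3 := (sigma_finite_product leb leb2).
Variables (b : R).
Hypothesis b0 : 0 < b.

Definition bessel_potential (f : R * R -> R) : R * R -> R := superpose leb3 (kern b) snd f.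

(** The pointwise real-valued counterpart of [potential]: it takes a default value
    where the integral diverges. *)
Definition adjoint_potential (e : R * R -> R) (x : R * R) : R :=
  \int[leb3]_q (kern b q * e (x + q.2)).

Let mker : measurable_fun [set: mQ] (kern b). Proof. exact: measurable_kern. Qed.
Let ker0 q : 0 <= kern b q. Proof. exact: kern_ge0. Qed.
Let msnd : measurable_fun [set: mQ] (snd : mQ -> mR2). Proof. exact: measurable_snd. Qed.
Let mom (N : nat) : (\int[leb3]_q (kern b q * (1 + enorm q.2) ^+ N)%:E < +oo)%E.
Proof. exact: kern_moment. Qed.

Lemma rschwartz_bessel_potential f : rschwartz f -> rschwartz (bessel_potential f).
Proof. exact: (rschwartz_superpose mker ker0 msnd mom). Qed.

Section Adjoint.
Variable e : R * R -> R.
Hypothesis me : measurable_fun [set: mR2] e.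

Lemma measurable_adjoint : measurable_fun [set: mR2] (adjoint_potential e).
Proof.
pose g (w : mR2 * mQ) : R := kern b w.2 * e (w.1 + w.2.2).
have mg : measurable_fun [set: mR2 * mQ] g.
  apply: measurable_funM; first exact: (measurableT_comp mker measurable_snd).
  exact: (measurable_shift me).
have mpos (h : mR2 * mQ -> R) : measurable_fun [set: mR2 * mQ] h ->
    measurable_fun [set: mR2] (fun x : mR2 => \int[leb3]_q (Num.max (h (x, q)) 0)%:E)%E.
  move=> mh; apply: (@measurable_fun_fubini_tonelli_F _ _ mR2 mQ R leb3 (fun w => (Num.max (h w) 0)%:E)).
    by apply/measurable_EFinP; exact: measurable_maxr.
  by move=> w; rewrite lee_fin le_max lexx orbT.
have mI : measurable_fun [set: mR2] (fun x : mR2 => \int[leb3]_q (g (x, q))%:E)%E.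
  have E x : (\int[leb3]_q (g (x, q))%:E = \int[leb3]_q (Num.max (g (x, q)) 0)%:E -
      \int[leb3]_q (Num.max (- g (x, q)) 0)%:E)%E.
    rewrite integralE; congr (_ - _)%E; apply: eq_integral => q _.
      by rewrite funeposE /= EFin_max.
    by rewrite funenegE /= EFin_max.
  rewrite (_ : (fun x => _) = (fun x : mR2 => \int[leb3]_q (Num.max (g (x, q)) 0)%:E -
      \int[leb3]_q (Num.max (- g (x, q)) 0)%:E)%E); last exact/funext.
  apply: emeasurable_funB; first exact: (mpos g mg).
  by apply: (mpos (fun w => - g w)); exact: measurableT_comp.
exact: (measurableT_comp (fine_measurable measurableT) mI).
Qed.

Lemma adjoint_le_potential x :
  (`|adjoint_potential e x|%R%:E <= potential b (fun y => `|e y|%R) x)%E.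
Proof.
have mF : measurable_fun [set: mQ] (fun q : mQ => (kern b q * e (x + q.2)%R)%:E).
  apply/measurable_EFinP; apply: measurable_funM => //.
  exact: (measurableT_comp (measurable_shift me) (measurable_pair1 x)).
rewrite /adjoint_potential /Rintegral.
have H := le_abse_integral leb3 measurableT mF.
have -> : potential b (fun y => `|e y|%R) x = (\int[leb3]_q `|(kern b q * e (x + q.2)%R)%:E|)%E.
  by apply: eq_integral => q _ /=; rewrite normrM (ger0_norm (ker0 q)).
apply: le_trans H.
by case: (\int[leb3]_q _)%E => [r| |] //=; rewrite normr0 leey.
Qed.

Variable f : R * R -> R.
Hypothesis rf : rschwartz f.
Hypothesis fin : (\int[leb2]_x (potential b (fun y => `|e y|%R) x * `|f x|%R%:E) < +oo)%E.

Let F (x : R * R) (q : R * (R * R)) : R := kern b q * (e (x + q.2) * f x).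
Let G (y : R * R) (q : R * (R * R)) : R := kern b q * (e y * f (y - q.2)).

Let mf : measurable_fun [set: mR2] f. Proof. exact: rschwartz_measurable. Qed.

Let mF : measurable_fun [set: mR2 * mQ] (fun w : mR2 * mQ => F w.1 w.2).
Proof.
apply: measurable_funM; first exact: (measurableT_comp mker measurable_snd).
apply: measurable_funM; first exact: (measurable_shift me).
exact: (measurableT_comp mf measurable_fst).
Qed.

Let GE y q : G y q = F (y - q.2) q.
Proof. by rewrite /G /F subrK. Qed.

Let mG : measurable_fun [set: mR2 * mQ] (fun w : mR2 * mQ => G w.1 w.2).
Proof.
under eq_fun do rewrite GE.
have msub : measurable_fun [set: mR2 * mQ] (fun w : mR2 * mQ => (w.1 - w.2.2, w.2)).
  apply: measurable_fun_pair; last exact: measurable_snd.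
  by apply: measurable_fun_pair => /=; meas.
exact: (measurableT_comp mF msub).
Qed.

Let mFE : measurable_fun [set: mR2 * mQ] (fun w : mR2 * mQ => (F w.1 w.2)%:E).
Proof. exact/measurable_EFinP. Qed.

Let mGE : measurable_fun [set: mR2 * mQ] (fun w : mR2 * mQ => (G w.1 w.2)%:E).
Proof. exact/measurable_EFinP. Qed.

Let intF : (sigma_finite_product leb2 leb3).-integrable setT (fun w => (F w.1 w.2)%:E).
Proof.
have mabs : measurable_fun [set: mR2] (fun y : mR2 => `|e y|) by exact: measurableT_comp.
have E := @potential_formE R b (fun y => `|e y|) (fun x => `|f x|) b0 mabs
  (fun x => normr_ge0 _) (fun x => normr_ge0 _).
have [_] := @integrable12ltyP _ _ mR2 mQ R leb2 leb3 (fun w => (F w.1 w.2)%:E) mFE.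
apply; move: fin; rewrite E; apply: le_lt_trans.
rewrite le_eqVlt; apply/orP; left; apply/eqP.
apply: eq_integral => x _; apply: eq_integral => q _.
by rewrite /F /= normrM (ger0_norm (ker0 q)) normrM.
Qed.

Let intG : (sigma_finite_product leb2 leb3).-integrable setT (fun w => (G w.1 w.2)%:E).
Proof.
have mA : measurable_fun [set: mR2 * mQ] (fun w : mR2 * mQ => `|(F w.1 w.2)%:E|%E).
  by apply: measurableT_comp => //; exact: mFE.
have S := @ge0_integral_swap R (fun x q => `|(F x q)%:E|%E) mA (fun _ _ => abse_ge0 _).
have [H _] := @integrable12ltyP _ _ mR2 mQ R leb2 leb3 (fun w => (F w.1 w.2)%:E) mFE.
have {}H := H intF.
have [_] := @integrable12ltyP _ _ mR2 mQ R leb2 leb3 (fun w => (G w.1 w.2)%:E) mGE.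
apply; apply: le_lt_trans H; rewrite le_eqVlt; apply/orP; left; apply/eqP.
apply/esym; apply: (etrans S).
by apply: eq_integral => y _; apply: eq_integral => q _; rewrite GE.
Qed.

Let swap_FG : (\int[leb2]_x \int[leb3]_q (F x q)%:E = \int[leb2]_y \int[leb3]_q (G y q)%:E)%E.
Proof.
transitivity (\int[leb3]_q \int[leb2]_x (F x q)%:E)%E.
  exact: (@Fubini _ _ mR2 mQ R leb2 leb3 (fun w => (F w.1 w.2)%:E) intF).
transitivity (\int[leb3]_q \int[leb2]_y (G y q)%:E)%E; last first.
  apply/esym; exact: (@Fubini _ _ mR2 mQ R leb2 leb3 (fun w => (G w.1 w.2)%:E) intG).
apply: eq_integral => q _; apply/esym.
under eq_integral do rewrite GE.
apply: (@integral2_translate _ (- q.2)%R (fun y => (F y q)%:E)).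
by apply/measurable_EFinP; exact: (measurableT_comp mF (measurable_pair2 q)).
Qed.

Let secG y : (\int[leb3]_q (G y q)%:E = (e y * bessel_potential f y)%:E)%E.
Proof.
have fi := rschwartz_integrable mker ker0 msnd mom y rf.
have -> : (\int[leb3]_q (G y q)%:E = \int[leb3]_q ((e y)%:E * (kern b q * f (y - q.2))%:E))%E.
  by apply: eq_integral => q _; rewrite -EFinM /G; congr EFin; ring.
rewrite integralZl// EFinM /bessel_potential /superpose /Rintegral fineK//.
exact: (integrable_fin_num measurableT fi).
Qed.

(* The integrability of F x can be transferred to e only where f x <> 0; both
   sides vanish where f x = 0. *)
Let secF x : leb3.-integrable setT (fun q => (F x q)%:E) ->
  (\int[leb3]_q (F x q)%:E = (adjoint_potential e x * f x)%:E)%E.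
Proof.
move=> Fi; have [fx0|fx0] := eqVneq (f x) 0.
  rewrite fx0 mulr0; under eq_integral do rewrite /F fx0 mulr0 mulr0.
  by rewrite integral0.
have ei : leb3.-integrable setT (EFin \o (fun q => kern b q * e (x + q.2))).
  have := integrableZ_real (f x)^-1 Fi; apply: eq_integrable => //.
  by move=> q _ /=; congr EFin; rewrite /F; field.
have -> : (\int[leb3]_q (F x q)%:E = \int[leb3]_q ((f x)%:E * (kern b q * e (x + q.2))%:E))%E.
  by apply: eq_integral => q _; rewrite -EFinM /F; congr EFin; ring.
rewrite integralZl// mulrC EFinM /adjoint_potential /Rintegral fineK//.
exact: (integrable_fin_num measurableT ei).
Qed.

Lemma integrable_pairing : leb2.-integrable setT (EFin \o (fun y => e y * bessel_potential f y)).
Proof.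
have := @integrable_fubini_F _ _ mR2 mQ R leb2 leb3 (fun w => (G w.1 w.2)%:E) intG.
apply: eq_integrable => //.
by move=> y _; rewrite /fubini_F /=; exact: secG.
Qed.

Let aeE : ae_eq leb2 setT (fun x => \int[leb3]_q (F x q)%:E)%E
  (fun x => (adjoint_potential e x * f x)%:E).
Proof.
have := @ae_integrable1 _ _ mR2 mQ R leb2 leb3 (fun w => (F w.1 w.2)%:E) intF.
by apply: filterS => x Fi _; exact: secF.
Qed.

Let mIF : measurable_fun [set: mR2] (fun x : mR2 => \int[leb3]_q (F x q)%:E)%E.
Proof. exact: (@measurable_fubini_F _ _ mR2 mQ R leb2 leb3 (fun w => (F w.1 w.2)%:E) intF). Qed.

Let mAf : measurable_fun [set: mR2] (fun x : mR2 => (adjoint_potential e x * f x)%:E).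
Proof. by apply/measurable_EFinP; apply: measurable_funM => //; exact: measurable_adjoint. Qed.

Lemma integrable_adjoint_pairing :
  leb2.-integrable setT (EFin \o (fun x => adjoint_potential e x * f x)).
Proof.
have mabs : measurable_fun [set: mR2] (fun y : mR2 => `|e y|) by exact: measurableT_comp.
have mP := measurable_potential b0 mabs (fun x => normr_ge0 _).
apply/integrableP; split; first exact: mAf.
apply: le_lt_trans fin; apply: ge0_le_integral => //.
- by apply: measurableT_comp => //; exact: mAf.
- apply: emeasurable_funM => //.
  by apply/measurable_EFinP; exact: measurableT_comp.
- move=> x _; rewrite /= normrM EFinM; apply: lee_wpmul2r; first by rewrite lee_fin.
  exact: adjoint_le_potential.
Qed.

(** Fubini on the plane times the parameter space; the two sides are the integrals
    of [F] and of its translate [G]. *)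
Lemma pairing_adjoint : \int[leb2]_y (e y * bessel_potential f y) =
  \int[leb2]_x (adjoint_potential e x * f x).
Proof.
rewrite /Rintegral; congr fine.
under eq_integral do rewrite -secG.
rewrite -swap_FG.
by apply: ae_eq_integral; [exact: measurableT|exact: mIF|exact: mAf|exact: aeE].
Qed.

End Adjoint.
End Pairing.

Section SchwartzIntegrable.
Context {R : realType}.
Local Notation leb := (@lebesgue_measure R).
Local Notation leb2 := (@plane R).
Local Notation mR := (measurableTypeR R).
Local Notation mR2 := (mR * mR)%type.
Local Notation mQ := (mR * mR2)%type.
Local Notation leb3 := (sigma_finite_product leb leb2).

Lemma integrable_oneDsqrV : leb.-integrable setT (EFin \o (fun u : R => (oneDsqr u)^-1)).
Proof.
have c : continuous (fun u : R => (oneDsqr u)^-1) by exact: continuous_oneDsqrV.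
have p (u : R) : 0 <= (oneDsqr u)^-1 by rewrite invr_ge0 (le_trans ler01)// oneDsqr_ge1.
apply/integrableP; split; first by apply/measurable_EFinP; exact: continuous_measurable_fun.
have -> : (\int[leb]_u `|(EFin \o (fun u : R => (oneDsqr u)^-1%R)) u| =
    \int[leb]_u ((oneDsqr u)^-1)%:E)%E.
  by apply: eq_integral => u _ /=; rewrite ger0_norm.
rewrite ge0_symfun_integralT//; last by move=> u; rewrite /= /oneDsqr sqrrN.
by rewrite -set_itvcy integral0y_oneDsqr -EFinM ltry.
Qed.

(** Decay of order four dominates the product of 1 / (1 + x1^2) and
    1 / (1 + x2^2). *)
Lemma rschwartz_L1 (f : R * R -> R) : rschwartz f -> leb2.-integrable setT (EFin \o f).
Proof.
move=> rf; have [B [B0 HB]] := rschwartz_decay 4 rf.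
have [i _] := plane_prod integrable_oneDsqrV integrable_oneDsqrV.
apply: (le_integrable _ _ _ (integrableZ_real B i)) => //.
  by apply/measurable_EFinP; exact: rschwartz_measurable.
move=> z _ /=; rewrite lee_fin.
have o1 : 0 < oneDsqr z.1 := lt_le_trans ltr01 (oneDsqr_ge1 _).
have o2 : 0 < oneDsqr z.2 := lt_le_trans ltr01 (oneDsqr_ge1 _).
rewrite [leRHS]ger0_norm; last by rewrite mulr_ge0// mulr_ge0// invr_ge0 ltW.
rewrite -invfM ler_pdivlMr ?mulr_gt0// mulrC; apply: le_trans (HB z).
apply: ler_wpM2r => //.
have e0 := enorm_ge0 z.
have e2 : enorm z ^+ 2 = z.1 ^+ 2 + z.2 ^+ 2 by rewrite sqr_sqrtr// addr_ge0 ?sqr_ge0.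
have -> : (1 + enorm z) ^+ 4 = (1 + enorm z) ^+ 2 * (1 + enorm z) ^+ 2 by rewrite -exprD.
have s1 := sqr_ge0 z.1; have s2 := sqr_ge0 z.2.
by apply: ler_pM; rewrite ?(ltW o1) ?(ltW o2)// /oneDsqr sqrrD expr1n mul1r e2 mulr2n; lra.
Qed.

Lemma rschwartz_Lq (q : R) (f : R * R -> R) : 1 < q -> rschwartz f ->
  (\int[leb2]_x (`|f x| `^ q)%:E < +oo)%E.
Proof.
move=> q1 rf; have [B [B0 HB]] := rschwartz_bounded rf.
have q0 : 0 < q := lt_trans ltr01 q1.
have /integrableP[mf fi] := rschwartz_L1 rf.
have mfq : measurable_fun [set: mR2] (fun x : mR2 => `|f x| `^ q).
  apply: (measurableT_comp (measurable_powR q)); apply: measurableT_comp => //.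
  exact: rschwartz_measurable.
apply: (@le_lt_trans _ _ (\int[leb2]_x ((B `^ (q - 1))%:E * `|(f x)%:E|))%E).
  apply: ge0_le_integral; first exact: measurableT.
  - by move=> x _; rewrite lee_fin powR_ge0.
  - exact/measurable_EFinP.
  - by apply: measurable_funeM; apply: measurableT_comp.
  - move=> x _; rewrite /= -EFinM lee_fin -(mulr_powRB1 (normr_ge0 _) q0) mulrC.
    by apply: ler_wpM2r => //; apply: ge0_ler_powR; rewrite ?nnegrE//; lra.
rewrite ge0_integralZl//; last 2 first.
- by apply: measurableT_comp.
- by rewrite lee_fin powR_ge0.
by apply: lte_mul_pinfty; rewrite ?lee_fin ?powR_ge0.
Qed.

Section RealFourier.
Variables (b : R) (f : R * R -> R) (y : R * R).
Hypotheses (b0 : 0 < b) (rf : rschwartz f).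

Let bounded_pairing (e : R * R -> R) : measurable_fun [set: mR2] e -> (forall x, `|e x| <= 1) ->
  (\int[leb2]_x (potential b (fun y => `|e y|%R) x * `|f x|%R%:E) < +oo)%E.
Proof.
move=> me e1; have /integrableP[mf fi] := rschwartz_L1 rf.
have mabs : measurable_fun [set: mR2] (fun y : mR2 => `|e y|) by exact: measurableT_comp.
apply: le_lt_trans fi; apply: ge0_le_integral; first exact: measurableT.
- by move=> x _; apply: mule_ge0; [apply: potential_ge0|rewrite lee_fin].
- apply: emeasurable_funM; first exact: (measurable_potential b0 mabs (fun x => normr_ge0 _)).
  by apply/measurable_EFinP; apply: measurableT_comp => //; exact/measurable_EFinP.
- by apply: measurableT_comp.
- move=> x _; rewrite -[leRHS]mul1e; apply: lee_wpmul2r; first by rewrite lee_fin.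
  rewrite -(integral_kern b0); apply: ge0_le_integral; first exact: measurableT.
  + by move=> q _; rewrite lee_fin mulr_ge0// kern_ge0.
  + apply/measurable_EFinP; apply: measurable_funM; first exact: measurable_kern.
    exact: (measurableT_comp (measurable_shift mabs) (measurable_pair1 x)).
  + by apply/measurable_EFinP; exact: measurable_kern.
  + by move=> q _; rewrite lee_fin ler_piMr// kern_ge0.
Qed.

Let mcos : measurable_fun [set: mR2] (fun z : mR2 => cos (dotp z y)).
Proof. exact: (measurableT_comp (continuous_measurable_fun (@continuous_cos R)) (measurable_dotp y)). Qed.

Let msin : measurable_fun [set: mR2] (fun z : mR2 => sin (dotp z y)).
Proof. exact: (measurableT_comp (continuous_measurable_fun (@continuous_sin R)) (measurable_dotp y)). Qed.

Let cos1 z : `|cos (dotp z y)| <= 1.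
Proof. by rewrite ler_norml cos_geN1 cos_le1. Qed.

Let sin1 z : `|sin (dotp z y)| <= 1.
Proof. by rewrite ler_norml sin_geN1 sin_le1. Qed.

Let dotpD (x z : R * R) : dotp (x + z) y = dotp x y + dotp z y.
Proof. by rewrite /dotp /=; ring. Qed.

Let adjoint_cos x : adjoint_potential b (fun z => cos (dotp z y)) x =
  (1 + enorm y ^+ 2) `^ (- b) * cos (dotp x y).
Proof.
have [Ec Es] := kern_fourier y b0.
have ic := integrable_kern b0 mcos cos1; have is_ := integrable_kern b0 msin sin1.
rewrite /adjoint_potential.
have -> : (fun q : mQ => kern b q * cos (dotp (x + q.2) y)) =
    (fun q : mQ => cos (dotp x y) * (kern b q * cos (dotp q.2 y)) -
                   sin (dotp x y) * (kern b q * sin (dotp q.2 y))).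
  by apply/funext => q; rewrite dotpD cosD; ring.
rewrite (RintegralB measurableT (integrableZ_real _ ic) (integrableZ_real _ is_)).
by rewrite (RintegralZl _ measurableT ic) (RintegralZl _ measurableT is_) Ec Es; ring.
Qed.

Let adjoint_sin x : adjoint_potential b (fun z => sin (dotp z y)) x =
  (1 + enorm y ^+ 2) `^ (- b) * sin (dotp x y).
Proof.
have [Ec Es] := kern_fourier y b0.
have ic := integrable_kern b0 mcos cos1; have is_ := integrable_kern b0 msin sin1.
rewrite /adjoint_potential.
have -> : (fun q : mQ => kern b q * sin (dotp (x + q.2) y)) =
    (fun q : mQ => sin (dotp x y) * (kern b q * cos (dotp q.2 y)) +
                   cos (dotp x y) * (kern b q * sin (dotp q.2 y))).
  by apply/funext => q; rewrite dotpD sinD; ring.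
rewrite (RintegralD measurableT (integrableZ_real _ ic) (integrableZ_real _ is_)).
by rewrite (RintegralZl _ measurableT ic) (RintegralZl _ measurableT is_) Ec Es; ring.
Qed.

Lemma trig_integrable :
  leb2.-integrable setT (EFin \o (fun x => cos (dotp x y) * f x)) /\
  leb2.-integrable setT (EFin \o (fun x => sin (dotp x y) * f x)).
Proof.
have fi := rschwartz_L1 rf; have mf := rschwartz_measurable rf.
split; apply: (le_integrable _ _ _ fi) => //.
- by apply/measurable_EFinP; exact: measurable_funM.
- by move=> x _ /=; rewrite lee_fin normrM ler_piMl.
- by apply/measurable_EFinP; exact: measurable_funM.
- by move=> x _ /=; rewrite lee_fin normrM ler_piMl.
Qed.

(** By Fubini the potential can be moved to the cosine, which is an eigenfunction
    up to an odd term that integrates to zero. *)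
Lemma cos_bessel_potential :
  \int[leb2]_x (cos (dotp x y) * bessel_potential b f x) =
  (1 + enorm y ^+ 2) `^ (- b) * \int[leb2]_x (cos (dotp x y) * f x).
Proof.
rewrite (pairing_adjoint b0 mcos rf (bounded_pairing mcos cos1)).
have [ic _] := trig_integrable.
rewrite -(RintegralZl _ measurableT ic); apply: eq_Rintegral => x _.
by rewrite adjoint_cos mulrA.
Qed.

Lemma sin_bessel_potential :
  \int[leb2]_x (sin (dotp x y) * bessel_potential b f x) =
  (1 + enorm y ^+ 2) `^ (- b) * \int[leb2]_x (sin (dotp x y) * f x).
Proof.
rewrite (pairing_adjoint b0 msin rf (bounded_pairing msin sin1)).
have [_ is_] := trig_integrable.
rewrite -(RintegralZl _ measurableT is_); apply: eq_Rintegral => x _.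
by rewrite adjoint_sin mulrA.
Qed.

End RealFourier.
End SchwartzIntegrable.

(** * The Bessel operators on complex Schwartz functions *)

Section ComplexAssembly.
Context {R : realType}.
Local Open Scope complex_scope.
Local Notation leb := (@lebesgue_measure R).
Local Notation leb2 := (@plane R).
Local Notation mR := (measurableTypeR R).
Local Notation mR2 := (mR * mR)%type.
Implicit Types (phi : R * R -> R[i]).

Lemma real_mulC (w u v : R) : w%:C * (u +i* v) = (w * u) +i* (w * v).
Proof. by apply/eqP; rewrite eq_complex /= !mul0r subr0 addr0 !eqxx. Qed.

Lemma normr_Re_le (x : R[i]) : `|complex.Re x| <= Normc.normc x.
Proof. by case: x => a b /=; rewrite -sqrtr_sqr ler_wsqrtr// lerDl sqr_ge0. Qed.

Lemma normr_Im_le (x : R[i]) : `|complex.Im x| <= Normc.normc x.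
Proof. by case: x => a b /=; rewrite -sqrtr_sqr ler_wsqrtr// lerDr sqr_ge0. Qed.

Lemma normc_le_add (x : R[i]) : Normc.normc x <= `|complex.Re x| + `|complex.Im x|.
Proof.
case: x => a b /=; rewrite -(ger0_norm (addr_ge0 (normr_ge0 a) (normr_ge0 b))) -sqrtr_sqr.
rewrite ler_wsqrtr// sqrrD !real_normK ?num_real//.
by rewrite addrAC lerDl mulrn_wge0// mulr_ge0.
Qed.

Lemma normc_ge0 (x : R[i]) : 0 <= Normc.normc x.
Proof. exact: le_trans (normr_ge0 _) (normr_Re_le x). Qed.

Lemma schwartz_Re phi : schwartz phi -> rschwartz (fun x => complex.Re (phi x)).
Proof.
move=> [[sr si] d]; split => // k a; have [B HB] := d k a; exists B => x.
apply: le_trans (HB x); rewrite ler_wpM2l ?exprn_ge0 ?addr_ge0 ?enorm_ge0//.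
exact: (normr_Re_le (Cpderiv a phi x)).
Qed.

Lemma schwartz_Im phi : schwartz phi -> rschwartz (fun x => complex.Im (phi x)).
Proof.
move=> [[sr si] d]; split => // k a; have [B HB] := d k a; exists B => x.
apply: le_trans (HB x); rewrite ler_wpM2l ?exprn_ge0 ?addr_ge0 ?enorm_ge0//.
exact: (normr_Im_le (Cpderiv a phi x)).
Qed.

Lemma schwartz_of_rschwartz (f g : R * R -> R) : rschwartz f -> rschwartz g ->
  schwartz (fun x => f x +i* g x).
Proof.
move=> [sf df] [sg dg]; split; first by split.
move=> k a; have [B HB] := df k a; have [B' HB'] := dg k a; exists (B + B') => x.
have e0 : 0 <= (1 + enorm x) ^+ k by rewrite exprn_ge0// addr_ge0// enorm_ge0.
apply: le_trans (lerD (HB x) (HB' x)); rewrite -mulrDr ler_wpM2l//.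
exact: (normc_le_add (Cpderiv a (fun x => f x +i* g x) x)).
Qed.

Definition Cbessel_potential (b : R) phi (x : R * R) : R[i] :=
  bessel_potential b (fun x => complex.Re (phi x)) x +i*
  bessel_potential b (fun x => complex.Im (phi x)) x.

Lemma schwartz_Cbessel_potential (b : R) phi : 0 < b -> schwartz phi ->
  schwartz (Cbessel_potential b phi).
Proof.
move=> b0 sphi; apply: schwartz_of_rschwartz; apply: rschwartz_bessel_potential => //.
- exact: schwartz_Re.
- exact: schwartz_Im.
Qed.

Lemma Cintegral_fourier (f g : R * R -> R) (y : R * R) : rschwartz f -> rschwartz g ->
  Cintegral (fun x => expi (- dotp x y) * (f x +i* g x)) =
  (\int[leb2]_x (cos (dotp x y) * f x) + \int[leb2]_x (sin (dotp x y) * g x)) +i*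
  (\int[leb2]_x (cos (dotp x y) * g x) - \int[leb2]_x (sin (dotp x y) * f x)).
Proof.
move=> rf rg; have [cf sf] := trig_integrable y rf; have [cg sg] := trig_integrable y rg.
rewrite -(RintegralD measurableT cf sg) -(RintegralB measurableT cg sf).
rewrite /Cintegral; congr (_ +i* _); apply: eq_Rintegral => x _;
  rewrite /expi /= cosN sinN; ring.
Qed.

Lemma fourier_Cbessel_potential (b : R) phi (y : R * R) : 0 < b -> schwartz phi ->
  fourier (Cbessel_potential b phi) y = ((1 + enorm y ^+ 2) `^ (- b))%:C * fourier phi y.
Proof.
move=> b0 sphi; have rr := schwartz_Re sphi; have ri := schwartz_Im sphi.
have phiE : phi = (fun x => complex.Re (phi x) +i* complex.Im (phi x)).
  by apply/funext => x; case: (phi x).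
rewrite /fourier {2}phiE mulrCA; congr (_ * _).
rewrite /Cbessel_potential !Cintegral_fourier//;
  [|exact: rschwartz_bessel_potential|exact: rschwartz_bessel_potential].
rewrite !(cos_bessel_potential y b0) // !(sin_bessel_potential y b0)//.
by rewrite real_mulC; congr (_ +i* _); ring.
Qed.

(** On the Fourier side (1 + |y|^2)^(gamma1 / 2) is the product of
    (1 + |y|^2)^(gamma0 / 2) and the symbol of the potential. *)
Lemma bessel_op_potential (b gamma0 gamma1 : R) phi : 0 < b -> gamma1 / 2 = gamma0 / 2 - b ->
  schwartz phi -> bessel_op gamma1 phi = bessel_op gamma0 (Cbessel_potential b phi).
Proof.
move=> b0 gb sphi; rewrite /bessel_op; congr inv_fourier; apply/funext => y.
rewrite fourier_Cbessel_potential// mulrA; congr (_ * _).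
have w0 : 1 + enorm y ^+ 2 != 0 by rewrite gt_eqF// ltr_wpDr ?sqr_ge0.
rewrite gb powRD; last by apply/implyP.
by rewrite -rmorphM.
Qed.

End ComplexAssembly.

(** * The embedding on the plane *)

Section PotentialPairing.
Context {R : realType}.
Local Notation leb := (@lebesgue_measure R).
Local Notation leb2 := (@plane R).
Local Notation mR := (measurableTypeR R).
Local Notation mR2 := (mR * mR)%type.
Local Notation mQ := (mR * mR2)%type.
Local Notation leb3 := (sigma_finite_product leb leb2).

Lemma le_potential (b : R) (f g : R * R -> R) (x : R * R) :
  0 < b -> measurable_fun [set: mR2] f -> measurable_fun [set: mR2] g ->
  (forall x, 0 <= f x) -> (forall x, f x <= g x) ->
  (potential b f x <= potential b g x)%E.
Proof.
move=> b0 mf mg f0 fg; apply: ge0_le_integral; first exact: measurableT.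
- by move=> q _; rewrite lee_fin mulr_ge0// kern_ge0.
- apply/measurable_EFinP; apply: measurable_funM; first exact: measurable_kern.
  exact: (measurableT_comp (measurable_shift mf) (measurable_pair1 x)).
- apply/measurable_EFinP; apply: measurable_funM; first exact: measurable_kern.
  exact: (measurableT_comp (measurable_shift mg) (measurable_pair1 x)).
- by move=> q _; rewrite lee_fin ler_wpM2l// kern_ge0.
Qed.

Lemma potentialZ (b k : R) (f : R * R -> R) (x : R * R) :
  0 < b -> measurable_fun [set: mR2] f -> (forall x, 0 <= f x) -> 0 <= k ->
  potential b (fun y => k * f y) x = (k%:E * potential b f x)%E.
Proof.
move=> b0 mf f0 k0; rewrite /potential -ge0_integralZl//.
- by apply: eq_integral => q _; rewrite -EFinM mulrCA.
- apply/measurable_EFinP; apply: measurable_funM; first exact: measurable_kern.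
  exact: (measurableT_comp (measurable_shift mf) (measurable_pair1 x)).
- by move=> q _; rewrite lee_fin mulr_ge0// kern_ge0.
Qed.

Lemma powR_invl (k r : R) : 0 <= k -> k^-1 `^ r = (k `^ r)^-1.
Proof. by move=> k0; rewrite -(powR_inv1 k0) -powRrM mulrC powRrM powR_inv1 ?powR_ge0. Qed.

Lemma potential_Lp_scaled (b p0 p1 : R) : 0 < b -> 1 < p0 -> p0 <= p1 ->
  p0^-1 - p1^-1 <= b ->
  exists C, 0 <= C /\ forall (f : R * R -> R) (k : R), 0 < k ->
    measurable_fun [set: mR2] f -> (forall x, 0 <= f x) ->
    (\int[leb2]_x (f x `^ p0)%:E <= (k `^ p0)%:E)%E ->
    (\int[leb2]_x potential b f x `^ p1 <= ((C * k) `^ p1)%:E)%E.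
Proof.
move=> b0 p01 pp sob; have [C [C0 HC]] := potential_Lp b0 p01 pp sob.
exists C; split => // f k k0 mf f0 fk.
have mh : measurable_fun [set: mR2] (fun x => k^-1 * f x) by exact: measurable_funM.
have h0 x : 0 <= k^-1 * f x by rewrite mulr_ge0// invr_ge0 ltW.
have := HC _ mh h0; have -> : (\int[leb2]_x ((k^-1 * f x) `^ p0)%:E =
    ((k `^ p0)^-1)%:E * \int[leb2]_x (f x `^ p0)%:E)%E.
  rewrite -ge0_integralZl//.
  - apply: eq_integral => x _; rewrite -EFinM powRM// ?invr_ge0 ?(ltW k0)//.
    by rewrite (powR_invl _ (ltW k0)).
  - by apply/measurable_EFinP; exact: (measurableT_comp (measurable_powR p0) mf).
  - by move=> x _; rewrite lee_fin powR_ge0.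
  - by rewrite lee_fin invr_ge0 powR_ge0.
have kp : 0 < k `^ p0 by rewrite powR_gt0.
have /[swap] /[apply] : (((k `^ p0)^-1)%:E * \int[leb2]_x (f x `^ p0)%:E <= 1)%E.
  apply: (@le_trans _ _ (((k `^ p0)^-1)%:E * (k `^ p0)%:E)%E).
    by apply: lee_wpmul2l => //; rewrite lee_fin invr_ge0 ltW.
  by rewrite -EFinM mulVf ?gt_eqF.
have -> : (\int[leb2]_x potential b (fun y => k^-1 * f y)%R x `^ p1 =
    ((k `^ p1)^-1)%:E * \int[leb2]_x potential b f x `^ p1)%E.
  rewrite -ge0_integralZl//.
  - apply: eq_integral => x _; rewrite potentialZ ?invr_ge0 ?(ltW k0)//.
    rewrite poweRM ?lee_fin ?invr_ge0 ?(ltW k0)//; last exact: potential_ge0.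
    rewrite poweR_EFin; congr (_%:E * _)%E.
    by rewrite (powR_invl _ (ltW k0)).
  - apply: (measurableT_comp (measurable_poweR p1)); exact: measurable_potential.
  - by move=> x _; exact: poweR_ge0.
  - by rewrite lee_fin invr_ge0 powR_ge0.
have kp1 : 0 < k `^ p1 by rewrite powR_gt0.
move=> H; rewrite powRM ?(ltW k0)// EFinM muleC.
have -> : (\int[leb2]_x potential b f x `^ p1 =
    (k `^ p1)%:E * (((k `^ p1)^-1)%:E * \int[leb2]_x potential b f x `^ p1))%E.
  by rewrite muleA -EFinM mulfV ?gt_eqF// mul1e.
by apply: lee_wpmul2l => //; rewrite lee_fin ltW.
Qed.

(** Young's inequality without its constants, allowing an infinite value of [a]. *)
Lemma ereal_young (p q t : R) (a : \bar R) : 1 < p -> 1 < q -> p^-1 + q^-1 = 1 ->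
  0 <= t -> (0 <= a)%E -> (a * t%:E <= a `^ p + (t `^ q)%:E)%E.
Proof.
move=> p1 q1 pq t0; have [p0 q0] : 0 < p /\ 0 < q by split; lra.
case: a => [a| |] // a0; last first.
  by rewrite poweRyr ?gt_eqF// addye// leey.
rewrite poweR_EFin -EFinM -EFinD lee_fin; rewrite lee_fin in a0.
apply: le_trans (conjugate_powR a0 t0 p0 q0 pq) _.
by apply: lerD; rewrite ler_pdivrMr// ler_peMr ?powR_ge0// ltW.
Qed.

Lemma pairing_lty (b p1 : R) (h e f : R * R -> R) : 0 < b -> 1 < p1 ->
  measurable_fun [set: mR2] h -> measurable_fun [set: mR2] e ->
  (forall x, `|e x| <= h x) ->
  (\int[leb2]_x potential b h x `^ p1 < +oo)%E -> rschwartz f ->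
  (\int[leb2]_x (potential b (fun y => `|e y|%R) x * `|f x|%R%:E) < +oo)%E.
Proof.
move=> b0 p1_gt1 mh me eh hfin rf.
have p10 : 0 < p1 by lra.
have h0 x : 0 <= h x := le_trans (normr_ge0 _) (eh x).
have mae : measurable_fun [set: mR2] (fun y => `|e y|) by exact: measurableT_comp.
have mf : measurable_fun [set: mR2] f by exact: rschwartz_measurable.
have mP : measurable_fun [set: mR2] (potential b h) by exact: measurable_potential.
pose q := (1 - p1^-1)^-1.
have pi1 : p1^-1 < 1 by rewrite invf_lt1.
have pi0 : 0 < p1^-1 by rewrite invr_gt0.
have q1 : 1 < q by rewrite /q invf_gt1; lra.
have pq : p1^-1 + q^-1 = 1 by rewrite /q invrK; lra.
have fq := rschwartz_Lq q1 rf.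
have mpow : measurable_fun [set: mR2] (fun x => potential b h x `^ p1)%E.
  exact: (measurableT_comp (measurable_poweR p1) mP).
have mfq : measurable_fun [set: mR2] (fun x => (`|f x| `^ q)%:E).
  apply/measurable_EFinP; apply: (measurableT_comp (measurable_powR q)).
  exact: measurableT_comp.
apply: (@le_lt_trans _ _ (\int[leb2]_x (potential b h x `^ p1 + (`|f x| `^ q)%:E))%E).
  apply: ge0_le_integral; first exact: measurableT.
  - by move=> x _; rewrite mule_ge0 ?potential_ge0 ?lee_fin.
  - apply: emeasurable_funM; first exact: measurable_potential.
    by apply/measurable_EFinP; exact: measurableT_comp.
  - exact: emeasurable_funD.
  - move=> x _; apply: (@le_trans _ _ (potential b h x * `|f x|%R%:E)%E).
      by apply: lee_wpmul2r; rewrite ?lee_fin//; exact: le_potential.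
    by apply: ereal_young => //; exact: potential_ge0.
rewrite ge0_integralD//.
- by rewrite lte_add_pinfty.
- by move=> x _; exact: poweR_ge0.
Qed.

End PotentialPairing.

Section ComplexPairing.
Context {R : realType}.
Local Open Scope complex_scope.
Local Notation leb := (@lebesgue_measure R).
Local Notation leb2 := (@plane R).
Local Notation mR := (measurableTypeR R).
Local Notation mR2 := (mR * mR)%type.
Implicit Types (phi g : R * R -> R[i]).

Definition Cadjoint_potential (b : R) g (x : R * R) : R[i] :=
  adjoint_potential b (fun y => complex.Re (g y)) x +i*
  adjoint_potential b (fun y => complex.Im (g y)) x.

Lemma Cadjoint_potential_le (b : R) g x : 0 < b ->
  measurable_fun [set: mR2] (fun y => complex.Re (g y)) ->
  measurable_fun [set: mR2] (fun y => complex.Im (g y)) ->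
  measurable_fun [set: mR2] (fun y => Normc.normc (g y)) ->
  ((Normc.normc (Cadjoint_potential b g x))%:E <=
   2%:E * potential b (fun y => Normc.normc (g y)) x)%E.
Proof.
move=> b0 mr mi mn.
have bound (e : R * R -> R) : measurable_fun [set: mR2] e ->
    (forall y, `|e y| <= Normc.normc (g y)) ->
    (`|adjoint_potential b e x|%R%:E <= potential b (fun y => Normc.normc (g y)) x)%E.
  move=> me eg; apply: (le_trans (adjoint_le_potential b0 me x)).
  by apply: le_potential => //; exact: measurableT_comp.
have Hr := bound _ mr (fun y => normr_Re_le (g y)).
have Hi := bound _ mi (fun y => normr_Im_le (g y)).
apply: (@le_trans _ _ (`|adjoint_potential b (fun y => complex.Re (g y)) x|%R%:E +
   `|adjoint_potential b (fun y => complex.Im (g y)) x|%R%:E)%E).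
  by rewrite -EFinD lee_fin; exact: (normc_le_add (Cadjoint_potential b g x)).
have -> : (2%:E = 1%:E + 1%:E :> \bar R)%E by rewrite -EFinD.
by rewrite ge0_muleDl ?lee_fin// mul1e; exact: leeD.
Qed.

(** The product of two complex functions splits into four real pairings, each of
    which is transposed separately; they converge because the potential of the
    modulus of [g] is in L_p1 and Schwartz functions are in the dual space. *)
Lemma Cpairing_adjoint (b p1 : R) g phi : 0 < b -> 1 < p1 ->
  measurable_fun [set: mR2] (fun y => complex.Re (g y)) ->
  measurable_fun [set: mR2] (fun y => complex.Im (g y)) ->
  measurable_fun [set: mR2] (fun y => Normc.normc (g y)) ->
  (\int[leb2]_x potential b (fun y => Normc.normc (g y)) x `^ p1 < +oo)%E ->
  schwartz phi ->
  Cintegral (fun x => g x * Cbessel_potential b phi x) =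
  Cintegral (fun x => Cadjoint_potential b g x * phi x).
Proof.
move=> b0 p1_gt1 mr mi mn fin sphi.
have rr := schwartz_Re sphi; have ri := schwartz_Im sphi.
have frr := pairing_lty b0 p1_gt1 mn mr (fun y => normr_Re_le (g y)) fin rr.
have fri := pairing_lty b0 p1_gt1 mn mr (fun y => normr_Re_le (g y)) fin ri.
have fir := pairing_lty b0 p1_gt1 mn mi (fun y => normr_Im_le (g y)) fin rr.
have fii := pairing_lty b0 p1_gt1 mn mi (fun y => normr_Im_le (g y)) fin ri.
transitivity (
  (\int[leb2]_x (complex.Re (g x) * bessel_potential b (fun x => complex.Re (phi x)) x) -
   \int[leb2]_x (complex.Im (g x) * bessel_potential b (fun x => complex.Im (phi x)) x)) +i*
  (\int[leb2]_x (complex.Re (g x) * bessel_potential b (fun x => complex.Im (phi x)) x) +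
   \int[leb2]_x (complex.Im (g x) * bessel_potential b (fun x => complex.Re (phi x)) x))).
  rewrite -(RintegralB measurableT (integrable_pairing b0 mr rr frr) (integrable_pairing b0 mi ri fii)).
  rewrite -(RintegralD measurableT (integrable_pairing b0 mr ri fri) (integrable_pairing b0 mi rr fir)).
  rewrite /Cintegral; congr (_ +i* _); apply: eq_Rintegral => x _; by case: (g x).
rewrite (pairing_adjoint b0 mr rr frr) (pairing_adjoint b0 mi ri fii).
rewrite (pairing_adjoint b0 mr ri fri) (pairing_adjoint b0 mi rr fir).
rewrite -(RintegralB measurableT (integrable_adjoint_pairing b0 mr rr frr) (integrable_adjoint_pairing b0 mi ri fii)).
rewrite -(RintegralD measurableT (integrable_adjoint_pairing b0 mr ri fri) (integrable_adjoint_pairing b0 mi rr fir)).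
by rewrite /Cintegral; congr (_ +i* _); apply: eq_Rintegral => x _; case: (phi x).
Qed.

Lemma CLpnorm_ge0 (p : R) g : (0 <= CLpnorm p g)%E.
Proof. exact: Lnorm_ge0. Qed.

Lemma CLpnorm_powE (p : R) g : 0 < p ->
  (CLpnorm p g `^ p = \int[leb2]_x (Normc.normc (g x) `^ p)%:E)%E.
Proof.
move=> p0; rewrite /CLpnorm poweR_Lnorm ?gt_eqF//.
by apply: eq_integral => x _; rewrite gee0_abs ?lee_fin ?normc_ge0.
Qed.

Lemma le_CLpnorm (p k : R) g : 0 < p -> 0 <= k ->
  (\int[leb2]_x (Normc.normc (g x) `^ p)%:E <= (k `^ p)%:E)%E -> (CLpnorm p g <= k%:E)%E.
Proof.
move=> p0 k0; rewrite -CLpnorm_powE// -poweR_EFin => H.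
have := le_poweR (ltW (_ : 0 < p^-1)) _ H.
rewrite -!poweRrM mulfV ?gt_eqF// !poweRe1//; last exact: CLpnorm_ge0.
by apply; [rewrite invr_gt0|exact: poweR_ge0].
Qed.

Lemma measurable_normc g :
  measurable_fun [set: mR2] (fun y => complex.Re (g y)) ->
  measurable_fun [set: mR2] (fun y => complex.Im (g y)) ->
  measurable_fun [set: mR2] (fun y => Normc.normc (g y)).
Proof.
move=> mr mi; rewrite (_ : (fun y => _) = (fun y : mR2 =>
    (complex.Re (g y) ^+ 2 + complex.Im (g y) ^+ 2) `^ (2^-1))); last first.
  apply/funext => y; rewrite powR12_sqrt ?addr_ge0 ?sqr_ge0//.
  by case: (g y).
apply: (measurableT_comp (measurable_powR _)).
by apply: measurable_funD; apply: measurable_funX.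
Qed.

(** The scaled inequality needs a positive scale, and the norm [N] of [g] may
    vanish; so it is applied for all k > N. *)
Lemma CLpnorm_adjoint_le (b p0 p1 : R) : 0 < b -> 1 < p0 -> p0 <= p1 ->
  p0^-1 - p1^-1 <= b ->
  exists C, 0 <= C /\ forall g, CLp p0 g ->
    [/\ CLp p1 (Cadjoint_potential b g),
      (\int[leb2]_x potential b (fun y => Normc.normc (g y)) x `^ p1 < +oo)%E &
      (CLpnorm p1 (Cadjoint_potential b g) <= C%:E * CLpnorm p0 g)%E].
Proof.
move=> b0 p0_gt1 p01 sob.
have [p0_gt0 p1_gt0] : 0 < p0 /\ 0 < p1 by split; lra.
have [C [C0 HC]] := potential_Lp_scaled b0 p0_gt1 p01 sob.
exists (2 * C); split; first by rewrite mulr_ge0.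
move=> g [mr mi gfin].
have mn := measurable_normc mr mi.
have mP := measurable_potential b0 mn (fun x => normc_ge0 (g x)).
have P0 := potential_ge0 b0 (fun x => normc_ge0 (g x)).
set N := fine (CLpnorm p0 g).
have NE : CLpnorm p0 g = N%:E by rewrite fineK// ge0_fin_numE// CLpnorm_ge0.
have N0 : 0 <= N by rewrite fine_ge0// CLpnorm_ge0.
have main k : N < k ->
    (\int[leb2]_x potential b (fun y => Normc.normc (g y)) x `^ p1 <= ((C * k) `^ p1)%:E)%E.
  move=> Nk; have k0 : 0 < k := le_lt_trans N0 Nk.
  apply: HC => //; first by move=> x; exact: normc_ge0.
  rewrite -CLpnorm_powE// NE poweR_EFin lee_fin.
  by apply: ge0_ler_powR; rewrite ?nnegrE//; lra.
have mRa := measurable_adjoint b mr; have mIa := measurable_adjoint b mi.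
have bound k : N < k -> (CLpnorm p1 (Cadjoint_potential b g) <= (2 * (C * k))%:E)%E.
  move=> Nk; have k0 : 0 < k := le_lt_trans N0 Nk.
  have Ck : 0 <= C * k by rewrite mulr_ge0// ltW.
  apply: le_CLpnorm => //; first by rewrite mulr_ge0.
  apply: (@le_trans _ _ (\int[leb2]_x ((2 `^ p1)%:E *
      potential b (fun y => Normc.normc (g y)) x `^ p1))%E).
    apply: ge0_le_integral; first exact: measurableT.
    - by move=> x _; rewrite lee_fin powR_ge0.
    - apply/measurable_EFinP; apply: (measurableT_comp (measurable_powR p1)).
      exact: measurable_normc.
    - apply: measurable_funeM; exact: (measurableT_comp (measurable_poweR p1) mP).
    - move=> x _; rewrite -poweR_EFin -(poweR_EFin 2) -poweRM//.
      apply: le_poweR; rewrite ?lee_fin ?normc_ge0 ?(ltW p1_gt0)//.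
      exact: Cadjoint_potential_le.
  rewrite ge0_integralZl//; last 2 first.
  - exact: (measurableT_comp (measurable_poweR p1) mP).
  - by move=> x _; exact: poweR_ge0.
  rewrite powRM// EFinM; apply: lee_wpmul2l; first by rewrite lee_fin powR_ge0.
  exact: main.
split.
- split => //; apply: le_lt_trans (bound (N + 1) _) (ltry _); lra.
- apply: le_lt_trans (main (N + 1) _) (ltry _); lra.
- rewrite NE -EFinM; apply/lee_addgt0Pr => e e0.
  pose d := e / (2 * C + 1).
  have d0 : 0 < d by rewrite divr_gt0//; lra.
  apply: (le_trans (bound (N + d) _)); first lra.
  rewrite -EFinD lee_fin.
  have : 2 * C * d <= e by rewrite /d mulrA ler_pdivrMr; nra.
  lra.
Qed.

Lemma bessel_norm_ge0 (gamma p : R) F : (0 <= bessel_norm gamma p F)%E.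
Proof.
by apply/ereal_infP => _ [T [g [_ _ _ _ ->]]]; exact: CLpnorm_ge0.
Qed.

(** The tempered extension [T] of [F] is kept, and its representing function is
    replaced by the adjoint potential. *)
Lemma bessel_norm_le (p0 p1 gamma0 gamma1 : R) : 1 < p0 -> p0 <= p1 ->
  gamma1 <= gamma0 -> gamma1 - 2 / p1 <= gamma0 - 2 / p0 ->
  exists K, 0 <= K /\ forall F : (R * R -> R[i]) -> R[i],
    (bessel_norm gamma1 p1 F <= K%:E * bessel_norm gamma0 p0 F)%E.
Proof.
move=> p0_gt1 p01 gg sob.
have [p0_gt0 p1_gt0] : 0 < p0 /\ 0 < p1 by split; lra.
have pinv : p1^-1 <= p0^-1 by rewrite lef_pV2 ?posrE.
have [g01|gneq] := eqVneq gamma0 gamma1.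
  have pe : p0 = p1.
    by apply: invr_inj; apply/eqP; rewrite eq_le pinv andbT; lra.
  by exists 1; split => // F; rewrite mul1e g01 pe.
have glt : gamma1 < gamma0 by rewrite lt_neqAle eq_sym gneq.
pose b := (gamma0 - gamma1) / 2.
have b0 : 0 < b by rewrite divr_gt0// subr_gt0.
have sb : p0^-1 - p1^-1 <= b by rewrite /b; lra.
have gb : gamma1 / 2 = gamma0 / 2 - b by rewrite /b; lra.
have [C [C0 HC]] := CLpnorm_adjoint_le b0 p0_gt1 p01 sb.
(* C + 1 instead of C, in order to divide by the constant *)
exists (C + 1); split; first lra.
move=> F; rewrite -lee_pdivrMl; last lra.
apply/ereal_infP => _ [T [g [tT TF gp gT ->]]].
rewrite lee_pdivrMl; last lra.
have [ap fin ale] := HC g gp.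
apply: (@le_trans _ _ (CLpnorm p1 (Cadjoint_potential b g))).
  apply: ereal_inf_lbound; exists T, (Cadjoint_potential b g); split => //.
  move=> phi sphi; rewrite /bessel_dist (bessel_op_potential b0 gb sphi).
  have := gT _ (schwartz_Cbessel_potential b0 sphi); rewrite /bessel_dist => ->.
  have [mr mi _] := gp.
  apply: (Cpairing_adjoint b0 (lt_le_trans p0_gt1 p01)) => //.
  exact: measurable_normc.
apply: (le_trans ale); apply: lee_wpmul2r; first exact: CLpnorm_ge0.
by rewrite lee_fin; lra.
Qed.

End ComplexPairing.

(** * The weighted spaces *)

Section MixedNorms.
Context {R : realType}.

Lemma weight_split (c theta p : R) (nu : int) :
  c `^ (nu%:~R * (theta * p)) = (c `^ (nu%:~R * theta)) `^ p.
Proof. by rewrite mulrA powRrM. Qed.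

Lemma mixed_norm_le (kappa c : R) (xi zeta : int -> R * R -> R)
    (p0 p1 gamma0 gamma1 Theta theta : R) : 0 < c -> 1 < p0 -> p0 <= p1 ->
  gamma1 <= gamma0 -> gamma1 - 2 / p1 <= gamma0 - 2 / p0 ->
  exists K, 0 <= K /\ forall u,
    (mixed_norm kappa c xi zeta gamma1 p1 (Theta * p1) (theta * p1) u <=
     K%:E * mixed_norm kappa c xi zeta gamma0 p0 (Theta * p0) (theta * p0) u)%E.
Proof.
move=> c0 p0_gt1 p01 gg sob; have p0_gt0 : 0 < p0 by lra.
have [K [K0 HK]] := bessel_norm_le p0_gt1 p01 gg sob.
exists K; split => // u.
rewrite /mixed_norm; under eq_esum do rewrite weight_split.
under [X in (_ <= _ * X `^ _)%E]eq_esum do rewrite weight_split.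
apply: weighted_lp_norm_le => //; try by move=> nu; rewrite ?powR_gt0 ?poweR_ge0.
move=> nu; rewrite /weighted_norm; under eq_esum do rewrite weight_split.
under [X in (_ <= _ * X `^ _)%E]eq_esum do rewrite weight_split.
apply: weighted_lp_norm_le => // i; try exact: bessel_norm_ge0.
by rewrite powR_gt0.
Qed.

End MixedNorms.

Theorem proposition3p5 (R : realType) (kappa c : R) (xi zeta : int -> R * R -> R)
    (p0 p1 gamma0 gamma1 Theta theta : R)
    (hkappa : 0 < kappa < 2 * pi)
    (hc : 1 < c)
    (hxi : resolution c (angular_domain kappa)
             (boundary (angular_domain kappa)) xi)
    (hzeta : resolution c (angular_domain kappa) [set (0, 0)] zeta)
    (hp0 : 1 < p0) (hp01 : p0 <= p1)
    (hgamma : gamma1 <= gamma0)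
    (hsob : gamma1 - 2 / p1 <= gamma0 - 2 / p0) :
  mixed_space kappa c xi zeta gamma0 p0 (Theta * p0) (theta * p0) `<=`
    mixed_space kappa c xi zeta gamma1 p1 (Theta * p1) (theta * p1) /\
  exists C : R, forall u,
    mixed_space kappa c xi zeta gamma0 p0 (Theta * p0) (theta * p0) u ->
    (mixed_norm kappa c xi zeta gamma1 p1 (Theta * p1) (theta * p1) u <=
     C%:E * mixed_norm kappa c xi zeta gamma0 p0 (Theta * p0) (theta * p0) u)%E.
Proof.
have c0 : 0 < c by lra.
have [K [K0 HK]] := mixed_norm_le kappa xi zeta Theta theta c0 hp0 hp01 hgamma hsob.
split; last by exists K => u _; exact: HK.
move=> u [du fu]; split => //; apply: (le_lt_trans (HK u)).
have u0 : (0 <= mixed_norm kappa c xi zeta gamma0 p0 (Theta * p0) (theta * p0) u)%E.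
  exact: poweR_ge0.
by rewrite lte_mul_pinfty ?lee_fin.
Qed.
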